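(* Let $K$ be an algebraically closed field, let $\Lambda$ be a finite-dimensional basic $K$-algebra, and let $X_1,\ldots,X_r$ be a set of simple-minded objects in $\mathcal{D}^b(\mathrm{mod}\,\Lambda)$. Let $\mathcal{X}$ be the associated strictly unital minimal positive $A_\infty$-algebra on $\bigoplus_{m}\mathrm{Hom}(\bigoplus_iX_i,\Sigma^m\bigoplus_iX_i)$, let $Y_1,\ldots,Y_r$ be the simple $\mathcal{X}$-modules corresponding to the idempotents $\mathrm{id}_{X_1},\ldots,\mathrm{id}_{X_r}$, and let $T_1,\ldots,T_r$ be the images of $Y_1,\ldots,Y_r$ under a quasi-inverse of the triangle equivalence $(\Psi\circ\Phi)|:\mathrm{thick}(I_1,\ldots,I_r)\to\mathcal{D}_{fd}(\mathcal{X})$, where $I_1,\ldots,I_r$ are the indecomposable injective $\Lambda$-modules (all as specified in the context). Put $T=\bigoplus_iT_i$. Then: a) $T$ generates $\mathrm{thick}(I_1,\ldots,I_r)$, i.e. $\mathrm{thick}(T)=\mathrm{thick}(I_1,\ldots,I_r)$. b) For $1\le i,j\le r$ and $m\in\mathbb{Z}$, $\mathrm{Hom}(X_j,\Sigma^mT_i)=K$ if $i=j$ and $m=0$, and $\mathrm{Hom}(X_j,\Sigma^mT_i)=0$ otherwise. c) $T$ is isomorphic to a bounded complex of finitely generated injectives. d) Let $C$ be an object of $\mathcal{D}^-(\mathrm{mod}\,\Lambda)$. If $\mathrm{Hom}(C,\Sigma^mT)=0$ for all $m\in\mathbb{Z}$, then $C=0$. e) $\mathrm{Hom}(T,\Sigma^mT)=0$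 for $m>0$.
   Context: Derived categories. $\mathrm{Mod}\,\Lambda$ (resp. $\mathrm{mod}\,\Lambda$) is the category of right (resp. finite-dimensional right) $\Lambda$-modules; $\mathcal{D}^b(\mathrm{mod}\,\Lambda)$ and $\mathcal{D}^-(\mathrm{mod}\,\Lambda)$ (bounded above) are viewed inside $\mathcal{D}(\mathrm{Mod}\,\Lambda)$, where $\mathrm{Hom}$ is taken. $\Sigma$ is the suspension. $\mathrm{thick}(\mathcal{S})$ is the smallest triangulated subcategory containing $\mathcal{S}$ and stable under direct summands; ''generates'' is meant in this sense. Simple-minded objects: let $r$ be the rank of the Grothendieck group of $\mathrm{mod}\,\Lambda$. Objects $X_1,\ldots,X_r$ of $\mathcal{D}^b(\mathrm{mod}\,\Lambda)$ are simple-minded if (1) $\mathrm{Hom}(X_i,\Sigma^mX_j)=0$ for all $m<0$ and all $i,j$; (2) $\mathrm{Hom}(X_i,X_j)=K$ if $i=j$ and $0$ otherwise; (3) $\mathcal{D}^b(\mathrm{mod}\,\Lambda)=\mathrm{thick}(X_1,\ldots,X_r)$. $A_\infty$-algebras and modules (Koszul sign rule). An $A_\infty$-algebra is a graded vector space $A$ with homogeneous maps $m_n:A^{\otimes n}\to A$ of degree $2-n$, $n\ge1$, satisfying $\sum_{j+k+l=n}(-1)^{jk+l}m_{j+1+l}(\mathrm{id}^{\otimes j}\otimes m_k\otimes\mathrm{id}^{\otimes l})=0$ for all $n\ge1$. It is minimal if $m_1=0$, and strictly unital if there is $1_A\in A^0$ with $m_n(\ldots,1_A,\ldots)=0$ for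 $n\ne2$ and $m_2(1_A\otimes a)=a=m_2(a\otimes1_A)$. A (right) $A_\infty$-module over $A$ is a graded vector space $M$ with maps $m_n^M:M\otimes A^{\otimes n-1}\to M$ of degree $2-n$ satisfying the same equations (with $m^M$ used whenever the $M$-factor is involved); it is strictly unital if $m_2^M(m\otimes1_A)=m$ and, for $n\ge3$, $m_n^M(m\otimes a_2\otimes\cdots\otimes a_n)=0$ when some $a_i=1_A$. An $A_\infty$-morphism $f:M\to M'$ is a family $f_n:M\otimes A^{\otimes n-1}\to M'$ of degree $1-n$ with $\sum_{j+k+l=n}(-1)^{jk+l}f_{j+1+l}(\mathrm{id}^{\otimes j}\otimes m_k\otimes\mathrm{id}^{\otimes l})=\sum_{r+s=n}m_{s+1}(f_r\otimes\mathrm{id}^{\otimes s})$; it is strictly unital if, for $n\ge2$, $f_n(m\otimes a_2\otimes\cdots\otimes a_n)=0$ when some $a_i=1_A$, and a quasi-isomorphism if $f_1$ induces isomorphisms on cohomology. The derived category $\mathcal{D}(A)$ is obtained from the category of strictly unital $A_\infty$-modules and strictly unital $A_\infty$-morphisms by inverting quasi-isomorphisms; it is triangulated with suspension the shift. $\mathrm{per}(A)=\mathrm{thick}(A)$ is generated by the free module of rank 1, and $\mathcal{D}_{fd}(A)\subseteq\mathcal{D}(A)$ is the full subcategory of modules with finite-dimensional total cohomology. Positive algebras. A strictly unital minimal $A_\infty$-algebra $A$ is positive if $A^i=0$ for $i<0$, $A^0$ is a product of $r$ copies of $K$ for some positive integer $r$, and for $n\ne2$ one has $m_n(a_1\otimes\cdots\otimes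 a_n)=0$ if some $a_i\in A^0$. Let $1=e_1+\cdots+e_r$ be the decomposition into primitive orthogonal idempotents of $A^0$. Put $P_i=e_iA$; it is an $A_\infty$-submodule of the free module $A$, with $A_\infty$-submodule $e_iA^{>0}$ (where $A^{>0}=\bigoplus_{i>0}A^i$). The simple module corresponding to $e_i$ is $P_i/e_iA^{>0}$, one-dimensional in degree $0$. $\bar A=A/A^{>0}$ is, as $A_\infty$-module, the direct sum of the simple modules. The construction. Let $S_1,\ldots,S_r$ be representatives of the simple $\Lambda$-modules and $I_1,\ldots,I_r$ the corresponding indecomposable injective $\Lambda$-modules (so $\mathrm{Hom}(S_i,\Sigma^mI_j)$ is $K$ if $i=j,m=0$ and $0$ otherwise); $\mathrm{thick}(I_1,\ldots,I_r)=\mathrm{thick}(\mathrm{D}({}_\Lambda\Lambda))$ with $\mathrm{D}=\mathrm{Hom}_K(?,K)$. By the $A_\infty$-Morita theorem for algebraic triangulated categories (Lefèvre-Hasegawa) there is a strictly unital minimal positive $A_\infty$-algebra $\mathcal{S}$ with underlying graded algebra $\bigoplus_{m\in\mathbb{Z}}\mathrm{Hom}(\bigoplus_iS_i,\Sigma^m\bigoplus_iS_i)$ and a triangle equivalence $\Phi:\mathcal{D}^b(\mathrm{mod}\,\Lambda)\to\mathrm{per}(\mathcal{S})$ taking $S_j$ to $\bigoplus_m\mathrm{Hom}(\bigoplus_iS_i,\Sigma^mS_j)$; it restricts to a triangle equivalence $\Phi|:\mathrm{thick}(I_1,\ldots,I_r)\to\mathrm{thick}(\bar{\mathcal{S}})=\mathcal{D}_{fd}(\mathcal{S})$.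 Likewise the graded algebra $\bigoplus_m\mathrm{Hom}(\bigoplus_iX_i,\Sigma^m\bigoplus_iX_i)$ carries a strictly unital minimal $A_\infty$-structure; the resulting $A_\infty$-algebra is $\mathcal{X}$, which is positive by (1),(2), and by (3) there is a triangle equivalence $\mathcal{D}(\mathcal{S})\to\mathcal{D}(\mathcal{X})$ restricting to triangle equivalences $\Psi:\mathrm{per}(\mathcal{S})\to\mathrm{per}(\mathcal{X})$ and $\Psi|:\mathcal{D}_{fd}(\mathcal{S})\to\mathcal{D}_{fd}(\mathcal{X})$, such that the equivalence $\Psi\circ\Phi:\mathcal{D}^b(\mathrm{mod}\,\Lambda)\to\mathrm{per}(\mathcal{X})$ takes $X_i$ to the direct summand $\mathrm{id}_{X_i}\mathcal{X}$ of $\mathcal{X}$. Then $(\Psi\circ\Phi)|=\Psi|\circ\Phi|:\mathrm{thick}(I_1,\ldots,I_r)\to\mathcal{D}_{fd}(\mathcal{X})=\mathrm{thick}(\bar{\mathcal{X}})$ is a triangle equivalence. The primitive orthogonal idempotents of $\mathcal{X}^0$ are $\mathrm{id}_{X_1},\ldots,\mathrm{id}_{X_r}$, and $Y_1,\ldots,Y_r$ are the corresponding simple $\mathcal{X}$-modules. *)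

(* Defs.v *)
From HB Require Import structures.
From mathcomp Require Import all_boot all_order all_algebra.
From mathcomp Require Import falgebra.
From mathcomp Require Import boolp.
From mathcomp Require Import zify.

Set Implicit Arguments.
Unset Strict Implicit.
Unset Printing Implicit Defensive.

Import GRing.Theory.
Local Open Scope ring_scope.

(* A graded R-module is a module with an internal decomposition
   V = \bigoplus_(d : int) V_d, where V_d = {x | gr d x}. *)
Record gmod (R : nzRingType) := GMod {
  gsort :> lmodType R;
  gr : int -> gsort -> Prop;
  gr0 : forall d, gr d 0;
  gr_lin : forall d a x y, gr d x -> gr d y -> gr d (a *: x + y);
  gr_span : forall x, exists s : seq (int * gsort),
    (forall p, p \in s -> gr p.1 p.2) /\ x = \sum_(p <- s) p.2;
  gr_indep : forall (s : seq int) (c : int -> gsort), uniq s ->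
    (forall d, gr d (c d)) -> \sum_(d <- s) c d = 0 ->
    forall d, d \in s -> c d = 0 }.
Arguments gr {R} _ _ _.

(* A list of homogeneous elements, each paired with its degree. *)
Definition homogeneous (R : nzRingType) (V : gmod R) (a : seq (int * V)) :=
  forall p, p \in a -> gr V p.1 p.2.

Definition total_degree (T : Type) (a : seq (int * T)) : int :=
  \sum_(p <- a) p.1.

Section GradedConstructions.
Variable R : nzRingType.
Implicit Types V W : gmod R.

Lemma grD V d x y : gr V d x -> gr V d y -> gr V d (x + y).
Proof. by move=> hx hy; rewrite -[x]scale1r; apply: gr_lin. Qed.

Lemma grZ V d a x : gr V d x -> gr V d (a *: x).
Proof. by move=> hx; rewrite -[_ *: _]addr0; apply: gr_lin => //; apply: gr0. Qed.

Lemma grB V d x y : gr V d x -> gr V d y -> gr V d (x - y).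
Proof. by move=> hx hy; rewrite addrC -scaleN1r; apply: gr_lin. Qed.

Lemma gr_sum V d (I : eqType) (r : seq I) (F : I -> V) :
  (forall i, i \in r -> gr V d (F i)) -> gr V d (\sum_(i <- r) F i).
Proof.
move=> h; rewrite big_seq; elim/big_ind: _ => [|x y|i] //.
- exact: gr0.
- exact: grD.
- exact: h.
Qed.

Section Shift.
Variables (m : int) (V : gmod R).

Lemma gshift_span (x : V) : exists s : seq (int * V),
  (forall p, p \in s -> gr V (p.1 + m) p.2) /\ x = \sum_(p <- s) p.2.
Proof.
have [s [hs ->]] := gr_span x.
exists [seq (p.1 - m, p.2) | p <- s]; split; last by rewrite big_map.
by move=> p /mapP[q qs ->] /=; rewrite subrK; apply: hs.
Qed.

Lemma gshift_indep (s : seq int) (c : int -> V) : uniq s ->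
  (forall d, gr V (d + m) (c d)) -> \sum_(d <- s) c d = 0 ->
  forall d, d \in s -> c d = 0.
Proof.
move=> us hc hs d ds.
have := @gr_indep R V [seq e + m | e <- s] (fun e => c (e - m)).
rewrite map_inj_uniq; last exact: addIr.
move/(_ us) => h; rewrite -[d](addrK m); apply: h.
- by move=> e; have := hc (e - m); rewrite subrK.
- by rewrite big_map -[RHS]hs; apply: eq_bigr => e _; rewrite addrK.
- exact: map_f.
Qed.

Definition gshift : gmod R :=
  @GMod R V (fun d x => gr V (d + m) x) (fun d => gr0 V (d + m))
    (fun d => @gr_lin R V (d + m)) gshift_span gshift_indep.
End Shift.

Section Product.
Variables V W : gmod R.

Definition gprod_gr (d : int) (z : (V * W)%type) := gr V d z.1 /\ gr W d z.2.

Lemma gprod_lin d a (z t : (V * W)%type) :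
  gprod_gr d z -> gprod_gr d t -> gprod_gr d (a *: z + t).
Proof. by move=> [? ?] [? ?]; split; apply: gr_lin. Qed.

Lemma pair_sum (I : Type) (r : seq I) (F : I -> (V * W)%type) :
  \sum_(i <- r) F i = (\sum_(i <- r) (F i).1, \sum_(i <- r) (F i).2).
Proof. by elim: r => [|i r IH]; rewrite ?big_nil // !big_cons IH. Qed.

Lemma gprod_span (z : (V * W)%type) : exists s : seq (int * (V * W)),
  (forall p, p \in s -> gprod_gr p.1 p.2) /\ z = \sum_(p <- s) p.2.
Proof.
case: z => x y; have [s [hs ->]] := gr_span x; have [t [ht ->]] := gr_span y.
exists ([seq (p.1, (p.2, 0)) | p <- s] ++ [seq (p.1, (0, p.2)) | p <- t]).
split.
  move=> p; rewrite mem_cat => /orP[] /mapP[q qs ->] /=; split=> /=;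
    by [apply: gr0 | apply: hs | apply: ht].
rewrite big_cat !big_map !pair_sum /= !big1_eq.
by congr pair; rewrite /= ?addr0 ?add0r.
Qed.

Lemma gprod_indep (s : seq int) (c : int -> (V * W)%type) : uniq s ->
  (forall d, gprod_gr d (c d)) -> \sum_(d <- s) c d = 0 ->
  forall d, d \in s -> c d = 0.
Proof.
move=> us hc; rewrite pair_sum => -[h1 h2] d ds.
have e1 : (c d).1 = 0.
  by apply: (gr_indep (c := fun d => (c d).1) us _ h1 ds) => e; case: (hc e).
have e2 : (c d).2 = 0.
  by apply: (gr_indep (c := fun d => (c d).2) us _ h2 ds) => e; case: (hc e).
by case: (c d) e1 e2 => u v /= -> ->.
Qed.

Definition gprod : gmod R :=
  @GMod R (V * W)%type gprod_gr (fun d => conj (gr0 V d) (gr0 W d))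
    gprod_lin gprod_span gprod_indep.
End Product.

Section Stalk.
Variable S : lmodType R.

Definition gstalk_gr (d : int) (x : S) := d = 0 \/ x = 0.

Lemma gstalk_lin d a x y :
  gstalk_gr d x -> gstalk_gr d y -> gstalk_gr d (a *: x + y).
Proof.
move=> [->|->]; first by left.
by move=> [->|->]; [left | right; rewrite scaler0 addr0].
Qed.

Lemma gstalk_span (x : S) : exists s : seq (int * S),
  (forall p, p \in s -> gstalk_gr p.1 p.2) /\ x = \sum_(p <- s) p.2.
Proof.
exists [:: (0, x)]; split; last by rewrite big_seq1.
by move=> p; rewrite inE => /eqP ->; left.
Qed.

Lemma gstalk_indep (s : seq int) (c : int -> S) : uniq s ->
  (forall d, gstalk_gr d (c d)) -> \sum_(d <- s) c d = 0 ->
  forall d, d \in s -> c d = 0.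
Proof.
move=> us hc hs d ds; case: (hc d) => // d0; subst d.
rewrite (bigD1_seq 0) //= big1 ?addr0 // in hs.
by move=> e /eqP e0; case: (hc e).
Qed.

Definition gstalk : gmod R :=
  @GMod R S gstalk_gr (fun d => or_intror erefl) gstalk_lin gstalk_span
    gstalk_indep.
End Stalk.

End GradedConstructions.

Record category := Category {
  obj : Type;
  hom : obj -> obj -> Type;
  idm : forall X, hom X X;
  comp : forall X Y Z, hom Y Z -> hom X Y -> hom X Z;
  comp_idl : forall X Y (f : hom X Y), comp (idm Y) f = f;
  comp_idr : forall X Y (f : hom X Y), comp f (idm X) = f;
  compA : forall W X Y Z (h : hom Y Z) (g : hom X Y) (f : hom W X),
    comp h (comp g f) = comp (comp h g) f }.
Arguments hom {_} _ _.
Arguments idm {_} _.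
Arguments comp {_ _ _ _} _ _.

Record functor (C E : category) := Functor {
  fobj : obj C -> obj E;
  fhom : forall X Y, hom X Y -> hom (fobj X) (fobj Y);
  fhom_id : forall X, fhom (idm X) = idm (fobj X);
  fhom_comp : forall X Y Z (g : hom Y Z) (f : hom X Y),
    fhom (comp g f) = comp (fhom g) (fhom f) }.

Definition invertible (E : category) (X Y : obj E) (f : hom X Y) :=
  exists g : hom Y X, comp g f = idm X /\ comp f g = idm Y.

(* The data on a K-linear category of complexes (or of A_oo-modules) from
   which its derived category is made: linear combinations c f + g of
   morphisms, quasi-isomorphisms, all shifts Sigma^m together with the
   identifications X = Sigma^0 X and Sigma^n Sigma^m X = Sigma^(m+n) X, and
   the cone Y -> cone f -> Sigma X of a morphism f : X -> Y. *)
Record dg_model (K : fieldType) := DGModel {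
  dg_cat :> category;
  lincomb : forall X Y : obj dg_cat, K -> hom X Y -> hom X Y -> hom X Y;
  qis : forall X Y : obj dg_cat, hom X Y -> Prop;
  shift : int -> obj dg_cat -> obj dg_cat;
  shift_hom : forall (m : int) X Y, hom X Y -> hom (shift m X) (shift m Y);
  shift_zero : forall X, hom X (shift 0 X);
  shift_add : forall m n X, hom (shift n (shift m X)) (shift (m + n) X);
  cone : forall X Y : obj dg_cat, hom X Y -> obj dg_cat;
  cone_in : forall X Y (f : hom X Y), hom Y (cone f);
  cone_out : forall X Y (f : hom X Y), hom (cone f) (shift 1 X) }.
Arguments lincomb {_ _ _ _} _ _ _.
Arguments shift {_ _} _ _.
Arguments shift_hom {_ _} _ {_ _} _.
Arguments shift_zero {_ _} _.
Arguments shift_add {_ _} _ _ _.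

(* A derived category of C: the Gabriel-Zisman localization of C at the
   quasi-isomorphisms, on the same objects as C, with its K-linear structure
   and the shift functors induced by those of C. *)
Record derived (K : fieldType) (C : dg_model K) := Derived {
  dhom : obj C -> obj C -> lmodType K;
  did : forall X, dhom X X;
  dcomp : forall X Y Z, dhom Y Z -> dhom X Y -> dhom X Z;
  dcomp_idl : forall X Y (f : dhom X Y), dcomp (did Y) f = f;
  dcomp_idr : forall X Y (f : dhom X Y), dcomp f (did X) = f;
  dcompA : forall W X Y Z (h : dhom Y Z) (g : dhom X Y) (f : dhom W X),
    dcomp h (dcomp g f) = dcomp (dcomp h g) f;
  dcomp_linl : forall X Y Z (f : dhom X Y) c (g g' : dhom Y Z),
    dcomp (c *: g + g') f = c *: dcomp g f + dcomp g' f;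
  dcomp_linr : forall X Y Z (g : dhom Y Z) c (f f' : dhom X Y),
    dcomp g (c *: f + f') = c *: dcomp g f + dcomp g f';
  loc : forall X Y : obj C, hom X Y -> dhom X Y;
  loc_id : forall X, loc (idm X) = did X;
  loc_comp : forall X Y Z (g : hom Y Z) (f : hom X Y),
    loc (comp g f) = dcomp (loc g) (loc f);
  loc_lin : forall X Y c (f g : hom X Y),
    loc (lincomb c f g) = c *: loc f + loc g;
  loc_qis : forall X Y (f : hom X Y), qis f ->
    exists g : dhom Y X, dcomp g (loc f) = did X /\ dcomp (loc f) g = did Y;
  loc_univ : forall (E : category) (F : functor C E),
    (forall X Y (f : hom X Y), qis f -> invertible (fhom F f)) ->
    exists! G : (forall X Y, dhom X Y -> hom (fobj F X) (fobj F Y)),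
      [/\ forall X, G X X (did X) = idm (fobj F X),
          forall X Y Z (g : dhom Y Z) (f : dhom X Y),
            G X Z (dcomp g f) = comp (G Y Z g) (G X Y f)
        & forall X Y (f : hom X Y), G X Y (loc f) = fhom F f];
  dshift : forall (m : int) X Y, dhom X Y -> dhom (shift m X) (shift m Y);
  dshift_id : forall m X, dshift m (did X) = did (shift m X);
  dshift_comp : forall m X Y Z (g : dhom Y Z) (f : dhom X Y),
    dshift m (dcomp g f) = dcomp (dshift m g) (dshift m f);
  dshift_loc : forall m X Y (f : hom X Y),
    dshift m (loc f) = loc (shift_hom m f) }.
Arguments dhom {_ _} _ _ _.
Arguments did {_ _} _ _.
Arguments dcomp {_ _ _ _ _ _} _ _.
Arguments loc {_ _} _ {_ _} _.
Arguments dshift {_ _ _} _ {_ _} _.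

(* the meaning of "V = K" *)
Definition is_line (K : fieldType) (V : lmodType K) :=
  exists2 v : V, v != 0 & forall w, exists c : K, w = c *: v.

Definition is_trivial (K : fieldType) (V : lmodType K) := forall v : V, v = 0.

Section Triangulated.
Variables (K : fieldType) (C : dg_model K) (D : derived C).
Implicit Types X Y Z : obj C.

Definition diso X Y (f : dhom D X Y) :=
  exists g : dhom D Y X, dcomp g f = did D X /\ dcomp f g = did D Y.

Definition isomorphic X Y := exists f : dhom D X Y, diso f.

Definition zero_object X := did D X = 0.

(* X, with the injections i and projections p, is the direct sum of the Xs *)
Definition direct_sum (r : nat) (Xs : 'I_r -> obj C) X
    (i : forall a, dhom D (Xs a) X) (p : forall a, dhom D X (Xs a)) :=
  [/\ forall a, dcomp (p a) (i a) = did D (Xs a),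
      forall a b, a != b -> dcomp (p b) (i a) = 0
    & \sum_a dcomp (i a) (p a) = did D X].

Definition direct_summand X Y :=
  exists Z (i : dhom D X Y) (p : dhom D Y X) (j : dhom D Z Y) (q : dhom D Y Z),
    [/\ dcomp p i = did D X, dcomp q j = did D Z, dcomp q i = 0, dcomp p j = 0
      & dcomp i p + dcomp j q = did D Y].

(* X -u-> Y -v-> Z -w-> Sigma X is isomorphic to the triangle of a cone *)
Definition distinguished X Y Z (u : dhom D X Y) (v : dhom D Y Z)
    (w : dhom D Z (shift 1 X)) :=
  exists (X' Y' : obj C) (f : hom X' Y') (a : dhom D X X') (b : dhom D Y Y')
         (c : dhom D Z (cone f)),
    [/\ diso a, diso b & diso c] /\
    [/\ dcomp b u = dcomp (loc D f) a,
        dcomp c v = dcomp (loc D (cone_in f)) b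
      & dcomp (dshift 1 a) w = dcomp (loc D (cone_out f)) c].

Definition thick_subcategory (P : obj C -> Prop) :=
  [/\ forall X, zero_object X -> P X,
      forall X, P (shift 1 X) <-> P X,
      forall X Y Z (u : dhom D X Y) (v : dhom D Y Z) (w : dhom D Z (shift 1 X)),
        distinguished u v w -> P X -> P Y -> P Z
    & forall X Y, direct_summand X Y -> P Y -> P X].

Definition thick (S : obj C -> Prop) X :=
  forall P, thick_subcategory P -> (forall Y, S Y -> P Y) -> P X.

Definition thick_of (r : nat) (Xs : 'I_r -> obj C) :=
  thick (fun Y => exists a, Y = Xs a).

End Triangulated.

(* A functor defined on the full subcategory P: its values outside P are
   irrelevant, and the functor laws are only required on P. *)
Record prefunctor (K : fieldType) (C C' : dg_model K) (D : derived C)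
    (D' : derived C') := PreFunctor {
  pobj :> obj C -> obj C';
  phom : forall X Y, dhom D X Y -> dhom D' (pobj X) (pobj Y) }.
Arguments phom {_ _ _ _ _} _ {_ _} _.

Definition prefunctor_comp (K : fieldType) (C C' C'' : dg_model K)
    (D : derived C) (D' : derived C') (D'' : derived C'')
    (G : prefunctor D' D'') (F : prefunctor D D') : prefunctor D D'' :=
  PreFunctor (fun X Y (f : dhom D X Y) => phom G (phom F f)).

Section Functors.
Variables (K : fieldType) (C C' : dg_model K) (D : derived C) (D' : derived C').
Variables (P : obj C -> Prop) (P' : obj C' -> Prop).
Implicit Type F : prefunctor D D'.

Definition linear_functor F :=
  [/\ forall X, P X -> P' (F X),
      forall X, P X -> phom F (did D X) = did D' (F X),
      forall X Y Z (g : dhom D Y Z) (f : dhom D X Y), P X -> P Y -> P Z ->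
        phom F (dcomp g f) = dcomp (phom F g) (phom F f)
    & forall X Y c (f g : dhom D X Y), P X -> P Y ->
        phom F (c *: f + g) = c *: phom F f + phom F g].

Definition triangle_functor F :=
  linear_functor F /\
  exists eta : (forall X, dhom D' (F (shift 1 X)) (shift 1 (F X))),
    [/\ forall X, P X -> diso (eta X),
        forall X Y (f : dhom D X Y), P X -> P Y ->
          dcomp (eta Y) (phom F (dshift 1 f)) =
          dcomp (dshift 1 (phom F f)) (eta X)
      & forall X Y Z (u : dhom D X Y) (v : dhom D Y Z)
               (w : dhom D Z (shift 1 X)), P X -> P Y -> P Z ->
          distinguished u v w ->
          distinguished (phom F u) (phom F v) (dcomp (eta X) (phom F w))].

Definition equivalence F :=
  (forall X Y, P X -> P Y -> bijective (@phom _ _ _ _ _ F X Y)) /\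
  (forall Y, P' Y -> exists2 X, P X & isomorphic D' (F X) Y).

Definition triangle_equivalence F := triangle_functor F /\ equivalence F.

End Functors.

Definition natural_iso (K : fieldType) (C C' : dg_model K) (D : derived C)
    (D' : derived C') (P : obj C -> Prop) (F G : prefunctor D D') :=
  exists eta : (forall X, dhom D' (F X) (G X)),
    (forall X, P X -> diso (eta X)) /\
    forall X Y (f : dhom D X Y), P X -> P Y ->
      dcomp (eta Y) (phom F f) = dcomp (phom G f) (eta X).

Definition id_prefunctor (K : fieldType) (C : dg_model K) (D : derived C) :
  prefunctor D D := PreFunctor (fun X Y (f : dhom D X Y) => f).

Definition quasi_inverse (K : fieldType) (C C' : dg_model K) (D : derived C)
    (D' : derived C') (P : obj C -> Prop) (P' : obj C' -> Prop)
    (F : prefunctor D D') (G : prefunctor D' D) :=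
  [/\ linear_functor P' P G,
      natural_iso P (prefunctor_comp G F) (id_prefunctor D)
    & natural_iso P' (prefunctor_comp F G) (id_prefunctor D')].

(* Right modules over L are left modules over the converse algebra L^c. *)
Section Complexes.
Variables (K : fieldType) (L : falgType K).

(* the K-vector space structure of a right L-module *)
Definition kscale (M : lmodType L^c) (c : K) (x : M) : M :=
  ((c%:A : L) : L^c) *: x.

Lemma kscale_lin (M : lmodType L^c) c : linear (@kscale M c).
Proof.
move=> a x y; rewrite /kscale scalerDr !scalerA; congr (_ *: x + _).
exact: etrans (mulr_algr c (a : L)) (esym (mulr_algl c (a : L))).
Qed.

Lemma kscaleA (M : lmodType L^c) c c' (x : M) :
  kscale c (kscale c' x) = kscale (c * c') x.
Proof.
rewrite /kscale scalerA; congr (_ *: x).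
by apply: (etrans (mulr_algl c' (c%:A : L))); rewrite scalerA mulrC.
Qed.

Lemma kscale1 (M : lmodType L^c) (x : M) : kscale 1 x = x.
Proof. by rewrite /kscale scale1r -[RHS]scale1r. Qed.

Lemma kscaleN1 (M : lmodType L^c) (x : M) : kscale (-1) x = - x.
Proof. by rewrite /kscale scaleN1r -[RHS]scaleN1r. Qed.

Record complex := Complex {
  cx_sp :> gmod L^c;
  cx_d : cx_sp -> cx_sp;
  cx_d_lin : linear cx_d;
  cx_d_deg : forall n x, gr cx_sp n x -> gr cx_sp (n + 1) (cx_d x);
  cx_dd : forall x, cx_d (cx_d x) = 0 }.
Arguments cx_d : clear implicits.

Record chain_map (M N : complex) := ChainMap {
  cm_fun :> M -> N;
  cm_lin : linear cm_fun;
  cm_deg : forall n x, gr M n x -> gr N n (cm_fun x);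
  cm_comm : forall x, cm_fun (cx_d M x) = cx_d N (cm_fun x) }.

Lemma chain_map_eq M N (f g : chain_map M N) : (forall x, f x = g x) -> f = g.
Proof.
case: f g => [f f1 f2 f3] [g g1 g2 g3] /= /funext h; subst g.
by congr ChainMap; apply: Prop_irrelevance.
Qed.

Lemma lin0 (R : nzRingType) (U V : lmodType R) (f : U -> V) :
  linear f -> f 0 = 0.
Proof. by move=> h; have := h (-1) 0 0; rewrite scaler0 addr0 scaleN1r addNr. Qed.

Lemma linD (R : nzRingType) (U V : lmodType R) (f : U -> V) x y :
  linear f -> f (x + y) = f x + f y.
Proof. by move=> h; have := h 1 x y; rewrite !scale1r. Qed.

Lemma linZ (R : nzRingType) (U V : lmodType R) (f : U -> V) a x :
  linear f -> f (a *: x) = a *: f x.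
Proof. by move=> h; have := h a x 0; rewrite !addr0 (lin0 h) addr0. Qed.

Lemma linN (R : nzRingType) (U V : lmodType R) (f : U -> V) x :
  linear f -> f (- x) = - f x.
Proof. by move=> h; rewrite -scaleN1r linZ // scaleN1r. Qed.

Definition cm_id (M : complex) : chain_map M M :=
  @ChainMap M M id (fun _ _ _ => erefl) (fun _ _ h => h) (fun _ => erefl).

Lemma cm_comp_lin (M N P : complex) (g : chain_map N P) (f : chain_map M N) :
  linear (g \o f).
Proof. by move=> a x y /=; rewrite !cm_lin. Qed.

Lemma cm_comp_comm (M N P : complex) (g : chain_map N P) (f : chain_map M N) x :
  (g \o f) (cx_d M x) = cx_d P ((g \o f) x).
Proof. by rewrite /= !cm_comm. Qed.

Definition cm_comp (M N P : complex) (g : chain_map N P) (f : chain_map M N) :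
    chain_map M P :=
  @ChainMap M P (g \o f) (cm_comp_lin g f)
    (fun n x h => cm_deg g (cm_deg f h)) (cm_comp_comm g f).

Lemma cm_idl M N (f : chain_map M N) : cm_comp (cm_id N) f = f.
Proof. exact: chain_map_eq. Qed.

Lemma cm_idr M N (f : chain_map M N) : cm_comp f (cm_id M) = f.
Proof. exact: chain_map_eq. Qed.

Lemma cm_compA M N P Q (h : chain_map P Q) (g : chain_map N P)
  (f : chain_map M N) : cm_comp h (cm_comp g f) = cm_comp (cm_comp h g) f.
Proof. exact: chain_map_eq. Qed.

Definition complex_category : category :=
  @Category complex chain_map cm_id cm_comp
    cm_idl cm_idr cm_compA.

Section LinComb.
Variables (M N : complex) (c : K) (f g : chain_map M N).
Let h x := kscale c (f x) + g x.

Lemma cm_lincomb_lin : linear h.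
Proof.
move=> a x y; rewrite /h !cm_lin kscale_lin scalerDr.
by rewrite -!addrA; congr (_ + _); rewrite addrCA.
Qed.

Lemma cm_lincomb_deg n x : gr M n x -> gr N n (h x).
Proof. by move=> hx; apply: gr_lin; apply: cm_deg. Qed.

Lemma cm_lincomb_comm x : h (cx_d M x) = cx_d N (h x).
Proof. by rewrite /h !cm_comm (cx_d_lin (c := N)). Qed.

Definition cm_lincomb := ChainMap cm_lincomb_lin cm_lincomb_deg cm_lincomb_comm.
End LinComb.

Section ComplexShift.
Variable m : int.
Let s : K := (-1) ^ m.

Section Object.
Variable M : complex.
Let d (x : gshift m M) : gshift m M := kscale s (cx_d M x).

Lemma cx_shift_lin : linear d.
Proof. by move=> a x y; rewrite /d (cx_d_lin (c := M)) kscale_lin. Qed.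

Lemma cx_shift_deg n x : gr (gshift m M) n x -> gr (gshift m M) (n + 1) (d x).
Proof. by move=> h; apply: grZ; rewrite /= addrAC; apply: cx_d_deg. Qed.

Lemma cx_shift_dd x : d (d x) = 0.
Proof.
by rewrite /d /kscale (linZ _ _ (@cx_d_lin M)) cx_dd !scaler0.
Qed.

Definition cx_shift : complex := Complex cx_shift_lin cx_shift_deg cx_shift_dd.
End Object.

Lemma cm_shift_comm (M N : complex) (f : chain_map M N) (x : cx_shift M) :
  (f : M -> N) (cx_d (cx_shift M) x) = cx_d (cx_shift N) (f x).
Proof. by rewrite /= /kscale (linZ _ _ (cm_lin f)) cm_comm. Qed.

Definition cm_shift (M N : complex) (f : chain_map M N) :
    chain_map (cx_shift M) (cx_shift N) :=
  @ChainMap (cx_shift M) (cx_shift N) f (cm_lin f)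
    (fun n x h => cm_deg f h) (cm_shift_comm f).
End ComplexShift.

Lemma cx_shift_zero_deg (M : complex) n x : gr M n x -> gr (cx_shift 0 M) n x.
Proof. by rewrite /= addr0. Qed.

Lemma cx_shift_zero_comm (M : complex) x : cx_d M x = cx_d (cx_shift 0 M) x.
Proof. by rewrite /= expr0z kscale1. Qed.

Definition cx_shift_zero (M : complex) : chain_map M (cx_shift 0 M) :=
  @ChainMap M (cx_shift 0 M) id (fun _ _ _ => erefl)
    (@cx_shift_zero_deg M) (@cx_shift_zero_comm M).

Lemma cx_shift_add_deg m n (M : complex) k x :
  gr (cx_shift n (cx_shift m M)) k x -> gr (cx_shift (m + n) M) k x.
Proof. by rewrite /= -addrA [n + m]addrC. Qed.

Lemma cx_shift_add_comm m n (M : complex) x :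
  cx_d (cx_shift n (cx_shift m M)) x = cx_d (cx_shift (m + n) M) x.
Proof. by rewrite /= kscaleA expfzDr ?oppr_eq0 ?oner_eq0 // mulrC. Qed.

Definition cx_shift_add m n (M : complex) :
    chain_map (cx_shift n (cx_shift m M)) (cx_shift (m + n) M) :=
  @ChainMap (cx_shift n (cx_shift m M)) (cx_shift (m + n) M) id
    (fun _ _ _ => erefl) (@cx_shift_add_deg m n M) (@cx_shift_add_comm m n M).

Section ComplexCone.
Variables (M N : complex) (f : chain_map M N).
Let C : gmod L^c := gprod N (gshift 1 M).
Let d (z : C) : C := (cx_d N z.1 + f z.2, - cx_d M z.2).

Lemma cx_cone_lin : linear d.
Proof.
move=> a [y x] [y' x']; congr pair => /=.
  rewrite (cx_d_lin (c := N)) (cm_lin f) scalerDr -!addrA.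
  by congr (_ + _); rewrite addrCA.
by rewrite (cx_d_lin (c := M)) opprD scalerN.
Qed.

Lemma cx_cone_deg n z : gr C n z -> gr C (n + 1) (d z).
Proof.
move=> [h1 h2]; split=> /=.
  by apply: grD; [apply: cx_d_deg | apply: (cm_deg f)].
by rewrite -scaleN1r; apply: grZ; apply: (@cx_d_deg M (n + 1)).
Qed.

Lemma cx_cone_dd z : d (d z) = 0.
Proof.
case: z => y x; congr pair => /=.
  rewrite (linD _ _ (@cx_d_lin N)) cx_dd add0r (linN _ (cm_lin f)).
  by rewrite cm_comm addrN.
by rewrite (linN _ (@cx_d_lin M)) cx_dd !oppr0.
Qed.

Definition cx_cone : complex := Complex cx_cone_lin cx_cone_deg cx_cone_dd.

Lemma cx_cone_in_lin : linear (fun y : N => ((y, 0) : cx_cone)).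
Proof. by move=> a x y; congr pair; rewrite /= scaler0 addr0. Qed.

Lemma cx_cone_in_deg n (y : N) : gr N n y -> gr cx_cone n (y, 0).
Proof. by move=> h; split => //; apply: gr0. Qed.

Lemma cx_cone_in_comm (y : N) : ((cx_d N y, 0) : cx_cone) = cx_d cx_cone (y, 0).
Proof.
congr pair => /=; first by rewrite (lin0 (cm_lin f)) addr0.
by rewrite (lin0 (@cx_d_lin M)) oppr0.
Qed.

Definition cx_cone_in : chain_map N cx_cone :=
  ChainMap cx_cone_in_lin cx_cone_in_deg cx_cone_in_comm.

Lemma cx_cone_out_lin : linear (fun z : cx_cone => (z.2 : cx_shift 1 M)).
Proof. by []. Qed.

Lemma cx_cone_out_deg n (z : cx_cone) :
  gr cx_cone n z -> gr (cx_shift 1 M) n z.2.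
Proof. by case. Qed.

Lemma cx_cone_out_comm (z : cx_cone) :
  (cx_d cx_cone z).2 = cx_d (cx_shift 1 M) z.2.
Proof. by rewrite /= expr1z kscaleN1. Qed.

Definition cx_cone_out : chain_map cx_cone (cx_shift 1 M) :=
  ChainMap cx_cone_out_lin cx_cone_out_deg cx_cone_out_comm.
End ComplexCone.

(* bijectivity of the map Ker d / Im d -> Ker d' / Im d' induced by f *)
Definition iso_on_cohomology (R : nzRingType) (V W : lmodType R)
    (d : V -> V) (d' : W -> W) (f : V -> W) :=
  (forall x, d x = 0 -> (exists y, f x = d' y) -> exists z, x = d z) /\
  (forall y, d' y = 0 -> exists x z, d x = 0 /\ y = f x + d' z).

Definition complexes : dg_model K :=
  @DGModel K complex_category cm_lincomb
    (fun M N (f : chain_map M N) => iso_on_cohomology (cx_d M) (cx_d N) f)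
    cx_shift cm_shift cx_shift_zero cx_shift_add cx_cone cx_cone_in cx_cone_out.

Definition stalk (S : lmodType L^c) : obj complexes :=
  @Complex (gstalk S) (fun=> 0)
    (fun a x y => esym (etrans (addr0 _) (scaler0 _ a)))
    (fun n _ _ => gr0 (gstalk S) (n + 1)) (fun=> erefl).

End Complexes.
Arguments cx_d {K L} _ _.

(* An operation f_n : M (x) A^(x)(n-1) -> N is given by its values f x s,
   x : M, s : seq A of size n - 1, so that one function M -> seq A -> N
   encodes a whole family (f_n)_(n >= 1); for M = A this covers the
   operations m_n of A itself. *)

(* the sum of F u v over all the decompositions s = u ++ v *)
Definition sum_split (V : nmodType) (T : Type) (F : seq T -> seq T -> V)
    (s : seq T) : V :=
  \sum_(i < (size s).+1) F (take i s) (drop i s).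

Section SumSplit.
Variables (V : nmodType) (T : Type).
Implicit Types (F G : seq T -> seq T -> V) (s u v w : seq T).

Lemma sum_split_nil F : sum_split F [::] = F [::] [::].
Proof. by rewrite /sum_split big_ord1. Qed.

Lemma sum_split_cons F x s :
  sum_split F (x :: s) = F [::] (x :: s) + sum_split (fun u => F (x :: u)) s.
Proof. by rewrite /sum_split big_ord_recl. Qed.

Lemma eq_sum_split F G s :
  (forall u v, s = u ++ v -> F u v = G u v) -> sum_split F s = sum_split G s.
Proof. by move=> h; apply: eq_bigr => i _; apply: h; rewrite cat_take_drop. Qed.

Lemma sum_split0 s : sum_split (fun _ _ => 0 : V) s = 0.
Proof. by rewrite /sum_split big1. Qed.

Lemma sum_splitD F G s :
  sum_split (fun u v => F u v + G u v) s = sum_split F s + sum_split G s.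
Proof. exact: big_split. Qed.

Lemma sum_splitA (F : seq T -> seq T -> seq T -> V) s :
  sum_split (fun z w => sum_split (fun u v => F u v w) z) s =
  sum_split (fun u z => sum_split (fun v w => F u v w) z) s.
Proof.
elim: s F => [|x s IH] F; first by rewrite !sum_split_nil.
rewrite !sum_split_cons sum_split_nil -addrA; congr (_ + _).
rewrite -(IH (fun u => F (x :: u))) -sum_splitD.
by apply: eq_bigr => i _; rewrite sum_split_cons.
Qed.

Lemma sum_split_cat_cons F u c w :
  sum_split F (u ++ c :: w) =
  sum_split (fun u1 u2 => F u1 (u2 ++ c :: w)) u +
  sum_split (fun w1 w2 => F (u ++ c :: w1) w2) w.
Proof.
elim: u F => [|x u IH] F /=; first by rewrite sum_split_cons sum_split_nil.
by rewrite !sum_split_cons IH addrA.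
Qed.

End SumSplit.

Lemma sum_split_map (V : nmodType) (T T' : Type) (h : T' -> T)
    (F : seq T -> seq T -> V) (s : seq T') :
  sum_split F (map h s) = sum_split (fun u v => F (map h u) (map h v)) s.
Proof.
by rewrite /sum_split size_map; apply: eq_bigr => i _; rewrite map_take map_drop.
Qed.

Lemma linear_sum_split (R : nzRingType) (V W : lmodType R) (T : Type)
    (f : V -> W) (F : seq T -> seq T -> V) s :
  linear f -> f (sum_split F s) = sum_split (fun u v => f (F u v)) s.
Proof.
move=> hf; rewrite /sum_split.
apply: (big_morph f _ (lin0 hf)) => x y; exact: linD.
Qed.

Section Operations.
Variable K : fieldType.
Implicit Types A M N P : gmod K.

Definition multilinear A M N (f : M -> seq A -> N) :=
  (forall s, linear (fun x => f x s)) /\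
  (forall x u v, linear (fun a => f x (u ++ a :: v))).

Definition has_degree A M N (e : nat -> int) (f : M -> seq A -> N) :=
  forall d x a, gr M d x -> homogeneous a ->
    gr N (d + total_degree a + e (size a).+1) (f x [seq p.2 | p <- a]).

(* \sum_(j+k+l=n) (-1)^(jk+l) g_(j+1+l) (id^(x)j (x) m_k (x) id^(x)l),
   evaluated at x (x) a_2 (x) ... (x) a_n with x of degree d and a the list of
   the a_i, with their degrees. The terms with j = 0, where m_k is m^M, are
   g (mM x v) w with k = 1 + size v and l = size w. The other ones are
   g x (u ++ mA b v :: w) with j = 1 + size u, k = 1 + size v, l = size w;
   since m_k has degree 2 - k, the Koszul rule gives them the additional sign
   (-1)^(k (d + deg u)). *)
Definition stasheff_sum A (mA : A -> seq A -> A) M (mM : M -> seq A -> M)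
    N (g : M -> seq A -> N) (d : int) (x : M) (a : seq (int * A)) : N :=
  sum_split (fun v w => (-1) ^+ size w *:
      g (mM x [seq p.2 | p <- v]) [seq p.2 | p <- w]) a +
  sum_split (fun u t => if t is b :: t' then
      sum_split (fun v w =>
        let j := (size u).+1 in let k := (size v).+1 in let l := size w in
        (-1) ^ ((j * k + l)%N%:Z + k%:Z * (d + total_degree u)) *:
        g x ([seq p.2 | p <- u] ++
             mA b.2 [seq p.2 | p <- v] :: [seq p.2 | p <- w])) t'
    else 0) a.

(* (g o f)_n = \sum_(r+s=n) g_(s+1) (f_r (x) id^(x)s); for g = m^N this is also
   the right-hand side of the equation defining A_oo-morphisms. *)
Definition op_comp A M N P (g : N -> seq A -> P) (f : M -> seq A -> N)
    (x : M) (s : seq A) : P :=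
  sum_split (fun u v => g (f x u) v) s.

Definition is_ainf_structure A (mA : A -> seq A -> A) M (mM : M -> seq A -> M) :=
  [/\ multilinear mM, has_degree (fun n => 2 - n%:Z) mM
    & forall d x a, gr M d x -> homogeneous a ->
        stasheff_sum mA mM mM d x a = 0].

End Operations.

(* Algebras, modules and morphisms are all strictly unital. *)
Record ainf_alg (K : fieldType) := AinfAlg {
  aa_sp :> gmod K;
  aa_m : aa_sp -> seq aa_sp -> aa_sp;
  aa_axiom : is_ainf_structure aa_m aa_m;
  aa_one : aa_sp;
  aa_one_deg : gr aa_sp 0 aa_one;
  aa_one_l : forall a, aa_m aa_one [:: a] = a;
  aa_one_r : forall a, aa_m a [:: aa_one] = a;
  aa_one_vanish : forall a s, size s != 1 -> aa_one \in a :: s -> aa_m a s = 0 }.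
Arguments aa_m {K} _ _ _.
Arguments aa_one {K} _.

Section AinfModules.
Variables (K : fieldType) (A : ainf_alg K).

Record ainf_mod := AinfMod {
  am_sp :> gmod K;
  am_m : am_sp -> seq A -> am_sp;
  am_axiom : is_ainf_structure (aa_m A) am_m;
  am_one : forall x, am_m x [:: aa_one A] = x;
  am_one_vanish : forall x s, (1 < size s)%N -> aa_one A \in s -> am_m x s = 0 }.
Arguments am_m : clear implicits.

Record ainf_hom (M N : ainf_mod) := AinfHom {
  ah_fun :> M -> seq A -> N;
  ah_multilin : multilinear ah_fun;
  ah_deg : has_degree (fun n => 1 - n%:Z) ah_fun;
  ah_eq : forall d x a, gr M d x -> homogeneous a ->
    stasheff_sum (aa_m A) (am_m M) ah_fun d x a =
    op_comp (am_m N) ah_fun x [seq p.2 | p <- a];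
  ah_one_vanish : forall x s, aa_one A \in s -> ah_fun x s = 0 }.

Lemma ainf_hom_eq M N (f g : ainf_hom M N) : (forall x s, f x s = g x s) -> f = g.
Proof.
case: f g => [f f1 f2 f3 f4] [g g1 g2 g3 g4] /= h.
have {}h : f = g by apply: funext => x; apply: funext => s.
by subst g; congr AinfHom; apply: Prop_irrelevance.
Qed.

Lemma sum_split_first (V : nmodType) (T : Type) (F : seq T -> seq T -> V) s :
  (forall x u v, F (x :: u) v = 0) -> sum_split F s = F [::] s.
Proof.
case: s => [|x s] h; first by rewrite sum_split_nil.
by rewrite sum_split_cons /sum_split big1 ?addr0.
Qed.

Lemma sum_split_last (V : nmodType) (T : Type) (F : seq T -> seq T -> V) s :
  (forall x u v, F u (x :: v) = 0) -> sum_split F s = F s [::].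
Proof.
move=> h; elim: s F h => [|x s IH] F h; first by rewrite sum_split_nil.
by rewrite sum_split_cons h add0r IH.
Qed.

Lemma scaler_sum_split (R : nzRingType) (V : lmodType R) (T : Type) c
    (F : seq T -> seq T -> V) s :
  c *: sum_split F s = sum_split (fun u v => c *: F u v) s.
Proof. by rewrite /sum_split scaler_sumr. Qed.

Lemma linear_sum (R : nzRingType) (U V : lmodType R) (I : Type) (r : seq I)
    (F : I -> U -> V) :
  (forall i, linear (F i)) -> linear (fun x => \sum_(i <- r) F i x).
Proof.
move=> h a x y; rewrite scaler_sumr -big_split /=.
by apply: eq_bigr => i _; rewrite h.
Qed.

Lemma gr_sum_split (R : nzRingType) (V : gmod R) (T : Type) d
    (F : seq T -> seq T -> V) s :
  (forall u v, s = u ++ v -> gr V d (F u v)) -> gr V d (sum_split F s).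
Proof. by move=> h; apply: gr_sum => i _; apply: h; rewrite cat_take_drop. Qed.

Lemma homogeneous_cat (R : nzRingType) (V : gmod R) (u v : seq (int * V)) :
  homogeneous (u ++ v) <-> homogeneous u /\ homogeneous v.
Proof.
split=> [h|[hu hv] p]; last by rewrite mem_cat => /orP[/hu|/hv].
by split=> p hp; apply: h; rewrite mem_cat hp ?orbT.
Qed.

Lemma total_degree_cat (T : Type) (u v : seq (int * T)) :
  total_degree (u ++ v) = total_degree u + total_degree v.
Proof. by rewrite /total_degree big_cat. Qed.

Lemma sgn_eq (c a b : int) : a = b + c * 2 -> (-1) ^ a = (-1) ^ b :> K.
Proof.
have n1 : (-1 : K) != 0 by rewrite oppr_eq0 oner_eq0.
move=> ->; rewrite expfzDr // [c * 2]mulrC -exprz_exp -exprnP sqrrN expr1n.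
by rewrite exp1rz mulr1.
Qed.

Section AinfComp.
Variables (M N P : ainf_mod) (g : ainf_hom N P) (f : ainf_hom M N).
Let h := op_comp g f.

Lemma ah_comp_multilin : multilinear h.
Proof.
have [[f1 f2] [g1 g2]] := (ah_multilin f, ah_multilin g).
split=> [s|x u v c y z]; rewrite /h /op_comp.
  by apply: linear_sum => i c y z; rewrite f1 g1.
rewrite !sum_split_cat_cons scalerDr addrACA /sum_split !scaler_sumr.
by rewrite -!big_split; congr (_ + _); apply: eq_bigr => i _ /=;
  [rewrite g2 | rewrite f2 g1].
Qed.

Lemma ah_comp_deg : has_degree (fun n => 1 - n%:Z) h.
Proof.
move=> d x a hx ha; rewrite /h /op_comp sum_split_map.
apply: gr_sum_split => u v e; move: ha; rewrite e => /homogeneous_cat[hu hv].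
have := ah_deg g (ah_deg f hx hu) hv; congr (gr P _ _).
by rewrite total_degree_cat size_cat; lia.
Qed.

Lemma ah_comp_eq d x a : gr M d x -> homogeneous a ->
  stasheff_sum (aa_m A) (am_m M) h d x a =
  op_comp (am_m P) h x [seq p.2 | p <- a].
Proof.
move=> hx ha; have [[f1 f2] [g1 g2]] := (ah_multilin f, ah_multilin g).
have [[mP1 _] _ _] := am_axiom P; have [[mN1 _] _ _] := am_axiom N.
transitivity (sum_split (fun u v => op_comp (am_m P) g (f x [seq p.2 | p <- u])
    [seq p.2 | p <- v]) a); last first.
  rewrite /h /op_comp -(sum_split_map (fun p => p.2)
    (fun u v => sum_split (fun u0 v0 => am_m P (g (f x u) u0) v0) v)).
  rewrite -(sum_splitA (fun u v w => am_m P (g (f x u) v) w)).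
  by apply: eq_sum_split => u v _; rewrite (linear_sum_split _ _ (mP1 v)).
transitivity (sum_split (fun u v => stasheff_sum (aa_m A) (am_m N) g
    (d + total_degree u + (1 - (size u).+1%:Z)) (f x [seq p.2 | p <- u]) v) a);
  last first.
  apply: eq_sum_split => u v e; move: ha; rewrite e => /homogeneous_cat[hu hv].
  by apply: ah_eq => //; apply: ah_deg.
rewrite /stasheff_sum sum_splitD.
rewrite -(sum_splitA (fun u v w => (-1) ^+ size w *:
  g (am_m N (f x [seq p.2 | p <- u]) [seq p.2 | p <- v]) [seq p.2 | p <- w])).
transitivity (sum_split (fun u w => (-1) ^+ size w *:
    g (stasheff_sum (aa_m A) (am_m M) f d x u) [seq p.2 | p <- w]) a +
  sum_split (fun u1 v => sum_split (fun u t => if t is b :: t' then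
      sum_split (fun v w =>
        let j := (size u).+1 in let k := (size v).+1 in let l := size w in
        (-1) ^ ((j * k + l)%N%:Z + k%:Z *
           (d + total_degree u1 + (1 - (size u1).+1%:Z) + total_degree u)) *:
        g (f x [seq p.2 | p <- u1]) ([seq p.2 | p <- u] ++
             aa_m A b.2 [seq p.2 | p <- v] :: [seq p.2 | p <- w])) t'
    else 0) v) a); last first.
  congr (_ + _); apply: eq_sum_split => u v e.
  move: ha; rewrite e => /homogeneous_cat[hu hv].
  rewrite ah_eq // /op_comp sum_split_map.
  rewrite (linear_sum_split _ _ (g1 _)) /sum_split scaler_sumr.
  by apply: eq_bigr.
transitivity (sum_split (fun z w2 => (-1) ^+ size w2 *:
      g (sum_split (fun v w => (-1) ^+ size w *:
      f (am_m M x [seq p.2 | p <- v]) [seq p.2 | p <- w]) z) [seq p.2 | p <- w2]) a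
   + (sum_split (fun z w2 => (-1) ^+ size w2 *:
      g (sum_split (fun u t => if t is b :: t' then
      sum_split (fun v w =>
        let j := (size u).+1 in let k := (size v).+1 in let l := size w in
        (-1) ^ ((j * k + l)%N%:Z + k%:Z * (d + total_degree u)) *:
        f x ([seq p.2 | p <- u] ++
             aa_m A b.2 [seq p.2 | p <- v] :: [seq p.2 | p <- w])) t'
    else 0) z) [seq p.2 | p <- w2]) a + 
  sum_split (fun u1 v => sum_split (fun u t => if t is b :: t' then
      sum_split (fun v w =>
        let j := (size u).+1 in let k := (size v).+1 in let l := size w in
        (-1) ^ ((j * k + l)%N%:Z + k%:Z *
           (d + total_degree u1 + (1 - (size u1).+1%:Z) + total_degree u)) *:
        g (f x [seq p.2 | p <- u1]) ([seq p.2 | p <- u] ++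
             aa_m A b.2 [seq p.2 | p <- v] :: [seq p.2 | p <- w])) t'
    else 0) v) a)); last first.
  rewrite addrA -sum_splitD; congr (_ + _); apply: eq_sum_split => u v _.
  by rewrite /stasheff_sum (linD _ _ (g1 _)) scalerDr.
congr (_ + _).
  transitivity (sum_split (fun z w2 => sum_split (fun v w =>
    (-1) ^+ size (w ++ w2) *: g (f (am_m M x [seq p.2 | p <- v])
      [seq p.2 | p <- w]) [seq p.2 | p <- w2]) z) a); last first.
    apply: eq_sum_split => z w2 _.
    rewrite (linear_sum_split _ _ (g1 _)) /sum_split scaler_sumr.
    apply: eq_bigr => i _; rewrite (linZ _ _ (g1 _)) scalerA -exprD.
    by rewrite size_cat addnC.
  rewrite (sum_splitA (fun v w w2 =>
    (-1) ^+ size (w ++ w2) *: g (f (am_m M x [seq p.2 | p <- v])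
      [seq p.2 | p <- w]) [seq p.2 | p <- w2])).
  apply: eq_sum_split => v w' _; rewrite /h /op_comp sum_split_map.
  rewrite {1}/sum_split scaler_sumr; apply: eq_bigr => i _.
  by rewrite cat_take_drop.
pose c1 (u v w : seq (int * A)) : int :=
  (((size u).+1 * (size v).+1 + size w)%N%:Z +
  (size v).+1%:Z * (d + total_degree u)).
pose B (u : seq (int * A)) (b : int * A) (v w : seq (int * A)) : seq A :=
  [seq p.2 | p <- u] ++ aa_m A b.2 [seq p.2 | p <- v] :: [seq p.2 | p <- w].
pose G u (t w2 : seq (int * A)) : P := if t is b :: t' then sum_split (fun v w =>
   (-1) ^ (c1 u v (w ++ w2)) *: g (f x (B u b v w)) [seq p.2 | p <- w2]) t'
   else 0.
rewrite [X in _ = X + _](_ : _ =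
  sum_split (fun z w2 => sum_split (fun u t => G u t w2) z) a); last first.
  apply: eq_sum_split => z w2 _.
  rewrite (linear_sum_split _ _ (g1 _)) {1}/sum_split scaler_sumr.
  apply: eq_bigr => i _; case: (drop i z) => [|b t].
    by rewrite (lin0 (g1 _)) scaler0.
  rewrite (linear_sum_split _ _ (g1 _)) {1}/sum_split scaler_sumr.
  apply: eq_bigr => i' _; rewrite (linZ _ _ (g1 _)) scalerA exprnP.
  rewrite -expfzDr ?oppr_eq0 ?oner_eq0 //; congr (_ ^ _ *: _).
  by rewrite /c1 size_cat; lia.
rewrite (sum_splitA G).
pose H u1 u (t : seq (int * A)) : P := if t is b :: t' then sum_split (fun v w =>
   (-1) ^ (c1 (u1 ++ u) v w) *:
   g (f x [seq p.2 | p <- u1]) (B u b v w)) t' else 0.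
rewrite [X in _ = _ + X](_ : _ =
  sum_split (fun u1 v => sum_split (fun u t => H u1 u t) v) a); last first.
  apply: eq_sum_split => u1 v _; apply: eq_sum_split => u [|b t] // _.
  apply: eq_sum_split => v' w _; congr (_ *: _).
  apply: (@sgn_eq (- ((size u1)%:Z * (size v').+1%:Z))).
  by rewrite /c1 size_cat total_degree_cat; nia.
rewrite -(sum_splitA H) -sum_splitD; apply: eq_sum_split => u [|b t] _.
  by rewrite /G sum_split_nil /= sum_split0 add0r.
rewrite {1}/G sum_split_cons add0r /=.
rewrite (sum_splitA (fun v w w2 =>
  (-1) ^ (c1 u v (w ++ w2)) *: g (f x (B u b v w)) [seq p.2 | p <- w2])).
rewrite [X in _ = _ + X](_ : _ = sum_split (fun v w => (-1) ^ (c1 u v w) *: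
  sum_split (fun u1 u2 => g (f x [seq p.2 | p <- u1]) (B u2 b v w)) u) t);
  last first.
  rewrite {1}/sum_split exchange_big; apply: eq_bigr => i _ /=.
  rewrite /sum_split scaler_sumr.
  by apply: eq_bigr => i' _; rewrite cat_take_drop.
rewrite -sum_splitD; apply: eq_sum_split => v w _.
rewrite /h /op_comp sum_split_cat_cons scalerDr addrC; congr (_ + _).
  by rewrite sum_split_map.
rewrite sum_split_map /sum_split scaler_sumr.
by apply: eq_bigr => i _; rewrite cat_take_drop.
Qed.

Lemma ah_comp_one_vanish x s : aa_one A \in s -> h x s = 0.
Proof.
have [g1 _] := ah_multilin g.
move=> hs; rewrite /h /op_comp /sum_split big1 // => i _.
move: hs; rewrite -{1}(cat_take_drop i s) mem_cat => /orP[hs|hs].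
  by rewrite (ah_one_vanish f) // (lin0 (g1 _)).
by rewrite ah_one_vanish.
Qed.

Definition ah_comp : ainf_hom M P :=
  AinfHom ah_comp_multilin ah_comp_deg ah_comp_eq ah_comp_one_vanish.
End AinfComp.

Section AinfStrict.
Variables (M N : ainf_mod) (f1 : M -> N).
Hypothesis f1_lin : linear f1.
Hypothesis f1_deg : forall d x, gr M d x -> gr N d (f1 x).
Hypothesis f1_m : forall x s, f1 (am_m M x s) = am_m N (f1 x) s.
Let f (x : M) (s : seq A) : N := if s is [::] then f1 x else 0.

Lemma ah_strict_multilin : multilinear f.
Proof.
by split=> [[|y s]|x [|y u] v] //= a b c; rewrite scaler0 addr0.
Qed.

Lemma ah_strict_deg : has_degree (fun n => 1 - n%:Z) f.
Proof.
move=> d x [|p a] hx ha /=; last exact: gr0.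
by rewrite /total_degree big_nil subrr !addr0; apply: f1_deg.
Qed.

Lemma ah_strict_eq d x a : gr M d x -> homogeneous a ->
  stasheff_sum (aa_m A) (am_m M) f d x a =
  op_comp (am_m N) f x [seq p.2 | p <- a].
Proof.
move=> _ _; have [[m1 _] _ _] := am_axiom N.
rewrite /op_comp sum_split_first => [|y u v]; last by rewrite /= (lin0 (m1 _)).
rewrite /stasheff_sum sum_split_last => [|y u v]; last by rewrite /= scaler0.
rewrite /= scale1r f1_m [X in _ + X](_ : _ = 0) ?addr0 //.
rewrite /sum_split big1 // => i _; case: (drop i a) => [|b t] //.
rewrite big1 // => i' _; case: (take i a) => [|c u] /=; by rewrite scaler0.
Qed.

Lemma ah_strict_one_vanish x s : aa_one A \in s -> f x s = 0.
Proof. by case: s. Qed.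

Definition ah_strict : ainf_hom M N :=
  AinfHom ah_strict_multilin ah_strict_deg ah_strict_eq ah_strict_one_vanish.
End AinfStrict.

Definition ah_id (M : ainf_mod) : ainf_hom M M :=
  @ah_strict M M id (fun _ _ _ => erefl) (fun _ _ h => h) (fun _ _ => erefl).

Lemma ah_idl M N (f : ainf_hom M N) : ah_comp (ah_id N) f = f.
Proof.
by apply: ainf_hom_eq => x s; rewrite /= /op_comp sum_split_last.
Qed.

Lemma ah_idr M N (f : ainf_hom M N) : ah_comp f (ah_id M) = f.
Proof.
have [f1 _] := ah_multilin f.
apply: ainf_hom_eq => x s; rewrite /= /op_comp sum_split_first // => y u v.
by rewrite (lin0 (f1 _)).
Qed.

Lemma ah_compA M N P Q (h : ainf_hom P Q) (g : ainf_hom N P)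
  (f : ainf_hom M N) : ah_comp h (ah_comp g f) = ah_comp (ah_comp h g) f.
Proof.
have [h1 _] := ah_multilin h.
apply: ainf_hom_eq => x s; rewrite /= /op_comp.
rewrite -(sum_splitA (fun u v w => h (g (f x u) v) w)).
by apply: eq_sum_split => u v _; rewrite (linear_sum_split _ _ (h1 v)).
Qed.

Definition ainf_category : category :=
  @Category ainf_mod ainf_hom ah_id ah_comp ah_idl ah_idr ah_compA.

Lemma linear_stasheff_sum (M N N' : gmod K) (mM : M -> seq A -> M)
    (f : N -> N') (g : M -> seq A -> N) d x a : linear f ->
  f (stasheff_sum (aa_m A) mM g d x a) =
  stasheff_sum (aa_m A) mM (fun x s => f (g x s)) d x a.
Proof.
move=> hf; rewrite /stasheff_sum (linD _ _ hf) !(linear_sum_split _ _ hf).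
congr (_ + _).
  by apply: eq_sum_split => u v _; rewrite (linZ _ _ hf).
apply: eq_sum_split => u [|b t] _; first exact: lin0.
rewrite (linear_sum_split _ _ hf); apply: eq_sum_split => v w _.
by rewrite (linZ _ _ hf).
Qed.

Lemma stasheff_sumD (M N : gmod K) (mM : M -> seq A -> M)
    (f g : M -> seq A -> N) d x a :
  stasheff_sum (aa_m A) mM (fun x s => f x s + g x s) d x a =
  stasheff_sum (aa_m A) mM f d x a + stasheff_sum (aa_m A) mM g d x a.
Proof.
rewrite /stasheff_sum addrACA; congr (_ + _); rewrite -sum_splitD.
  by apply: eq_sum_split => u v _; rewrite scalerDr.
apply: eq_sum_split => u [|b t] _; first by rewrite addr0.
by rewrite -sum_splitD; apply: eq_sum_split => v w _; rewrite scalerDr.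
Qed.

Section AinfLinComb.
Variables (M N : ainf_mod) (c : K) (f g : ainf_hom M N).
Let h x s := c *: f x s + g x s.

Lemma ah_lincomb_multilin : multilinear h.
Proof.
have [[f1 f2] [g1 g2]] := (ah_multilin f, ah_multilin g).
by split=> [s|x u v] b y z; rewrite /h ?f1 ?g1 ?f2 ?g2 !scalerDr !scalerA
  [c * b]mulrC addrACA.
Qed.

Lemma ah_lincomb_deg : has_degree (fun n => 1 - n%:Z) h.
Proof. by move=> d x a hx ha; apply: gr_lin; apply: ah_deg. Qed.

Lemma ah_lincomb_eq d x a : gr M d x -> homogeneous a ->
  stasheff_sum (aa_m A) (am_m M) h d x a =
  op_comp (am_m N) h x [seq p.2 | p <- a].
Proof.
move=> hx ha; have [[m1 _] _ _] := am_axiom N.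
rewrite /h stasheff_sumD -(@linear_stasheff_sum _ N N (am_m M) ( *:%R c)).
  rewrite !ah_eq // /op_comp /sum_split scaler_sumr -big_split.
  by apply: eq_bigr => i _; rewrite /= m1.
by move=> b y z; rewrite scalerDr !scalerA mulrC.
Qed.

Lemma ah_lincomb_one_vanish x s : aa_one A \in s -> h x s = 0.
Proof. by move=> hs; rewrite /h !ah_one_vanish // scaler0 addr0. Qed.

Definition ah_lincomb : ainf_hom M N :=
  AinfHom ah_lincomb_multilin ah_lincomb_deg ah_lincomb_eq ah_lincomb_one_vanish.
End AinfLinComb.

Lemma stasheff_sum_strict (M M' N : gmod K) (mM : M -> seq A -> M)
    (mM' : M' -> seq A -> M') (p : M -> M') (g : M' -> seq A -> N) d x a :
  (forall x s, p (mM x s) = mM' (p x) s) ->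
  stasheff_sum (aa_m A) mM (fun x s => g (p x) s) d x a =
  stasheff_sum (aa_m A) mM' g d (p x) a.
Proof.
move=> h; rewrite /stasheff_sum; congr (_ + _).
by apply: eq_sum_split => u v _; rewrite h.
Qed.

Section AinfShift.
Variable m : int.
Let sgn (n : int) : K := (-1) ^ (m * n).

Let sgnD n n' : sgn (n + n') = sgn n * sgn n'.
Proof. by rewrite /sgn mulrDr expfzDr // oppr_eq0 oner_eq0. Qed.

Section Object.
Variable M : ainf_mod.
Let V : gmod K := gshift m M.

(* the sign is (-1)^(mn) for m_n, where n is 1 + size s *)
Definition shift_op (x : V) (s : seq A) : V :=
  sgn (size s).+1%:Z *: am_m M x s.

Lemma shift_op_multilin : multilinear shift_op.
Proof.
have [[m1 m2] _ _] := am_axiom M.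
split=> [s|x u v] c y z; rewrite /shift_op ?m1 ?m2 ?size_cat /=;
  by rewrite scalerDr !scalerA mulrC.
Qed.

Lemma shift_op_deg : has_degree (fun n => 2 - n%:Z) shift_op.
Proof.
move=> d x a hx ha; have [_ h _] := am_axiom M.
by apply: grZ; have := h _ _ _ hx ha; congr (gr M _ _); lia.
Qed.

Lemma shift_stasheff_sum (N : gmod K) (g : M -> seq A -> N) (e d : int)
    (x : V) a : (forall s, linear (g^~ s)) ->
  stasheff_sum (aa_m A) shift_op
    (fun x s => sgn (e + (size s)%:Z) *: g x s) d x a =
  sgn (e + (size a).+1%:Z) *: stasheff_sum (aa_m A) (am_m M) g (d + m) x a.
Proof.
move=> hg; have n1 : (-1 : K) != 0 by rewrite oppr_eq0 oner_eq0.
rewrite /stasheff_sum scalerDr !scaler_sum_split; congr (_ + _).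
  apply: eq_sum_split => u v ea; rewrite /shift_op (linZ _ _ (hg _)) !scalerA.
  rewrite !size_map ea size_cat -mulrA -sgnD mulrC; congr (sgn _ * _ *: _); lia.
apply: eq_sum_split => u [|b t] ea; first by rewrite scaler0.
rewrite scaler_sum_split; apply: eq_sum_split => v w et /=.
rewrite ea et !scalerA /sgn -!expfzDr //; congr (_ *: _).
apply: (@sgn_eq (- m * (size v).+1%:Z)).
rewrite !size_cat /= size_cat !size_map; nia.
Qed.

Lemma ah_shift_axiom : is_ainf_structure (aa_m A) shift_op.
Proof.
split; [exact: shift_op_multilin | exact: shift_op_deg |].
move=> d x a hx ha; have [[m1 _] _ h] := am_axiom M.
apply: etrans (@shift_stasheff_sum M (am_m M) 1 d x a m1) _.
by rewrite h // scaler0.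
Qed.

Lemma shift_one (x : V) : shift_op x [:: aa_one A] = x.
Proof.
rewrite /shift_op am_one /sgn (@sgn_eq m _ 0) ?expr0z ?scale1r //.
by rewrite add0r.
Qed.

Lemma shift_one_vanish (x : V) s :
  (1 < size s)%N -> aa_one A \in s -> shift_op x s = 0.
Proof. by move=> h h'; rewrite /shift_op am_one_vanish // scaler0. Qed.

Definition am_shift : ainf_mod :=
  AinfMod ah_shift_axiom shift_one shift_one_vanish.
End Object.

Section Morphism.
Variables (M N : ainf_mod) (f : ainf_hom M N).

(* the sign is (-1)^(m(n-1)) for f_n, so that shift_fun is a morphism *)
Definition shift_fun (x : am_shift M) (s : seq A) : am_shift N :=
  sgn (size s)%:Z *: f x s.

Lemma shift_fun_multilin : multilinear shift_fun.
Proof.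
have [f1 f2] := ah_multilin f.
split=> [s|x u v] c y z; rewrite /shift_fun ?f1 ?f2 ?size_cat /=;
  by rewrite scalerDr !scalerA mulrC.
Qed.

Lemma shift_fun_deg : has_degree (fun n => 1 - n%:Z) shift_fun.
Proof.
move=> d x a hx ha.
by apply: grZ; have := ah_deg f hx ha; congr (gr N _ _); lia.
Qed.

Lemma shift_fun_eq d x a : gr (am_shift M) d x -> homogeneous a ->
  stasheff_sum (aa_m A) (am_m (am_shift M)) shift_fun d x a =
  op_comp (am_m (am_shift N)) shift_fun x [seq p.2 | p <- a].
Proof.
have [f1 _] := ah_multilin f; have [[m1 _] _ _] := am_axiom N.
move=> hx ha.
have -> : shift_fun = fun x s => sgn (0 + (size s)%:Z) *: f x s.
  by apply: funext => y; apply: funext => s; rewrite add0r.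
apply: etrans (@shift_stasheff_sum M N f 0 d x a f1) _.
rewrite ah_eq // /op_comp scaler_sum_split.
apply: eq_sum_split => u v e; rewrite /= /shift_op (linZ _ _ (m1 _)) scalerA.
rewrite -sgnD !add0r; congr (sgn _ *: _).
by rewrite -(size_map (fun p => p.2) a) e size_cat; lia.
Qed.

Lemma shift_fun_one_vanish x s : aa_one A \in s -> shift_fun x s = 0.
Proof. by move=> h; rewrite /shift_fun ah_one_vanish // scaler0. Qed.

Definition ah_shift : ainf_hom (am_shift M) (am_shift N) :=
  AinfHom shift_fun_multilin shift_fun_deg shift_fun_eq shift_fun_one_vanish.
End Morphism.
End AinfShift.

Section ShiftIsos.
Variable M : ainf_mod.

Lemma am_shift_zero_deg d x : gr M d x -> gr (am_shift 0 M) d x.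
Proof. by rewrite /= addr0. Qed.

Lemma am_shift_zero_m x s : am_m M x s = am_m (am_shift 0 M) x s.
Proof. by rewrite /= /shift_op mul0r expr0z scale1r. Qed.

Definition am_shift_zero : ainf_hom M (am_shift 0 M) :=
  @ah_strict M (am_shift 0 M) id (fun _ _ _ => erefl)
    am_shift_zero_deg am_shift_zero_m.

Lemma am_shift_add_deg m n d x :
  gr (am_shift n (am_shift m M)) d x -> gr (am_shift (m + n) M) d x.
Proof. by rewrite /= -addrA [n + m]addrC. Qed.

Lemma am_shift_add_m m n x s :
  am_m (am_shift n (am_shift m M)) x s = am_m (am_shift (m + n) M) x s.
Proof.
rewrite /= /shift_op /= /shift_op scalerA; congr (_ *: _).
by rewrite [(m + n) * _]mulrDl addrC expfzDr // oppr_eq0 oner_eq0.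
Qed.

Definition am_shift_add m n :
    ainf_hom (am_shift n (am_shift m M)) (am_shift (m + n) M) :=
  @ah_strict (am_shift n (am_shift m M)) (am_shift (m + n) M) id
    (fun _ _ _ => erefl) (@am_shift_add_deg m n) (@am_shift_add_m m n).
End ShiftIsos.

Section AinfCone.
Variables (M N : ainf_mod) (f : ainf_hom M N).
Let C : gmod K := gprod N (gshift 1 M).

(* The sign (-1)^(n-1) in front of f_n is forced, up to a global sign, by the
   Stasheff equations. *)
Definition cone_op (z : C) (s : seq A) : C :=
  (am_m N z.1 s + (-1) ^+ size s *: f z.2 s, am_m (am_shift 1 M) z.2 s).

Lemma cone_op_multilin : multilinear cone_op.
Proof.
have [[m1 m2] _ _] := am_axiom N; have [f1 f2] := ah_multilin f.
have [[n1 n2] _ _] := am_axiom (am_shift 1 M).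
split=> [s|z u v] c y t; rewrite /cone_op; congr pair.
- by rewrite /= m1 f1 !scalerDr !scalerA [c * _]mulrC addrACA.
- exact: n1.
- by rewrite /= m2 f2 !size_cat !scalerDr !scalerA [c * _]mulrC addrACA.
- exact: n2.
Qed.

Lemma cone_op_deg : has_degree (fun n => 2 - n%:Z) cone_op.
Proof.
move=> d z a [h1 h2] ha; have [_ hN _] := am_axiom N.
have [_ hM _] := am_axiom (am_shift 1 M); split; last exact: hM.
apply: grD; first exact: hN.
by apply: grZ; have := ah_deg f h2 ha; congr (gr N _ _); lia.
Qed.

Let p1 : C -> N := fst.
Let p2 : C -> am_shift 1 M := snd.

Lemma fst_linear : linear p1. Proof. by []. Qed.
Lemma snd_linear : linear p2. Proof. by []. Qed.

Lemma cone_op_eq d z a : gr C d z -> homogeneous a ->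
  stasheff_sum (aa_m A) cone_op cone_op d z a = 0.
Proof.
move=> [h1 h2] ha; have [[m1 _] _ hN] := am_axiom N.
have [_ _ hM] := am_axiom (am_shift 1 M); have [f1 _] := ah_multilin f.
have e2 : (stasheff_sum (aa_m A) cone_op cone_op d z a).2 = 0.
  apply: (etrans (linear_stasheff_sum cone_op cone_op d z a snd_linear)).
  exact: (etrans (@stasheff_sum_strict C (am_shift 1 M) (am_shift 1 M) cone_op
    (am_m (am_shift 1 M)) p2 (am_m (am_shift 1 M)) d z a (fun _ _ => erefl))
    (hM _ _ _ h2 ha)).
have e1 : (stasheff_sum (aa_m A) cone_op cone_op d z a).1 = 0.
  apply: (etrans (linear_stasheff_sum cone_op cone_op d z a fst_linear)).
  rewrite /p1 /= stasheff_sumD.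
  have -> : stasheff_sum (aa_m A) cone_op
     (fun x s => (-1) ^+ size s *: f x.2 s) d z a =
     (-1) ^+ (size a).+1 *: op_comp (am_m N) f z.2 [seq p.2 | p <- a].
    apply: (etrans (@stasheff_sum_strict C (am_shift 1 M) N cone_op
      (am_m (am_shift 1 M)) p2 (fun y s => (-1) ^+ size s *: f y s) d z a
      (fun _ _ => erefl))).
    have -> : (fun (y : am_shift 1 M) s => (-1) ^+ size s *: f y s) =
        (fun y s => (-1) ^ (1 * (0 + (size s)%:Z)) *: f y s).
      by apply: funext => y; apply: funext => s; rewrite mul1r add0r.
    apply: (etrans (@shift_stasheff_sum 1 M N f 0 d z.2 a f1)).
    by rewrite ah_eq // mul1r add0r.
  rewrite /stasheff_sum /cone_op /=.
  transitivity (stasheff_sum (aa_m A) (am_m N) (am_m N) d z.1 a +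
    sum_split (fun u v => (-1) ^+ size a *: 
      am_m N (f z.2 [seq p.2 | p <- u]) [seq p.2 | p <- v]) a +
    (-1) ^+ (size a).+1 *: op_comp (am_m N) f z.2 [seq p.2 | p <- a]).
    congr (_ + _); rewrite /stasheff_sum addrAC; congr (_ + _).
    rewrite -sum_splitD; apply: eq_sum_split => u v e.
    rewrite (linD _ _ (m1 _)) (linZ _ _ (m1 _)) scalerDr scalerA -exprD.
    by rewrite size_map e size_cat addnC.
  rewrite hN // add0r /op_comp sum_split_map /sum_split -scaler_sumr.
  by rewrite -scalerDl exprS mulN1r addrN scale0r.
by case: (stasheff_sum _ _ _ _ _ _) e1 e2 => u v /= -> ->.
Qed.

Lemma cone_one z : cone_op z [:: aa_one A] = z.
Proof.
by case: z => y x; rewrite /cone_op am_one (am_one (a := am_shift 1 M))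
  ah_one_vanish ?mem_head // scaler0 addr0.
Qed.

Lemma cone_one_vanish z s :
  (1 < size s)%N -> aa_one A \in s -> cone_op z s = 0.
Proof.
move=> h h'; rewrite /cone_op !am_one_vanish // ah_one_vanish //.
by rewrite scaler0 addr0.
Qed.

Definition am_cone : ainf_mod :=
  AinfMod (And3 cone_op_multilin cone_op_deg cone_op_eq) cone_one
    cone_one_vanish.

Lemma am_cone_in_lin : linear (fun y : N => ((y, 0) : am_cone)).
Proof. by move=> a x y; congr pair; rewrite /= scaler0 addr0. Qed.

Lemma am_cone_in_deg n (y : N) : gr N n y -> gr am_cone n (y, 0).
Proof. by move=> h; split => //; apply: gr0. Qed.

Lemma am_cone_in_m (y : N) s :
  ((am_m N y s, 0) : am_cone) = am_m am_cone (y, 0) s.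
Proof.
have [f1 _] := ah_multilin f; have [[m1 _] _ _] := am_axiom (am_shift 1 M).
by congr pair; [rewrite /= (lin0 (f1 _)) scaler0 addr0 | rewrite -[LHS](lin0 (m1 s))].
Qed.

Definition am_cone_in : ainf_hom N am_cone :=
  ah_strict am_cone_in_lin am_cone_in_deg am_cone_in_m.

Lemma am_cone_out_deg n (z : am_cone) :
  gr am_cone n z -> gr (am_shift 1 M) n z.2.
Proof. by case. Qed.

Definition am_cone_out : ainf_hom am_cone (am_shift 1 M) :=
  @ah_strict am_cone (am_shift 1 M) snd (@snd_linear) am_cone_out_deg
    (fun _ _ => erefl).
End AinfCone.

Definition ainf_modules : dg_model K :=
  @DGModel K ainf_category ah_lincomb
    (fun M N (f : ainf_hom M N) =>
       iso_on_cohomology (fun x => am_m M x [::]) (fun x => am_m N x [::])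
         (fun x => f x [::]))
    am_shift ah_shift am_shift_zero
    (fun m n M => am_shift_add M m n) am_cone am_cone_in am_cone_out.

Lemma free_module_vanish (x : A) s :
  (1 < size s)%N -> aa_one A \in s -> aa_m A x s = 0.
Proof.
by move=> hs h; apply: aa_one_vanish; [case: s hs {h} => [|? []] |
  rewrite inE h orbT].
Qed.

Definition free_module : ainf_mod :=
  AinfMod (aa_axiom A) (@aa_one_r _ A) free_module_vanish.

End AinfModules.
Arguments am_m {K A} _ _ _.
Arguments free_module {K} A.

Section RightModules.
Variables (K : fieldType) (L : falgType K).
Implicit Types M N : lmodType L^c.

Definition submodule M (P : M -> Prop) :=
  P 0 /\ forall a x y, P x -> P y -> P (a *: x + y).

Definition zero_sub M (P : M -> Prop) := forall x, P x -> x = 0.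

Definition fin_dim M (P : M -> Prop) :=
  exists s : seq M, forall x, P x ->
    exists c : 'I_(size s) -> K, x = \sum_i kscale (c i) s`_i.

Definition fin_gen M (P : M -> Prop) :=
  exists2 s : seq M, forall x, x \in s -> P x &
    forall x, P x -> exists c : 'I_(size s) -> L^c, x = \sum_i c i *: s`_i.

Definition module_iso M N := exists2 f : M -> N, linear f & bijective f.

Definition simple_module M :=
  (exists x : M, x != 0) /\
  forall P : M -> Prop, submodule P -> zero_sub P \/ forall x, P x.

Definition simple_representatives (r : nat) (S : 'I_r -> lmodType L^c) :=
  [/\ forall j, simple_module (S j),
      forall i j, module_iso (S i) (S j) -> i = j
    & forall M, simple_module M -> exists j, module_iso M (S j)].

(* the submodule P is an injective module *)
Definition injective_module N (P : N -> Prop) :=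
  forall M M' (i : M -> M') (f : M -> N), linear i -> injective i ->
    linear f -> (forall x, P (f x)) ->
    exists g : M' -> N, [/\ linear g, forall y, P (g y) & forall x, g (i x) = f x].

Definition indecomposable M :=
  (exists x : M, x != 0) /\
  forall P Q : M -> Prop, submodule P -> submodule Q ->
    (forall x, P x -> Q x -> x = 0) ->
    (forall x, exists y z, [/\ P y, Q z & x = y + z]) ->
    zero_sub P \/ zero_sub Q.

(* I is the indecomposable injective module corresponding to the simple S *)
Definition injective_of_simple (S I : lmodType L^c) :=
  [/\ injective_module (fun _ : I => True), indecomposable I
    & exists2 i : S -> I, linear i & injective i].

Record fd_module := FdModule {
  fd_mod :> lmodType L^c;
  fd_fin_dim : fin_dim (fun _ : fd_mod => True) }.

Definition additive_on_sequences (G : zmodType) (cl : fd_module -> G) :=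
  forall (M M' M'' : fd_module) (i : M' -> M) (p : M -> M''),
    linear i -> linear p -> injective i -> (forall z, exists x, p x = z) ->
    (forall x, p x = 0 <-> exists y, x = i y) -> cl M = cl M' + cl M''.

(* G is the Grothendieck group of mod L, with M |-> cl M the class of M *)
Definition grothendieck_group (G : zmodType) (cl : fd_module -> G) :=
  additive_on_sequences cl /\
  forall (H : zmodType) (phi : fd_module -> H), additive_on_sequences phi ->
    exists! psi : G -> H, {morph psi : x y / x + y} /\
      forall V : fd_module, psi (cl V) = phi V.

Definition free_rank (G : zmodType) (r : nat) :=
  (exists b : 'I_r -> G, forall c : 'I_r -> int,
     \sum_i b i *~ c i = 0 -> forall i, c i = 0) /\
  (forall b : 'I_r.+1 -> G, exists c : 'I_r.+1 -> int,
     (exists i, c i != 0) /\ \sum_i b i *~ c i = 0).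

Definition primitive_idempotent (e : L) :=
  [/\ e != 0, e * e = e
    & forall f g : L, f * f = f -> g * g = g -> f * g = 0 -> g * f = 0 ->
        e = f + g -> f = 0 \/ g = 0].

(* f : eL -> e'L is a morphism of right L-modules *)
Definition ideal_morphism (e e' : L) (f : L -> L) :=
  forall x y a, e * x = x -> e * y = y ->
    e' * f x = f x /\ f (x * a + y) = f x * a + f y.

Definition ideal_iso (e e' : L) :=
  exists f g : L -> L,
    [/\ ideal_morphism e e' f, ideal_morphism e' e g,
        forall x, e * x = x -> g (f x) = x
      & forall y, e' * y = y -> f (g y) = y].

Definition basic :=
  exists (n : nat) (e : 'I_n -> L),
    [/\ forall i, primitive_idempotent (e i),
        forall i j, i != j -> e i * e j = 0,
        \sum_i e i = 1
      & forall i j, ideal_iso (e i) (e j) -> i = j].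

Variable D : derived (complexes L).
Implicit Types Z : obj (complexes L).

(* D^b(mod L) and D^-(mod L), as (replete) full subcategories of D(Mod L) *)
Definition Db Z := exists C : complex L,
  [/\ exists N : int, forall n x, N < `|n| -> gr C n x -> x = 0,
      forall n, fin_dim (gr C n) & isomorphic D Z C].

Definition Dminus Z := exists C : complex L,
  [/\ exists N : int, forall n x, N < n -> gr C n x -> x = 0,
      forall n, fin_dim (gr C n) & isomorphic D Z C].

Definition bounded_injective_complex (C : complex L) :=
  [/\ exists N : int, forall n x, N < `|n| -> gr C n x -> x = 0,
      forall n, fin_gen (gr C n) & forall n, injective_module (gr C n)].

Definition simple_minded (r : nat) (X : 'I_r -> obj (complexes L)) :=
  [/\ forall i, Db (X i),
      forall (m : int) i j, m < 0 ->
        is_trivial (dhom D (X i) (shift m (X j))),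
      forall i j, if i == j then is_line (dhom D (X i) (X j))
                  else is_trivial (dhom D (X i) (X j))
    & forall Z, Db Z <-> thick_of D X Z].

End RightModules.

Section Positive.
Variables (K : fieldType) (A : ainf_alg K).

Definition minimal := forall a, aa_m A a [::] = 0.

(* A is positive and 1 = e_1 + ... + e_r is the decomposition into primitive
   orthogonal idempotents of A^0 = K^r *)
Definition positive (r : nat) (e : 'I_r -> A) :=
  [/\ (0 < r)%N,
      forall d x, d < 0 -> gr A d x -> x = 0,
      [/\ forall i, gr A 0 (e i) /\ e i != 0,
          forall i j, aa_m A (e i) [:: e j] = if i == j then e i else 0,
          \sum_i e i = aa_one A
        & forall x, gr A 0 x -> exists c : 'I_r -> K, x = \sum_i c i *: e i]
    & forall a s, size s != 1 ->
        (exists2 b, b \in a :: s & gr A 0 b) -> aa_m A a s = 0].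

Definition positive_degree (a : A) :=
  exists s : seq (int * A), [/\ homogeneous s,
    forall p, p \in s -> 0 < p.1 & a = \sum_(p <- s) p.2].

(* i identifies P with the A_oo-submodule eA of the free module A *)
Definition idempotent_submodule (e : A) (P : ainf_mod A) (i : P -> A) :=
  [/\ linear i /\ injective i,
      forall d x, gr P d x <-> gr A d (i x),
      forall x s, i (am_m P x s) = aa_m A (i x) s
    & forall a, (exists x, i x = a) <-> exists b, a = aa_m A e [:: b]].

(* Y is (isomorphic to) the quotient eA / eA^(>0) *)
Definition simple_ainf_module (e : A) (Y : ainf_mod A) :=
  exists (P : ainf_mod A) (i : P -> A) (q : P -> Y),
    [/\ idempotent_submodule e i,
        linear q /\ forall y, exists x, q x = y,
        forall d x, gr P d x -> gr Y d (q x),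
        forall x s, q (am_m P x s) = am_m Y (q x) s
      & forall x, q x = 0 <->
          exists2 b, positive_degree b & i x = aa_m A e [:: b]].

Variable D : derived (ainf_modules A).

Definition per := thick D (fun M => M = free_module A).

Definition Dfd : obj (ainf_modules A) -> Prop := fun M : ainf_mod A =>
  exists s : seq M, forall x, am_m M x [::] = 0 ->
    exists (c : 'I_(size s) -> K) (z : M),
      x = \sum_i c i *: s`_i + am_m M z [::].

Definition isomorphic_to_idempotent_module (e : A) (Z : obj (ainf_modules A)) :=
  exists (P : ainf_mod A) (i : P -> A),
    idempotent_submodule e i /\ isomorphic D Z P.

End Positive.

(* theta identifies the underlying graded algebra of A with
   \bigoplus_m Hom(X, Sigma^m X), where the product of f : X -> Sigma^m X and
   g : X -> Sigma^n X is Sigma^n f o g. *)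
Definition graded_end_algebra (K : fieldType) (C : dg_model K) (D : derived C)
    (X : obj C) (A : ainf_alg K)
    (theta : forall m : int, dhom D X (shift m X) -> A) :=
  [/\ forall m, linear (theta m) /\ injective (theta m),
      forall m x, gr A m x <-> exists f, x = theta m f,
      forall m n (f : dhom D X (shift m X)) (g : dhom D X (shift n X)),
        theta (m + n) (dcomp (loc D (shift_add m n X)) (dcomp (dshift n f) g)) =
        aa_m A (theta m f) [:: theta n g]
    & theta 0 (loc D (shift_zero X)) = aa_one A].

(* The idempotent id_(X_a) of \bigoplus_m Hom(X, Sigma^m X), where X is the
   direct sum of the X_a, with injections i and projections p. *)
Definition idempotent_of (K : fieldType) (C : dg_model K) (D : derived C)
    (r : nat) (Xs : 'I_r -> obj C) (X : obj C)
    (i : forall a, dhom D (Xs a) X) (p : forall a, dhom D X (Xs a))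
    (A : ainf_alg K) (theta : forall m : int, dhom D X (shift m X) -> A)
    (a : 'I_r) : A :=
  theta 0 (dcomp (loc D (shift_zero X)) (dcomp (i a) (p a))).

Definition positive_end_algebra (K : fieldType) (C : dg_model K)
    (D : derived C) (r : nat) (Xs : 'I_r -> obj C) (X : obj C)
    (i : forall a, dhom D (Xs a) X) (p : forall a, dhom D X (Xs a))
    (A : ainf_alg K) (theta : forall m : int, dhom D X (shift m X) -> A) :=
  [/\ graded_end_algebra theta, minimal A & positive (idempotent_of i p theta)].

(* Main.v *)
(** Write S for the suspension.  For b), Hom(X_j, S^m T_i) is the group of
    morphisms in D(AX) from the projective P_j to S^m Y_i.  Degree-zero cocycles
    x of a module M with x e_j = x give morphisms P_j -> M, by the explicit
    A_oo-morphism (b, a_2, ..., a_n) |-> +-m(x, b, a_2, ..., a_n), and all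
    morphisms arise so; the group is therefore H^m(Y_i e_j).

    Let W in thick(X) satisfy Hom(X_j, S^n W) = 0 for all n < 0, and let Z
    satisfy Hom(X_j, S^n Z) = 0 for all n >= 0.  Then Hom(W, Z) = 0: since W is
    built from shifts of the X_j, a morphism W -> Z survives successive cones of
    maps S^-n X_j -> W with n >= 0, a process which stays inside the class of W
    and can be arranged to kill the identity of W.  With b) this gives e).  For
    a), take Z in thick(X) and n maximal with Hom(X_j, S^n Z) nonzero for some j.
    The orthogonality extends a nonzero morphism S^-n X_j -> Z along
    S^-n X_j -> S^-n T_j, and the cone of the extension has smaller total
    Hom(X_i, S^m -); induction ends with an object orthogonal to thick(X).

    Bounded complexes of finitely generated injectives form a thick subcategory:
    an idempotent of the derived category lifts to a chain endomorphism, and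
    Fitting's lemma splits off the image of one of its powers.  This is c).  For
    d), a nonzero cohomology class of C is detected by a chain map from C to a
    shift of some I_k, which lies in thick(T). *)

Require Import Defs.
From HB Require Import structures.
From mathcomp Require Import all_boot all_order all_algebra.
From mathcomp Require Import falgebra boolp.
From mathcomp Require classical_sets.
From mathcomp Require Import zify.

Set Implicit Arguments.
Unset Strict Implicit.
Unset Printing Implicit Defensive.

Import Order.TTheory GRing.Theory Num.Theory.
Local Open Scope ring_scope.

(** * Chain homotopies *)

(** The obstacle that shapes the proof is that [derived] describes the derived category by a
    universal property only, so nothing is known about its morphisms in advance. The uniqueness
    clause of [loc_univ] shows that they are generated by chain maps and inverses of
    quasi-isomorphisms, which allows induction on morphisms. The existence clause, applied to
    set-valued functors, gives the converse information: a chain map with zero image becomes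
    null-homotopic after composition with a quasi-isomorphism, and H^0 of A_oo-modules descends to
    the derived category, so that classes separate morphisms. K-injective targets then turn
    morphisms into chain maps up to homotopy. This is also the source of finiteness: an object Z of
    thick(I_1, ..., I_r) is a bounded complex of finite-dimensional injectives, so Hom(X_j, S^n Z)
    is finite-dimensional and zero for large |n|, and the induction for a) terminates. That the I_k
    are finite-dimensional has to be proved: they are given as indecomposable injectives containing
    a simple module, and the proof embeds them in the dual of L. *)

Section Homotopy.
Variables (K : fieldType) (L : falgType K).
Implicit Types M N P Q V W : complex L.

(** Stated for bare functions, so that sums, differences and composites need not be packaged as
    chain maps. *)
Definition null_homotopic M N (f : M -> N) :=
  exists h : M -> N, [/\ linear h, forall n x, gr M n x -> gr N (n - 1) (h x)
    & forall x, f x = cx_d N (h x) + h (cx_d M x)].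

Definition homotopic M N (f g : M -> N) := null_homotopic (fun x => f x - g x).

Lemma cx_dB M x y : cx_d M (x - y) = cx_d M x - cx_d M y.
Proof. by rewrite (linD _ _ (@cx_d_lin _ _ M)) (linN _ (@cx_d_lin _ _ M)). Qed.
Lemma cx_dD M x y : cx_d M (x + y) = cx_d M x + cx_d M y.
Proof. by rewrite (linD _ _ (@cx_d_lin _ _ M)). Qed.
Lemma cx_dN M x : cx_d M (- x) = - cx_d M x.
Proof. by rewrite (linN _ (@cx_d_lin _ _ M)). Qed.
Lemma cx_d0 M : cx_d M 0 = 0.
Proof. by rewrite (lin0 (@cx_d_lin _ _ M)). Qed.
Lemma cmD M N (f : chain_map M N) x y : f (x + y) = f x + f y.
Proof. by rewrite (linD _ _ (cm_lin f)). Qed.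
Lemma cmB M N (f : chain_map M N) x y : f (x - y) = f x - f y.
Proof. by rewrite (linD _ _ (cm_lin f)) (linN _ (cm_lin f)). Qed.
Lemma cmN M N (f : chain_map M N) x : f (- x) = - f x.
Proof. by rewrite (linN _ (cm_lin f)). Qed.
Lemma cm0 M N (f : chain_map M N) : f 0 = 0.
Proof. by rewrite (lin0 (cm_lin f)). Qed.

Lemma grN (V : gmod L^c) d (x : V) : gr V d x -> gr V d (- x).
Proof. by move=> h; rewrite -scaleN1r; apply: grZ. Qed.

Lemma linear_addf (U V : lmodType L^c) (f g : U -> V) :
  linear f -> linear g -> linear (fun x => f x + g x).
Proof. by move=> hf hg a x y; rewrite hf hg scalerDr addrACA. Qed.

Lemma linear_oppf (U V : lmodType L^c) (f : U -> V) :
  linear f -> linear (fun x => - f x).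
Proof. by move=> hf a x y; rewrite hf opprD scalerN. Qed.

Lemma linear_compf (U V W : lmodType L^c) (f : V -> W) (g : U -> V) :
  linear f -> linear g -> linear (fun x => f (g x)).
Proof. by move=> hf hg a x y; rewrite hg hf. Qed.

Lemma null_homotopic0 M N : null_homotopic (fun _ : M => 0 : N).
Proof.
exists (fun=> 0); split=> [a x y|n x _|x].
- by rewrite scaler0 addr0.
- exact: gr0.
- by rewrite cx_d0 addr0.
Qed.

Lemma null_homotopicD M N (f g : M -> N) :
  null_homotopic f -> null_homotopic g -> null_homotopic (fun x => f x + g x).
Proof.
move=> [h [h1 h2 h3]] [k [k1 k2 k3]]; exists (fun x => h x + k x); split.
- exact: linear_addf.
- by move=> n x hx; apply: grD; auto.
- by move=> x; rewrite h3 k3 cx_dD addrACA.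
Qed.

Lemma null_homotopicN M N (f : M -> N) :
  null_homotopic f -> null_homotopic (fun x => - f x).
Proof.
move=> [h [h1 h2 h3]]; exists (fun x => - h x); split.
- exact: linear_oppf.
- by move=> n x hx; apply: grN; auto.
- by move=> x; rewrite h3 cx_dN opprD.
Qed.

Lemma null_homotopic_comp M N P Q (f : N -> P) (g : chain_map P Q)
  (k : chain_map M N) :
  null_homotopic f -> null_homotopic (fun x => g (f (k x))).
Proof.
move=> [h [h1 h2 h3]]; exists (fun x => g (h (k x))); split.
- exact: (linear_compf (cm_lin g) (linear_compf h1 (cm_lin k))).
- by move=> n x hx; do 2!apply: cm_deg || apply: h2; apply: (cm_deg k).
- by move=> x; rewrite h3 cmD cm_comm cm_comm.
Qed.

Lemma null_homotopic_eq M N (f g : M -> N) :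
  f =1 g -> null_homotopic f -> null_homotopic g.
Proof. by move=> e [h [h1 h2 h3]]; exists h; split=> // x; rewrite -e. Qed.

Lemma null_homotopicB M N (f : M -> N) :
  null_homotopic f <-> homotopic f (fun=> 0).
Proof. by split; apply: null_homotopic_eq => x; rewrite subr0. Qed.

Lemma homotopic_refl M N (f : M -> N) : homotopic f f.
Proof. by apply: null_homotopic_eq (null_homotopic0 M N) => x; rewrite subrr. Qed.

Lemma homotopic_eq M N (f g : M -> N) : f =1 g -> homotopic f g.
Proof. by move=> /funext ->; apply: homotopic_refl. Qed.

Lemma homotopic_sym M N (f g : M -> N) : homotopic f g -> homotopic g f.
Proof. by move=> /null_homotopicN; apply: null_homotopic_eq => x; rewrite opprB. Qed.

Lemma homotopic_trans M N (f g h : M -> N) :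
  homotopic f g -> homotopic g h -> homotopic f h.
Proof.
move=> h1 h2; apply: null_homotopic_eq (null_homotopicD h1 h2) => x.
by rewrite addrA subrK.
Qed.

Lemma homotopic_comp M N P (f f' : chain_map N P) (g g' : chain_map M N) :
  homotopic f f' -> homotopic g g' ->
  homotopic (fun x => f (g x)) (fun x => f' (g' x)).
Proof.
move=> h1 h2; have e1 := null_homotopic_comp (cm_id P) g h1.
have e2 := null_homotopic_comp f' (cm_id M) h2.
apply: null_homotopic_eq (null_homotopicD e1 e2) => x /=.
by rewrite cmB addrA subrK.
Qed.

Definition cm_qis M N (f : chain_map M N) :=
  iso_on_cohomology (cx_d M) (cx_d N) f.

Lemma qis_id M : cm_qis (cm_id M).
Proof.
split=> [x _ [y e]|y hy]; first by exists y.
by exists y, 0; rewrite cx_d0 addr0.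
Qed.

Lemma qis_homotopic M N (f g : chain_map M N) :
  homotopic f g -> cm_qis f -> cm_qis g.
Proof.
move=> [h [h1 h2 h3]] [i s]; split.
  move=> x hx [y e]; apply: i => //; exists (y + h x).
  by rewrite cx_dD -e -[f x](subrK (g x)) h3 hx (lin0 h1) addr0 addrC.
move=> y hy; have [x [z [e ->]]] := s y hy; exists x, (z + h x); split=> //.
rewrite -[f x](subrK (g x)) h3 e (lin0 h1) addr0 cx_dD.
by rewrite [_ + g x]addrC -addrA [cx_d N (h x) + _]addrC.
Qed.

Lemma qis_comp M N P (g : chain_map N P) (f : chain_map M N) :
  cm_qis g -> cm_qis f -> cm_qis (cm_comp g f).
Proof.
move=> [gi gs] [fi fs]; split=> /=.
  move=> x hx e; apply: (fi _ hx); apply: gi => //.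
  by rewrite -cm_comm hx cm0.
move=> y hy; have [x [z [e ->]]] := gs y hy.
have [x' [z' [e' ->]]] := fs x e; exists x', (z + g z'); split=> //.
by rewrite cmD cx_dD cm_comm -addrA [cx_d P z + _]addrC.
Qed.

Lemma qis_right M N P (g : chain_map N P) (f : chain_map M N) :
  cm_qis g -> cm_qis (cm_comp g f) -> cm_qis f.
Proof.
move=> [gi gs] [ci cs]; split=> /=.
  move=> x hx [y e]; apply: ci => //=; exists (g y); by rewrite e cm_comm.
move=> y hy; have hgy : cx_d P (g y) = 0 by rewrite -cm_comm hy cm0.
have [x [z [e e2]]] := cs _ hgy; exists x.
have [||w hw] := gi (y - f x).
- by rewrite cx_dB hy -cm_comm e cm0 subrr.
- by exists z; rewrite cmB e2 /= addrAC subrr add0r.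
by exists w; split=> //; rewrite -hw addrC subrK.
Qed.

Definition acyclic M := forall x, cx_d M x = 0 -> exists y, x = cx_d M y.

End Homotopy.

(** * Cones, homotopy pullbacks and pushouts *)

Section Cones.
Variables (K : fieldType) (L : falgType K).
Implicit Types M N P Q T V W : complex L.

Lemma pair_linear (U V W : lmodType L^c) (f : U -> V) (g : U -> W) :
  linear f -> linear g -> linear (fun x => (f x, g x)).
Proof. by move=> hf hg a x y; rewrite hf hg. Qed.

Lemma zero_linear (U V : lmodType L^c) : linear (fun _ : U => 0 : V).
Proof. by move=> a x y; rewrite scaler0 addr0. Qed.

Lemma cone_in_null M N (f : chain_map M N) :
  null_homotopic (fun x => cx_cone_in f (f x)).
Proof.
exists (fun x => ((0, x) : cx_cone f)); split.
- exact: (pair_linear (@zero_linear M N) (fun _ _ _ => erefl)).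
- by move=> n x hx; split; [apply: gr0 | rewrite /= subrK].
- move=> x; congr pair => /=; first by rewrite cx_d0 add0r addr0.
  by rewrite addNr.
Qed.

(** A null-homotopy into the cone has two components: the one in M is the chain map [g], and the one
    in N is, up to sign, a homotopy between f g and k. *)
Lemma cone_lift M N V (f : chain_map M N) (k : chain_map V N) :
  null_homotopic (fun x => cx_cone_in f (k x)) ->
  exists g : chain_map V M, homotopic (fun x => f (g x)) k.
Proof.
move=> [h [h1 h2 h3]].
have e1 x : k x = cx_d N (h x).1 + f (h x).2 + (h (cx_d V x)).1.
  by have := congr1 fst (h3 x).
have e2 x : (h (cx_d V x)).2 = cx_d M (h x).2.
  by have /= := congr1 snd (h3 x); move/esym/eqP; rewrite addrC subr_eq0 => /eqP.
have l2 : linear (fun x => (h x).2 : M) by move=> a x y; rewrite h1.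
have d2 n x : gr V n x -> gr M n (h x).2.
  by move=> hx; have [_ /=] := h2 _ _ hx; rewrite subrK.
exists (ChainMap l2 d2 e2).
exists (fun x => - (h x).1); split.
- by move=> a x y; rewrite h1 /= opprD scalerN.
- by move=> n x hx; apply: grN; have [] := h2 _ _ hx.
- move=> x; rewrite e1 cx_dN /= [X in _ - X]addrAC opprD addrCA subrr addr0.
  by rewrite opprD.
Qed.

Section ConeExt.
Variables (M N T : complex L) (f : chain_map M N) (k : chain_map N T) (h : M -> T).
Hypotheses (h1 : linear h) (h2 : forall n x, gr M n x -> gr T (n - 1) (h x))
  (h3 : forall x, k (f x) = cx_d T (h x) + h (cx_d M x)).
Let e (z : cx_cone f) : T := k z.1 + h z.2.

Lemma cone_ext_lin : linear e.
Proof.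
by move=> a [y x] [y' x']; rewrite /e /= (cm_lin k) h1 scalerDr addrACA.
Qed.

Lemma cone_ext_deg n z : gr (cx_cone f) n z -> gr T n (e z).
Proof.
move=> [hy hx]; apply: grD; first exact: (cm_deg k).
by have := h2 hx; rewrite addrK.
Qed.

Lemma cone_ext_comm z : e (cx_d (cx_cone f) z) = cx_d T (e z).
Proof.
case: z => y x; rewrite /e /= cmD h3 (linN _ h1) cx_dD cm_comm -!addrA.
by rewrite subrr addr0.
Qed.

Definition cone_ext : chain_map (cx_cone f) T :=
  ChainMap cone_ext_lin cone_ext_deg cone_ext_comm.
End ConeExt.

(** A null-homotopy [h] of k f is exactly the missing component of the extension (y, x) |-> k y + h
    x. *)
Lemma cone_extend M N T (f : chain_map M N) (k : chain_map N T) :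
  null_homotopic (fun x => k (f x)) ->
  exists k' : chain_map (cx_cone f) T, cm_comp k' (cx_cone_in f) = k.
Proof.
move=> [h [h1 h2 h3]]; exists (cone_ext h1 h2 h3).
by apply: chain_map_eq => x /=; rewrite (lin0 h1) addr0.
Qed.

Lemma qis_acyclic_cone M N (f : chain_map M N) : cm_qis f -> acyclic (cx_cone f).
Proof.
move=> [fi fs] [y x] [/= e1 /eqP]; rewrite oppr_eq0 => /eqP e2.
have [|x' ex] := fi x e2.
  by exists (- y); rewrite cx_dN; apply/eqP; rewrite -addr_eq0 addrC e1.
have [|w [z [ew ez]]] := fs (y + f x').
  by rewrite cx_dD -cm_comm -ex e1.
exists (z, w - x'); congr pair => /=.
  by rewrite cmB addrA [cx_d _ z + _]addrC -ez addrK.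
by rewrite cx_dB ew sub0r opprK.
Qed.

(* The homotopy pullback N x_Q W, whose element ((n, w), q) carries a homotopy
   q from s n to g w. *)
Section Pullback.
Variables (N W Q : complex L) (s : chain_map N Q) (g : chain_map W Q).
Let C : gmod L^c := gprod (gprod N W) (gshift (-1) Q).
Let d (z : C) : C :=
  ((cx_d N z.1.1, cx_d W z.1.2), s z.1.1 - g z.1.2 - cx_d Q z.2).

Lemma pb_lin : linear d.
Proof.
move=> a [[n w] q] [[n' w'] q']; rewrite /d /=; congr (_, _, _).
- by rewrite (@cx_d_lin _ _ N).
- by rewrite (@cx_d_lin _ _ W).
- rewrite (cm_lin s) (cm_lin g) (@cx_d_lin _ _ Q) /= !scalerBr !opprD.
  by rewrite [a *: s n + s n' + _]addrACA [LHS]addrACA.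
Qed.

Lemma pb_deg n z : gr C n z -> gr C (n + 1) (d z).
Proof.
move=> [[h1 h2] h3]; split.
  by split; rewrite /=; apply: cx_d_deg.
rewrite /= addrK; apply: grB.
  by apply: grB; [apply: (cm_deg s) | apply: (cm_deg g)].
by have := cx_d_deg h3; rewrite subrK.
Qed.

Lemma pb_dd z : d (d z) = 0.
Proof.
case: z => [[n w] q]; rewrite /d /= !cx_dd; congr (_, _, _).
by rewrite !cx_dB cx_dd !cm_comm subr0 subrr.
Qed.

Definition pullback : complex L := Complex pb_lin pb_deg pb_dd.

Definition pb_fst : chain_map pullback N :=
  @ChainMap _ _ pullback N (fun z => z.1.1) (fun _ _ _ => erefl)
    (fun n z h => proj1 (proj1 h)) (fun=> erefl).

Definition pb_snd : chain_map pullback W :=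
  @ChainMap _ _ pullback W (fun z => z.1.2) (fun _ _ _ => erefl)
    (fun n z h => proj2 (proj1 h)) (fun=> erefl).

Lemma pb_homotopic :
  homotopic (fun z => s (pb_fst z)) (fun z => g (pb_snd z)).
Proof.
exists (fun z : pullback => z.2); split=> // [n z [_] //|z].
by rewrite /= [RHS]addrC subrK.
Qed.

(** The kernel of the surjection [pb_snd] is the homotopy fibre of [s], which is acyclic; the proof
    is the corresponding diagram chase. *)
Lemma pb_snd_qis : cm_qis s -> cm_qis pb_snd.
Proof.
move=> [si ss]; split.
  move=> [[n w] q] /= [e1 e2 e3] [w' ew].
  have [|n' en] := si n e1.
    exists (q + g w'); rewrite cx_dD -cm_comm -ew.
    by apply/eqP; rewrite -subr_eq -subr_eq0 e3.
  have [|n2 [q2 [en2 eq2]]] := ss (q + g w' - s n').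
    rewrite cx_dB cx_dD -!cm_comm -ew -en; apply/eqP.
    by rewrite -oppr_eq0 opprB opprD addrCA addrC addrAC -addrA; apply/eqP;
       rewrite -e3 addrAC addrA.
  exists ((n' + n2, w'), - q2); congr (_, _, _) => /=.
  - by rewrite cx_dD en2 addr0.
  - by [].
  - rewrite cmD cx_dN opprK; move/eqP: eq2; rewrite subr_eq => /eqP.
    move/(canRL (addrK _)) => ->.
    rewrite [RHS]addrAC; congr (_ - _); rewrite addrC addrA; exact: (etrans (esym (addrA _ _ _)) (addrC _ _)).
move=> w ew; have [|n [q [en eq]]] := ss (g w); first by rewrite -cm_comm ew cm0.
exists ((n, w), - q), 0; split; last by rewrite cx_d0 addr0.
by congr (_, _, _) => //=; rewrite cx_dN opprK eq opprD addrA subrr sub0r addNr.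
Qed.
End Pullback.

Section Pushout.
Variables (M W N : complex L) (t : chain_map M W) (g : chain_map M N).
Let C : gmod L^c := gprod (gprod W N) (gshift 1 M).
Let d (z : C) : C :=
  ((cx_d W z.1.1 + t z.2, cx_d N z.1.2 - g z.2), - cx_d M z.2).

Lemma po_lin : linear d.
Proof.
move=> a [[w n] x] [[w' n'] x']; rewrite /d /=; congr (_, _, _).
- by rewrite (@cx_d_lin _ _ W) (cm_lin t) /= !scalerDr addrACA.
- by rewrite (@cx_d_lin _ _ N) (cm_lin g) /= !scalerBr !opprD addrACA.
- by rewrite (@cx_d_lin _ _ M) opprD -scalerN.
Qed.

Lemma po_deg n z : gr C n z -> gr C (n + 1) (d z).
Proof.
move=> [[h1 h2] h3]; split; last by apply: grN; apply: (@cx_d_deg _ _ M (n + 1)).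
split; [apply: grD | apply: grB] => /=.
- exact: cx_d_deg.
- exact: (cm_deg t).
- exact: cx_d_deg.
- exact: (cm_deg g).
Qed.

Lemma po_dd z : d (d z) = 0.
Proof.
case: z => [[n w] q]; rewrite /d /=; congr (_, _, _).
- by rewrite cx_dD cx_dd cmN cm_comm add0r addrN.
- by rewrite cx_dB cx_dd cmN cm_comm sub0r opprK addNr.
- by rewrite cx_dN cx_dd !oppr0.
Qed.

(** The cone of (t, -g) : M -> W + N, that is, the homotopy pushout: the coordinate in M carries a
    homotopy between the images of [t] and [g]. *)
Definition pushout : complex L := Complex po_lin po_deg po_dd.

Lemma po_inl_lin : linear (fun w : W => ((w, 0, 0) : pushout)).
Proof. exact: (pair_linear (pair_linear (fun _ _ _ => erefl) (@zero_linear _ _)) (@zero_linear _ _)). Qed.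
Lemma po_inl_deg n (w : W) : gr W n w -> gr pushout n (w, 0, 0).
Proof. by move=> h; split; [split=> //|]; apply: gr0. Qed.
Lemma po_inl_comm (w : W) : (cx_d W w, 0, 0) = cx_d pushout (w, 0, 0).
Proof. by congr (_, _, _); rewrite /= ?(cm0, cx_d0, oppr0, addr0). Qed.
Definition po_inl : chain_map W pushout :=
  ChainMap po_inl_lin po_inl_deg po_inl_comm.

Lemma po_inr_lin : linear (fun n : N => ((0, n, 0) : pushout)).
Proof. exact: (pair_linear (pair_linear (@zero_linear _ _) (fun _ _ _ => erefl)) (@zero_linear _ _)). Qed.
Lemma po_inr_deg k (n : N) : gr N k n -> gr pushout k (0, n, 0).
Proof. by move=> h; split; [split=> //|]; apply: gr0. Qed.
Lemma po_inr_comm (n : N) : (0, cx_d N n, 0) = cx_d pushout (0, n, 0).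
Proof. by congr (_, _, _); rewrite /= ?(cm0, cx_d0, oppr0, addr0). Qed.
Definition po_inr : chain_map N pushout :=
  ChainMap po_inr_lin po_inr_deg po_inr_comm.

Lemma po_homotopic :
  homotopic (fun x => po_inl (t x)) (fun x => po_inr (g x)).
Proof.
exists (fun x => ((0, 0, x) : pushout)); split.
- exact: (pair_linear (@zero_linear _ _) (fun _ _ _ => erefl)).
- by move=> n x hx; split; [split; apply: gr0 | rewrite /= subrK].
- move=> x; congr (_, _, _) => /=; rewrite ?cx_d0 ?add0r ?sub0r ?subr0 ?addr0 //.
  by rewrite addNr oppr0.
Qed.

Lemma po_inr_qis : cm_qis t -> cm_qis po_inr.
Proof.
move=> [ti ts]; split.
  move=> n en [[[w n'] x] /= [e1 e2 /esym/eqP]]; rewrite oppr_eq0 => /eqP e3.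
  have [|x' ex] := ti x e3.
    by exists (- w); rewrite cx_dN; apply/eqP; rewrite -addr_eq0 addrC -e1.
  by exists (n' - g x'); rewrite cx_dB -cm_comm -ex.
move=> [[w n] x] /= [e1 e2 /eqP]; rewrite oppr_eq0 => /eqP e3.
have [|x' ex] := ti x e3.
  by exists (- w); rewrite cx_dN; apply/eqP; rewrite -addr_eq0 addrC e1.
have [|x2 [w2 [ex2 ew2]]] := ts (w + t x'); first by rewrite cx_dD -cm_comm -ex.
exists (n - g x' + g x2), (w2, 0, x2 - x'); split.
  by rewrite cx_dD cx_dB -!cm_comm ex2 cm0 addr0 -ex.
congr (_, _, _) => /=.
- by rewrite cmB add0r addrA [_ + t x2]addrC -ew2 addrK.
- by rewrite cx_d0 sub0r cmB opprB addrA -[_ + g x2 + _]addrA [g x2 + _]addrC addrA subrK addrK.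
- by rewrite add0r cx_dB ex2 sub0r opprK.
Qed.
End Pushout.

(** The squares commute only up to homotopy, which is enough because homotopic maps become equal in
    the localization. *)
Lemma ore_right N W Q (s : chain_map N Q) (g : chain_map W Q) : cm_qis s ->
  exists V (a : chain_map V W) (b : chain_map V N),
    cm_qis a /\ homotopic (fun z => s (b z)) (fun z => g (a z)).
Proof.
move=> hs; exists (pullback s g), (pb_snd s g), (pb_fst s g).
by split; [apply: pb_snd_qis | apply: pb_homotopic].
Qed.

Lemma ore_left M W N (t : chain_map M W) (g : chain_map M N) : cm_qis t ->
  exists V (s : chain_map N V) (b : chain_map W V),
    cm_qis s /\ homotopic (fun z => b (t z)) (fun z => s (g z)).
Proof.
move=> ht; exists (pushout t g), (po_inr t g), (po_inl t g).
by split; [apply: po_inr_qis | apply: po_homotopic].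
Qed.

Definition zero_complex : complex L := stalk ('rV[L^c]_0 : lmodType L^c).

Lemma zero_complexE (x : zero_complex) : x = 0.
Proof. by apply/matrixP => i [] []. Qed.

Lemma cm_zero_comm M N (x : M) : 0 = cx_d N 0.
Proof. by rewrite cx_d0. Qed.
Definition cm_zero M N : chain_map M N :=
  @ChainMap _ _ M N (fun=> 0) (@zero_linear M N) (fun n _ _ => gr0 N n)
   (@cm_zero_comm M N).

Lemma acyclic_qis0 M : acyclic M <-> cm_qis (cm_zero M zero_complex).
Proof.
split=> [h|[h _] x hx]; last by apply: h => //; exists 0; rewrite cx_d0.
split=> [x hx _|y _]; first exact: h.
exists 0, 0; split; first by rewrite cx_d0.
by rewrite [LHS]zero_complexE [RHS]zero_complexE.
Qed.

(* A homotopy from s g to 0 lifts g to the homotopy fibre of s, which is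
   acyclic. *)
Lemma qis_cancel_right N Q V (s : chain_map N Q) (g : chain_map V N) :
  cm_qis s -> null_homotopic (fun x => s (g x)) ->
  exists U (a : chain_map U V), cm_qis a /\ null_homotopic (fun x => g (a x)).
Proof.
move=> hs [h [h1 h2 h3]].
pose E := pullback s (cm_zero zero_complex Q).
have hE : acyclic E.
  apply/acyclic_qis0; apply: qis_homotopic (pb_snd_qis _ hs).
  by apply: homotopic_eq => x; rewrite [LHS]zero_complexE [RHS]zero_complexE.
pose k (v : V) : E := ((g v, 0), h v).
have k1 : linear k.
  exact: (pair_linear (pair_linear (cm_lin g) (@zero_linear _ _)) h1).
have k2 n v : gr V n v -> gr E n (k v).
  move=> hv; split; last exact: h2.
  by split; [apply: (cm_deg g) | apply: gr0].
have k3 v : k (cx_d V v) = cx_d E (k v).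
  congr (_, _, _) => /=; first exact: cm_comm.
  by rewrite subr0 h3 [X in _ = X - _]addrC addrK.
have hq : cm_qis (cm_zero zero_complex E).
  apply: (@qis_right _ _ _ _ _ (cm_zero E zero_complex)).
    exact/acyclic_qis0.
  apply: qis_homotopic (qis_id _); apply: homotopic_eq => x.
  by rewrite [LHS]zero_complexE [RHS]zero_complexE.
(* Completing the square of k : V -> E and the quasi-isomorphism 0 -> E makes [k a] null-homotopic,
   and [g a] is its first component. *)
have [U [a [b [ha hab]]]] := ore_right (ChainMap k1 k2 k3) hq.
exists U, a; split=> //.
have := null_homotopic_comp (pb_fst _ _) (cm_id U) (null_homotopicN hab).
by apply: null_homotopic_eq => x /=; rewrite sub0r opprK.
Qed.

Section Rotation.
Variables (M N : complex L) (f : chain_map M N).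

(** The comparison map of the rotation axiom, from S M to the cone of N -> cone f. The coordinate -
    f x makes it a chain map and is the source of the sign in [triangle_rotate]. *)
Definition cone_rot_fun (x : M) : cx_cone (cx_cone_in f) := ((0, x), - f x).

Lemma cone_rot_lin : linear (cone_rot_fun : cx_shift 1 M -> _).
Proof.
move=> a x y; congr (_, _, _) => /=; first by rewrite scaler0 addr0.
by rewrite (cm_lin f) opprD -scalerN.
Qed.
Lemma cone_rot_deg n (x : cx_shift 1 M) :
  gr (cx_shift 1 M) n x -> gr (cx_cone (cx_cone_in f)) n (cone_rot_fun x).
Proof.
move=> hx; split; first by split=> //; apply: gr0.
by apply: grN; apply: (cm_deg f).
Qed.
Lemma cone_rot_comm (x : cx_shift 1 M) :
  cone_rot_fun (cx_d (cx_shift 1 M) x) = cx_d (cx_cone (cx_cone_in f)) (cone_rot_fun x).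
Proof.
rewrite /= expr1z kscaleN1; congr (_, _, _) => /=.
- by rewrite cx_d0 add0r addrN.
- by rewrite addr0.
- by rewrite cmN cm_comm cx_dN.
Qed.
Definition cone_rot : chain_map (cx_shift 1 M) (cx_cone (cx_cone_in f)) :=
  ChainMap cone_rot_lin cone_rot_deg cone_rot_comm.

Lemma cone_rot_homotopic : homotopic (fun z => cone_rot (cx_cone_out f z))
  (cx_cone_in (cx_cone_in f)).
Proof.
exists (fun z : cx_cone f => ((0, - z.1) : cx_cone (cx_cone_in f))); split.
- move=> a [y x] [y' x']; congr (_, _) => /=; first by rewrite scaler0 addr0.
  by rewrite opprD -scalerN.
- by move=> n z [h _]; split; [apply: gr0 | rewrite /= subrK; apply: grN].
- move=> [y x]; congr (_, _, _) => /=.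
  + by rewrite cx_d0 cm0 !add0r addr0.
  + by rewrite cx_d0 oppr0 !addr0 subrr.
  + by rewrite subr0 cx_dN opprK opprD addrA subrr sub0r.
Qed.

Lemma cone_rot_qis : cm_qis cone_rot.
Proof.
split.
  move=> x _ [[[y x'] n] [e1 e2 e3]]; exists x'.
  by rewrite /= expr1z kscaleN1 [LHS]e2 /= addr0.
move=> [[y x] n] /= [e1 e2 e3]; exists x, (0, y); split.
  by rewrite /= expr1z kscaleN1 -[LHS]addr0 -[X in X = _]/(- cx_d M x + 0).
congr (_, _, _) => /=.
- by rewrite cx_d0 cm0 !add0r.
- by rewrite cx_d0 oppr0 !addr0.
- by apply/eqP; rewrite -opprD -addr_eq0 addrC [f x + _]addrC e1.
Qed.
End Rotation.

End Cones.

(** * Localizations *)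

Section DerivedGeneral.
Variables (K : fieldType) (C : dg_model K) (D : derived C).
Implicit Types X Y Z W : obj C.

Lemma comp0l X Y Z (f : dhom D X Y) : dcomp (0 : dhom D Y Z) f = 0.
Proof.
have := dcomp_linl f (-1) (0 : dhom D Y Z) 0.
by rewrite !scaleN1r !addNr.
Qed.

Lemma comp0r X Y Z (g : dhom D Y Z) : dcomp g (0 : dhom D X Y) = 0.
Proof.
have := dcomp_linr g (-1) (0 : dhom D X Y) 0.
by rewrite !scaleN1r !addNr.
Qed.

Lemma compDl X Y Z (f : dhom D X Y) (g g' : dhom D Y Z) :
  dcomp (g + g') f = dcomp g f + dcomp g' f.
Proof. by rewrite -{1}[g]scale1r dcomp_linl scale1r. Qed.

Lemma compDr X Y Z (g : dhom D Y Z) (f f' : dhom D X Y) :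
  dcomp g (f + f') = dcomp g f + dcomp g f'.
Proof. by rewrite -{1}[f]scale1r dcomp_linr scale1r. Qed.

Lemma compZl X Y Z c (f : dhom D X Y) (g : dhom D Y Z) :
  dcomp (c *: g) f = c *: dcomp g f.
Proof. by rewrite -[c *: g]addr0 dcomp_linl comp0l addr0. Qed.

Lemma compZr X Y Z c (g : dhom D Y Z) (f : dhom D X Y) :
  dcomp g (c *: f) = c *: dcomp g f.
Proof. by rewrite -[c *: f]addr0 dcomp_linr comp0r addr0. Qed.

Lemma compNl X Y Z (f : dhom D X Y) (g : dhom D Y Z) :
  dcomp (- g) f = - dcomp g f.
Proof. by rewrite -scaleN1r compZl scaleN1r. Qed.

Lemma compNr X Y Z (g : dhom D Y Z) (f : dhom D X Y) :
  dcomp g (- f) = - dcomp g f.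
Proof. by rewrite -scaleN1r compZr scaleN1r. Qed.

Lemma compBl X Y Z (f : dhom D X Y) (g g' : dhom D Y Z) :
  dcomp (g - g') f = dcomp g f - dcomp g' f.
Proof. by rewrite compDl compNl. Qed.

Lemma compBr X Y Z (g : dhom D Y Z) (f f' : dhom D X Y) :
  dcomp g (f - f') = dcomp g f - dcomp g f'.
Proof. by rewrite compDr compNr. Qed.

Lemma comp_suml X Y Z (I : Type) (s : seq I) (f : dhom D X Y)
  (g : I -> dhom D Y Z) : dcomp (\sum_(i <- s) g i) f = \sum_(i <- s) dcomp (g i) f.
Proof. by apply: (big_morph (fun g => dcomp g f)) => [x y|]; rewrite (compDl, comp0l). Qed.

Lemma comp_sumr X Y Z (I : Type) (s : seq I) (g : dhom D Y Z)
  (f : I -> dhom D X Y) : dcomp g (\sum_(i <- s) f i) = \sum_(i <- s) dcomp g (f i).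
Proof. by apply: (big_morph (fun f => dcomp g f)) => [x y|]; rewrite (compDr, comp0r). Qed.

Definition inverse_of X Y (f : dhom D X Y) (g : dhom D Y X) :=
  dcomp g f = did D X /\ dcomp f g = did D Y.

Lemma diso_id X : diso (did D X).
Proof. by exists (did D X); rewrite dcomp_idl. Qed.

Lemma diso_comp X Y Z (g : dhom D Y Z) (f : dhom D X Y) :
  diso g -> diso f -> diso (dcomp g f).
Proof.
move=> [g' [h1 h2]] [f' [h3 h4]]; exists (dcomp f' g'); split.
- by rewrite -dcompA [dcomp g' _]dcompA h1 dcomp_idl.
- by rewrite -dcompA [dcomp f _]dcompA h4 dcomp_idl.
Qed.

Lemma diso_shift m X Y (f : dhom D X Y) : diso f -> diso (dshift m f).
Proof.
move=> [g [h1 h2]]; exists (dshift m g).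
by split; rewrite -dshift_comp ?h1 ?h2 dshift_id.
Qed.

Lemma isomorphic_refl X : isomorphic D X X.
Proof. by exists (did D X); apply: diso_id. Qed.

Lemma isomorphic_sym X Y : isomorphic D X Y -> isomorphic D Y X.
Proof. by move=> [f [g h]]; exists g, f; case: h. Qed.

Lemma isomorphic_trans X Y Z :
  isomorphic D X Y -> isomorphic D Y Z -> isomorphic D X Z.
Proof. by move=> [f hf] [g hg]; exists (dcomp g f); apply: diso_comp. Qed.

Lemma isomorphic_shift m X Y :
  isomorphic D X Y -> isomorphic D (shift m X) (shift m Y).
Proof. by move=> [f hf]; exists (dshift m f); apply: diso_shift. Qed.

Lemma loc_qis_iso X Y (f : Defs.hom X Y) : qis f -> diso (loc D f).
Proof. exact: loc_qis. Qed.

Section Generation.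
Variable R : forall X Y, dhom D X Y -> Prop.
Hypothesis R_loc : forall X Y (f : Defs.hom X Y), R (loc D f).
Hypothesis R_comp : forall X Y Z (g : dhom D Y Z) (f : dhom D X Y),
  R g -> R f -> R (dcomp g f).
Hypothesis R_inv : forall X Y (f : Defs.hom X Y) (g : dhom D Y X), qis f ->
  inverse_of (loc D f) g -> R g.

Let Rhom X Y := {f : dhom D X Y | R f}.
Let Rid X : Rhom X X := exist _ (did D X) (eq_ind _ (@R X X) (R_loc (idm X)) _ (loc_id D X)).
Let Rcmp X Y Z (g : Rhom Y Z) (f : Rhom X Y) : Rhom X Z :=
  exist _ (dcomp (sval g) (sval f)) (R_comp (proj2_sig g) (proj2_sig f)).

Let Rcat : category.
Proof.
apply: (@Category (obj C) Rhom Rid Rcmp).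
- by move=> X Y [f hf]; apply: eq_exist; apply: dcomp_idl.
- by move=> X Y [f hf]; apply: eq_exist; apply: dcomp_idr.
- by move=> W X Y Z [h hh] [g hg] [f hf]; apply: eq_exist; apply: dcompA.
Defined.

Let Dcat : category :=
  @Category (obj C) (dhom D) (did D) (@dcomp _ _ D) (@dcomp_idl _ _ D)
    (@dcomp_idr _ _ D) (@dcompA _ _ D).

Let Floc : functor C Dcat :=
  @Functor C Dcat id (@loc _ _ D) (@loc_id _ _ D) (@loc_comp _ _ D).

Let FR : functor C Rcat.
Proof.
apply: (@Functor C Rcat id (fun X Y f => exist _ (loc D f) (R_loc f))).
- by move=> X; apply: eq_exist; apply: loc_id.
- by move=> X Y Z g f; apply: eq_exist; apply: loc_comp.
Defined.

(** The morphisms satisfying [R] form a category through which the localization functor factors.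
    Followed by the inclusion, the factorization solves the same universal problem as the identity,
    so the two agree and every morphism satisfies [R]. *)
Lemma derived_ind X Y (f : dhom D X Y) : R f.
Proof.
have FR_inv A B (h : Defs.hom A B) : qis h -> invertible (fhom FR h).
  move=> qh; have [g hg] := loc_qis D qh.
  exists (exist _ g (R_inv qh hg)).
  by split; apply: eq_exist; [case: hg | case: hg].
have [G [[G1 G2 G3] _]] := @loc_univ _ _ D Rcat FR FR_inv.
have [G' [_ U]] := @loc_univ _ _ D Dcat Floc (fun X Y f hf => loc_qis D hf).
have e1 := U (fun X Y f => f) (And3 (fun _ => erefl) (fun _ _ _ _ _ => erefl)
  (fun _ _ _ => erefl)).
have e2 := U (fun X Y f => sval (G X Y f)).
rewrite -[f]/((fun X Y (f : dhom D X Y) => f) X Y f) -e1 e2.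
  exact: (proj2_sig (G X Y f)).
split=> [A|A B E g h|A B h]; by rewrite ?G1 ?G2 ?G3.
Qed.
End Generation.

(** A [dg_model] has linear combinations but no distinguished zero morphism; (-1) f + f takes its
    place. *)
Lemma loc_zero X Y (f : Defs.hom X Y) : loc D (lincomb (-1) f f) = 0.
Proof. by rewrite loc_lin scaleN1r addNr. Qed.

End DerivedGeneral.

(** * Calculus of fractions for complexes *)

Section DerivedComplexes.
Variables (K : fieldType) (L : falgType K) (D : derived (complexes L)).
Implicit Types M N P Q T U V W : complex L.
Implicit Types X Y Z : obj (complexes L).
Local Notation loc f := (@loc K (complexes L) D _ _ f).

Lemma loc_cm_zero M N : loc (cm_zero M N) = 0.
Proof.
rewrite -(loc_zero D (cm_zero M N : Defs.hom (M : obj (complexes L)) N)).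
by congr Defs.loc; apply: chain_map_eq => x; rewrite /= kscaleN1 addNr.
Qed.

(** The zero endomorphism of an acyclic complex is a quasi-isomorphism, so 0 becomes invertible. *)
Lemma acyclic_zero_object M : acyclic M -> zero_object D M.
Proof.
move=> hM; have hz : cm_qis (cm_zero M M).
  split=> [x hx _|y /hM[x ->]]; first exact: hM.
  by exists 0, x; rewrite cx_d0 add0r.
have [g [h _]] := loc_qis D (hz : qis (cm_zero M M : Defs.hom (M : obj (complexes L)) M)).
by rewrite /zero_object -h loc_cm_zero comp0r.
Qed.

(** Such an [f] factors through the cone of the identity of M, which is acyclic and hence a zero
    object. *)
Lemma null_homotopic_loc M N (f : chain_map M N) :
  null_homotopic f -> loc f = 0.
Proof.
move=> hf; have [k <-] := @cone_extend _ _ _ _ _ (cm_id M) f hf.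
have hz : zero_object D (cx_cone (cm_id M)).
  by apply: acyclic_zero_object; apply: qis_acyclic_cone; apply: qis_id.
rewrite (loc_comp D (k : Defs.hom (_ : obj (complexes L)) _)).
by rewrite -[Defs.loc D (cx_cone_in _)]dcomp_idl hz comp0l comp0r.
Qed.

Lemma homotopic_loc M N (f g : chain_map M N) :
  homotopic f g -> loc f = loc g.
Proof.
move=> h; have h0 : null_homotopic (cm_lincomb (-1) g f).
  by apply: null_homotopic_eq h => x; rewrite /= kscaleN1 addrC.
have := null_homotopic_loc h0.
rewrite (loc_lin D (-1) (g : Defs.hom (_ : obj (complexes L)) _)) scaleN1r.
by move/eqP; rewrite addrC subr_eq0 => /eqP.
Qed.

Lemma loc_cm_comp M N P (g : chain_map N P) (f : chain_map M N) :
  loc (cm_comp g f) = dcomp (loc g) (loc f).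
Proof. exact: (loc_comp D (g : Defs.hom (_ : obj (complexes L)) _)). Qed.

Lemma loc_homotopic_comp M N P Q (g : chain_map N P) (f : chain_map M N)
    (g' : chain_map Q P) (f' : chain_map M Q) :
  homotopic (fun x => g (f x)) (fun x => g' (f' x)) ->
  dcomp (loc g) (loc f) = dcomp (loc g') (loc f').
Proof.
move=> h; rewrite -!loc_cm_comp.
exact: (@homotopic_loc _ _ (cm_comp g f) (cm_comp g' f') h).
Qed.

Lemma loc_cm_qis M N (f : chain_map M N) : cm_qis f ->
  exists g : dhom D N M, inverse_of (loc f) g.
Proof. by move=> h; apply: (loc_qis D (h : qis (f : Defs.hom (_ : obj (complexes L)) _))). Qed.

(** The case with content is the composite, where an Ore square rewrites t^-1 f1 as b a^-1. *)
Lemma right_fraction X Y (f : dhom D X Y) :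
  exists W (t : chain_map W X) (t' : dhom D X W) (g : chain_map W Y),
    [/\ cm_qis t, inverse_of (loc t) t' & f = dcomp (loc g) t'].
Proof.
move: X Y f; apply: derived_ind.
- move=> X Y f; exists X, (cm_id X), (did D X), f; split.
  + exact: qis_id.
  + by split; rewrite (loc_id D (X : obj (complexes L))) dcomp_idl.
  + by rewrite dcomp_idr.
- move=> X Y Z g f [W [t [t' [g1 [ht it ->]]]]] [V [s [s' [f1 [hs is' ->]]]]].
  have [U [a [b [ha hab]]]] := ore_right f1 ht.
  have [a' ia] := loc_cm_qis ha.
  exists U, (cm_comp s a), (dcomp a' s'), (cm_comp g1 b); split.
  + exact: qis_comp.
  + rewrite loc_cm_comp; split.
    * by rewrite -dcompA [dcomp s' _]dcompA is'.1 dcomp_idl ia.1.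
    * by rewrite -dcompA [dcomp _ (dcomp a' _)]dcompA ia.2 dcomp_idl is'.2.
  + rewrite loc_cm_comp -!dcompA; congr dcomp; rewrite !dcompA; congr dcomp.
    have := loc_homotopic_comp hab => e.
    rewrite -[dcomp t' _]dcomp_idr -ia.2 [dcomp _ (dcomp _ a')]dcompA.
    by rewrite -[dcomp (dcomp t' _) _]dcompA -e dcompA it.1 dcomp_idl.
- move=> X Y f g hf hg; exists X, f, g, (cm_id X); split=> //.
  by rewrite (loc_id D (X : obj (complexes L))) dcomp_idl.
Qed.

Lemma left_fraction X Y (f : dhom D X Y) :
  exists W (s : chain_map Y W) (s' : dhom D W Y) (g : chain_map X W),
    [/\ cm_qis s, inverse_of (loc s) s' & f = dcomp s' (loc g)].
Proof.
have [V [t [t' [g [ht it ->]]]]] := right_fraction f.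
have [W [s [b [hs h]]]] := ore_left g ht.
have [s' is'] := loc_cm_qis hs; exists W, s, s', b; split=> //.
have e := loc_homotopic_comp h.
rewrite -[Defs.loc D b]dcomp_idr -it.2 [dcomp (loc b) _]dcompA e.
by rewrite !dcompA is'.1 dcomp_idl.
Qed.

(* N |-> test_set N is a contravariant functor to sets which inverts
   quasi-isomorphisms.  Hence it factors through the localization, which shows
   that loc f = 0 only if f becomes null-homotopic after composition with a
   quasi-isomorphism. *)
Record test_set N := TestSet {
  test :> forall W, chain_map W N -> Prop;
  test_homotopic : forall W (f g : chain_map W N), homotopic f g -> test f -> test g;
  test_qis : forall V W (a : chain_map V W) (f : chain_map W N), cm_qis a ->
    test (cm_comp f a) <-> test f }.

Lemma test_set_eq N (R S : test_set N) :
  (forall W (f : chain_map W N), R W f <-> S W f) -> R = S.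
Proof.
case: R S => [R h1 h2] [S h3 h4] /= h.
have e : R = S by apply: functional_extensionality_dep => W; apply: funext => f; apply: propext.
by subst S; congr TestSet; apply: Prop_irrelevance.
Qed.

Lemma test_comp_homotopic N P (k : chain_map N P) (R : test_set P) W
  (f g : chain_map W N) :
  homotopic f g -> R W (cm_comp k f) -> R W (cm_comp k g).
Proof.
move=> h; apply: test_homotopic.
exact: (homotopic_comp (homotopic_refl k) h).
Qed.

Lemma test_comp_qis N P (k : chain_map N P) (R : test_set P) V W
  (a : chain_map V W) (f : chain_map W N) : cm_qis a ->
  R V (cm_comp k (cm_comp f a)) <-> R W (cm_comp k f).
Proof. by rewrite cm_compA; apply: test_qis. Qed.

Definition test_pull N P (k : chain_map N P) (R : test_set P) : test_set N :=
  @TestSet N (fun W f => R W (cm_comp k f)) (test_comp_homotopic (R := R))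
    (test_comp_qis k R).

Section TestPush.
Variables (N P : complex L) (s : chain_map N P) (hs : cm_qis s) (R : test_set N).

(** The inverse of pulling back along [s]: [f] belongs to it when the fraction s^-1 f, written as g
    a^-1, has its numerator in [R]. *)
Let S W (f : chain_map W P) := exists V (a : chain_map V W) (g : chain_map V N),
  [/\ cm_qis a, homotopic (cm_comp s g) (cm_comp f a) & R V g].

Lemma push_homotopic W (f g : chain_map W P) : homotopic f g -> S f -> S g.
Proof.
move=> h [V [a [k [ha hk hR]]]]; exists V, a, k; split=> //.
by apply: homotopic_trans hk _; apply: (homotopic_comp h (homotopic_refl a)).
Qed.

Lemma push_qis V W (b : chain_map V W) (f : chain_map W P) : cm_qis b ->
  S (cm_comp f b) <-> S f.
Proof.
move=> hb; split=> [[U [a [g [ha hg hR]]]]|[U [a [g [ha hg hR]]]]].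
  by exists U, (cm_comp b a), g; split=> //; apply: qis_comp.
have [U' [c [d [hc hcd]]]] := ore_right b ha.
have hd : cm_qis d.
  apply: (qis_right ha); apply: qis_homotopic (qis_comp hb hc).
  exact: homotopic_sym.
exists U', c, (cm_comp g d); split=> //; last exact/test_qis.
have h1 := homotopic_comp hg (homotopic_refl d).
apply: homotopic_trans h1 _.
exact: (@homotopic_comp _ _ _ _ _ f f (cm_comp a d) (cm_comp b c) (homotopic_refl f) hcd).
Qed.

Definition test_push : test_set P := TestSet push_homotopic push_qis.

Lemma test_pushK : test_pull s test_push = R.
Proof.
apply: test_set_eq => W f; split=> [[V [a [g [ha hg hR]]]]|h]; last first.
  by exists W, (cm_id W), f; split=> //; [apply: qis_id | apply: homotopic_refl].
(* Both [g] and [f a] have the same composite with [s] up to homotopy, so they become homotopic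
   after a further quasi-isomorphism [b]. *)
have [|U [b [hb hgb]]] := qis_cancel_right (g := cm_lincomb (-1) (cm_comp f a) g) hs.
  apply: null_homotopic_eq hg => x /=.
  by rewrite kscaleN1 cmD cmN addrC.
apply/(test_qis R f (qis_comp ha hb)).
apply: (test_homotopic (f := cm_comp g b)); last exact/test_qis.
by apply: null_homotopic_eq hgb => x /=; rewrite kscaleN1 addrC.
Qed.
End TestPush.

Lemma test_pullK N P (s : chain_map N P) (hs : cm_qis s) (R : test_set P) :
  test_push s (test_pull s R) = R.
Proof.
apply: test_set_eq => W f; split=> [[V [a [g [ha hg hR]]]]|h].
  by apply/(test_qis R f ha); apply: (test_homotopic hg hR).
have [V [a [g [ha hg]]]] := ore_right f hs.
exists V, a, g; split=> //=.
have /(test_qis R f ha) h' := h.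
exact: (@test_homotopic _ R _ (cm_comp f a) (cm_comp s g) (homotopic_sym hg) h').
Qed.

(** The opposite of the category of sets, so that the contravariant [test_set] is a functor in the
    sense of [loc_univ]. *)
Definition set_op : category :=
  @Category Type (fun A B => B -> A) (fun A x => x)
    (fun A B E (g : E -> B) (f : B -> A) x => f (g x))
    (fun _ _ _ => erefl) (fun _ _ _ => erefl) (fun _ _ _ _ _ _ _ => erefl).

Lemma test_pull_id N : test_pull (cm_id N) = id :> (test_set N -> test_set N).
Proof. by apply: funext => R; apply: test_set_eq => W f; rewrite /= cm_idl. Qed.

Lemma test_pull_comp M N P (g : chain_map N P) (f : chain_map M N) :
  test_pull (cm_comp g f) = fun R => test_pull f (test_pull g R).
Proof. by apply: funext => R; apply: test_set_eq => W k; rewrite /= cm_compA. Qed.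

Definition test_functor : functor (complexes L) set_op :=
  @Functor (complexes L) set_op (fun N => test_set N : Type)
    (fun M N f => test_pull f) test_pull_id test_pull_comp.

Lemma killed_homotopic N W (f g : chain_map W N) : homotopic f g ->
  (exists V (a : chain_map V W), cm_qis a /\ null_homotopic (cm_comp f a)) ->
  exists V (a : chain_map V W), cm_qis a /\ null_homotopic (cm_comp g a).
Proof.
move=> h [V [a [ha hf]]]; exists V, a; split=> //; apply: (proj2 (null_homotopicB _)).
apply: homotopic_trans (proj1 (null_homotopicB _) hf).
exact: (homotopic_comp (homotopic_sym h) (homotopic_refl a)).
Qed.

Lemma killed_qis N V W (b : chain_map V W) (f : chain_map W N) : cm_qis b ->
  (exists U (a : chain_map U V), cm_qis a /\ null_homotopic (cm_comp (cm_comp f b) a))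
  <-> exists U (a : chain_map U W), cm_qis a /\ null_homotopic (cm_comp f a).
Proof.
move=> hb; split=> [[U [a [ha hf]]]|[U [a [ha hf]]]].
  by exists U, (cm_comp b a); split=> //; apply: qis_comp.
have [U' [c [d [hc hcd]]]] := ore_right b ha.
exists U', c; split=> //; apply: (proj2 (null_homotopicB _)).
apply: (@homotopic_trans _ _ _ _ _ (cm_comp (cm_comp f a) d)).
  exact: (@homotopic_comp _ _ _ _ _ f f (cm_comp b c) (cm_comp a d) (homotopic_refl f) (homotopic_sym hcd)).
exact: (proj1 (null_homotopicB _) (null_homotopic_comp (cm_id N) d hf)).
Qed.

Definition killed N : test_set N := TestSet (@killed_homotopic N) (@killed_qis N).

Lemma loc0_killed M N (f : chain_map M N) : loc f = 0 ->
  exists V (a : chain_map V M), cm_qis a /\ null_homotopic (fun x => f (a x)).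
Proof.
move=> hf; have [|G [[_ _ hG] _]] := @loc_univ _ _ D set_op test_functor.
  move=> A B s hs; exists (test_push s).
  split; apply: funext => R /=; first exact: (@test_pushK _ _ s hs).
  exact: (@test_pullK _ _ s hs).
have e : test_pull f = test_pull (cm_zero M N).
  by rewrite -[LHS](hG M N f) -[RHS](hG M N (cm_zero M N)) hf loc_cm_zero.
(* The identity of M lies in the pullback of [killed] along the zero map, hence in the pullback
   along [f]; membership there is the claim. *)
have : test_pull f (killed N) M (cm_id M).
  rewrite e; exists M, (cm_id M); split; first exact: qis_id.
  exact: null_homotopic0.
move=> [V [a [ha h]]]; exists V, a; split=> //.
Qed.

End DerivedComplexes.

(** * Triangles *)

Section LinEquiv.
Variable K : fieldType.
Implicit Types U V W : lmodType K.

Definition lin_equiv V W := exists f : V -> W, linear f /\ bijective f.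

Lemma lin_equiv_sym V W : lin_equiv V W -> lin_equiv W V.
Proof.
move=> [f [lf [g gf fg]]]; exists g; split; last by exists f.
by move=> a x y; apply: (can_inj gf); rewrite lf !fg.
Qed.

Lemma lin_equiv_trans U V W : lin_equiv U V -> lin_equiv V W -> lin_equiv U W.
Proof.
move=> [f [lf bf]] [g [lg bg]]; exists (g \o f); split; last exact: bij_comp.
by move=> a x y /=; rewrite lf lg.
Qed.

Lemma is_trivial_equiv V W : lin_equiv V W -> is_trivial V -> is_trivial W.
Proof.
move=> [f [lf [g gf fg]]] h w; rewrite -[w]fg (h (g w)).
exact: lin0 lf.
Qed.

Lemma is_line_equiv V W : lin_equiv V W -> is_line V -> is_line W.
Proof.
move=> [f [lf [g gf fg]]] [v v0 h]; exists (f v).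
  by apply: contra_neq v0 => e; rewrite -[v]gf e -(lin0 lf) gf.
by move=> w; have [c e] := h (g w); exists c; rewrite -[w]fg e (linZ _ _ lf).
Qed.
End LinEquiv.

Section ConeMap.
Variables (K : fieldType) (L : falgType K) (M M' N : complex L).
Variables (f : chain_map M N) (a : chain_map M' M).

Let e (z : cx_cone (cm_comp f a)) : cx_cone f := (z.1, a z.2).

Lemma cone_map_lin : linear e.
Proof. by move=> c [y x] [y' x']; congr pair; rewrite /= (cm_lin a). Qed.
Lemma cone_map_deg n z : gr (cx_cone (cm_comp f a)) n z -> gr (cx_cone f) n (e z).
Proof. by move=> [h1 h2]; split=> //; apply: (cm_deg a). Qed.
Lemma cone_map_comm z : e (cx_d (cx_cone (cm_comp f a)) z) = cx_d (cx_cone f) (e z).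
Proof. by congr pair; rewrite /= cmN cm_comm. Qed.
Definition cone_map : chain_map (cx_cone (cm_comp f a)) (cx_cone f) :=
  ChainMap cone_map_lin cone_map_deg cone_map_comm.

Lemma cone_map_qis : cm_qis a -> cm_qis cone_map.
Proof.
move=> [ai as_]; split.
  move=> [y x] [/= e1 /eqP]; rewrite oppr_eq0 => /eqP e2 [[y' x'] [/= e3 e4]].
  have [|x2 ex2] := ai x e2; first by exists (- x'); rewrite cx_dN.
  have [|x3 [z [ex3 ez]]] := as_ (a x2 + x').
    by rewrite cx_dD -cm_comm -ex2 e4 addNr.
  exists (y' + f z, x3 - x2); congr pair => /=; last first.
    by rewrite cx_dB ex3 sub0r opprK.
  move/(canRL (addKr _)): ez => ez; rewrite e3 ez cx_dD -cm_comm cmB.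
  rewrite -addrA -cmD; congr (_ + f _).
  by rewrite [LHS]addrC -addrA addrCA addrA.
move=> [y x] [/= e1 /eqP]; rewrite oppr_eq0 => /eqP e2.
have [x1 [z [ex1 ez]]] := as_ x e2.
exists (y + f z, x1), (0, - z); split; congr pair => /=.
- by rewrite cx_dD -cm_comm -addrA -cmD [_ + a x1]addrC -ez.
- by rewrite ex1 oppr0.
- by rewrite cx_d0 add0r cmN addrK.
- by rewrite cx_dN opprK.
Qed.
End ConeMap.

Section Triangles.
Variables (K : fieldType) (L : falgType K) (D : derived (complexes L)).
Implicit Types X Y Z W : obj (complexes L).
Local Notation loc f := (@loc K (complexes L) D _ _ f).

Lemma diso_monic X Y W (f : dhom D X Y) (g h : dhom D W X) : diso f ->
  dcomp f g = dcomp f h -> g = h.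
Proof.
by move=> [f' [e _]] eq; rewrite -[g]dcomp_idl -e -dcompA eq dcompA e dcomp_idl.
Qed.

Lemma diso_epic X Y W (f : dhom D X Y) (g h : dhom D Y W) : diso f ->
  dcomp g f = dcomp h f -> g = h.
Proof.
by move=> [f' [_ e]] eq; rewrite -[g]dcomp_idr -e dcompA eq -dcompA e dcomp_idr.
Qed.

Lemma right_fraction2 X Y (f g : dhom D X Y) :
  exists W (t : chain_map W X) (t' : dhom D X W) (f1 g1 : chain_map W Y),
    [/\ cm_qis t, inverse_of (loc t) t', f = dcomp (loc f1) t'
      & g = dcomp (loc g1) t'].
Proof.
have [W1 [t1 [t1' [f1 [h1 i1 ->]]]]] := right_fraction f.
have [W2 [t2 [t2' [g1 [h2 i2 ->]]]]] := right_fraction g.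
have [V [a [b [ha hab]]]] := ore_right t2 h1.
have hq := qis_comp h2 ha; have [t' it] := loc_cm_qis D hq.
have e := loc_homotopic_comp D hab.
exists V, (cm_comp t2 a), t', (cm_comp f1 b), (cm_comp g1 a); split=> //.
  rewrite loc_cm_comp -dcompA; congr dcomp.
  rewrite -[t1']dcomp_idr -it.2 loc_cm_comp -e [dcomp t1' _]dcompA.
  by rewrite [dcomp t1' _]dcompA i1.1 dcomp_idl.
rewrite loc_cm_comp -dcompA; congr dcomp.
rewrite -[t2']dcomp_idr -it.2 loc_cm_comp [dcomp t2' _]dcompA.
by rewrite [dcomp t2' _]dcompA i2.1 dcomp_idl.
Qed.

(** Linearity of the shift is not an axiom of [derived]. Two morphisms with a common denominator
    reduce it to chain maps, where shifting visibly preserves [lincomb]. *)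
Lemma dshift_lin m X Y : linear (fun f : dhom D X Y => dshift m f).
Proof.
move=> c f g; have [W [t [t' [f1 [g1 [_ _ -> ->]]]]]] := right_fraction2 f g.
rewrite -dcomp_linl !dshift_comp -dcomp_linl; congr dcomp.
rewrite -[c *: _ + _](loc_lin D c (f1 : Defs.hom (_ : obj (complexes L)) _)).
rewrite !dshift_loc -loc_lin; congr Defs.loc.
exact: chain_map_eq.
Qed.

Lemma dshift0 m X Y : dshift m (0 : dhom D X Y) = 0.
Proof. exact: lin0 (@dshift_lin m X Y). Qed.

Section Cancel.
Variables (m n : int) (e : m + n = 0).

Lemma unshift_deg (M : complex L) k (x : cx_shift n (cx_shift m M)) :
  gr (cx_shift n (cx_shift m M)) k x -> gr M k x.
Proof. by rewrite /= -addrA [n + m]addrC e addr0. Qed.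

Lemma unshift_comm (M : complex L) (x : cx_shift n (cx_shift m M)) :
  cx_d (cx_shift n (cx_shift m M)) x = cx_d M x.
Proof.
rewrite /= kscaleA -expfzDr ?oppr_eq0 ?oner_eq0 // addrC e expr0z.
exact: kscale1.
Qed.

Definition unshift (M : complex L) : chain_map (cx_shift n (cx_shift m M)) M :=
  @ChainMap _ _ (cx_shift n (cx_shift m M)) M id (fun _ _ _ => erefl)
    (@unshift_deg M) (@unshift_comm M).

Lemma unshift_qis M : cm_qis (unshift M).
Proof.
split=> [x hx [y ey]|y hy].
  by exists y; rewrite unshift_comm.
by exists y, 0; rewrite unshift_comm cx_d0 addr0.
Qed.

Lemma unshift_iso M : diso (loc (unshift M)).
Proof. exact: (loc_cm_qis D (unshift_qis M)). Qed.

Lemma unshift_natural X Y (f : dhom D X Y) :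
  dcomp (loc (unshift Y)) (dshift n (dshift m f)) = dcomp f (loc (unshift X)).
Proof.
move: X Y f; apply: derived_ind => [X Y f|X Y Z g f hg hf|X Y f g hf [g1 g2]].
- rewrite !dshift_loc -!loc_cm_comp; congr Defs.loc; exact: chain_map_eq.
- by rewrite !dshift_comp [LHS]dcompA hg -[LHS]dcompA hf dcompA.
have h : dcomp (loc (unshift Y)) (dshift n (dshift m (Defs.loc D f))) =
         dcomp (Defs.loc D f) (loc (unshift X)).
  rewrite !dshift_loc -!loc_cm_comp; congr Defs.loc; exact: chain_map_eq.
have i : diso (dshift n (dshift m (Defs.loc D f))).
  by do 2!apply: diso_shift; exists g.
apply: (diso_epic i).
rewrite -dcompA -!dshift_comp g1 !dshift_id dcomp_idr.
by rewrite -dcompA h dcompA g1 dcomp_idl.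
Qed.

Lemma dshift_inj X Y : injective (fun f : dhom D X Y => dshift m f).
Proof.
move=> f g h; apply: (diso_epic (unshift_iso X)).
by rewrite -!unshift_natural h.
Qed.
End Cancel.

Lemma dshift_bij m X Y : bijective (fun f : dhom D X Y => dshift m f).
Proof.
have e : m + - m = 0 by rewrite subrr.
have e' : - m + m = 0 by rewrite addNr.
have [eX' iX] := unshift_iso e X; have [hX1 hX2] := iX.
exists (fun g => dcomp (loc (unshift e Y)) (dcomp (dshift (- m) g) eX')) => f.
  by rewrite dcompA unshift_natural -dcompA hX2 dcomp_idr.
apply: (dshift_inj e'); apply: (diso_monic (unshift_iso e Y)).
by rewrite unshift_natural -!dcompA hX1 dcomp_idr.
Qed.

Lemma lin_equiv_shift m X Y :
  lin_equiv (dhom D X Y) (dhom D (shift m X) (shift m Y)).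
Proof.
by exists (fun f => dshift m f); split; [apply: dshift_lin | apply: dshift_bij].
Qed.

Lemma shift_add_isomorphic m n X :
  isomorphic D (shift n (shift m X)) (shift (m + n) X).
Proof.
exists (Defs.loc D (shift_add m n X)); apply: loc_qis_iso.
split=> [x hx [y ey]|y hy]; first by exists y; rewrite cx_shift_add_comm.
by exists y, 0; rewrite cx_shift_add_comm cx_d0 addr0.
Qed.

Lemma shift_zero_isomorphic X : isomorphic D (shift 0 X) X.
Proof.
apply: isomorphic_sym; exists (Defs.loc D (shift_zero X)); apply: loc_qis_iso.
split=> [x hx [y ey]|y hy]; first by exists y; rewrite cx_shift_zero_comm.
by exists y, 0; rewrite cx_shift_zero_comm cx_d0 addr0.
Qed.
End Triangles.

Section IsoHom.
Variables (K : fieldType) (C : dg_model K) (D : derived C).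
Implicit Types X Y Z W : obj C.

Lemma lin_equiv_iso X Y X' Y' : isomorphic D X X' -> isomorphic D Y Y' ->
  lin_equiv (dhom D X Y) (dhom D X' Y').
Proof.
move=> [f [f' [f1 f2]]] [g [g' [g1 g2]]].
exists (fun h => dcomp g (dcomp h f')); split.
  by move=> c h k; rewrite dcomp_linl dcomp_linr.
exists (fun h => dcomp g' (dcomp h f)) => h.
  by rewrite -2!dcompA f1 dcomp_idr dcompA g1 dcomp_idl.
by rewrite -2!dcompA f2 dcomp_idr dcompA g2 dcomp_idl.
Qed.
End IsoHom.

(** * Exactness of Hom on triangles *)

Section Triangles2.
Variables (K : fieldType) (L : falgType K) (D : derived (complexes L)).
Implicit Types X Y Z W : obj (complexes L).
Local Notation loc f := (@loc K (complexes L) D _ _ f).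

Lemma lin_equiv_shift2 n m X Z :
  lin_equiv (dhom D (shift n X) (shift m Z)) (dhom D (shift (n - m) X) Z).
Proof.
apply: lin_equiv_sym; apply: lin_equiv_trans (lin_equiv_shift D m _ _) _.
apply: lin_equiv_iso (isomorphic_refl _ _).
by have := shift_add_isomorphic D (n - m) m X; rewrite subrK.
Qed.

Lemma cone_distinguished M N (f : chain_map M N) :
  distinguished (loc f) (loc (cx_cone_in f)) (loc (cx_cone_out f)).
Proof.
exists M, N, f, (did D M), (did D N), (did D (cx_cone f : obj (complexes L))).
split; first by split; apply: diso_id.
by split; rewrite ?dshift_id dcomp_idl dcomp_idr.
Qed.

Lemma triangle_complete X Y (u : dhom D X Y) :
  exists Z (v : dhom D Y Z) w, distinguished u v w.
Proof.
have [W [s [s' [g [hs is' ->]]]]] := left_fraction u.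
exists (cx_cone g), (dcomp (loc (cx_cone_in g)) (loc s)), (loc (cx_cone_out g)).
exists X, W, g, (did D X), (loc s), (did D (cx_cone g : obj (complexes L))).
split; first by split; [apply: diso_id | exists s' | apply: diso_id].
split; first by rewrite dcompA is'.2 dcomp_idl dcomp_idr.
  by rewrite dcomp_idl.
by rewrite dshift_id dcomp_idl dcomp_idr.
Qed.

Section Triangle.
Variables (X Y Z : obj (complexes L)) (u : dhom D X Y) (v : dhom D Y Z)
  (w : dhom D Z (shift 1 X)).
Hypothesis uvw : distinguished u v w.

Lemma triangle_comp0 : dcomp v u = 0.
Proof.
move: uvw => [M [N [f [a [b [c [[ia ib ic] [e1 e2 e3]]]]]]]].
apply: (diso_monic ic); rewrite comp0r dcompA e2 -dcompA e1 dcompA.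
rewrite -loc_cm_comp (null_homotopic_loc D (f := cm_comp _ f)) ?comp0l //.
exact: cone_in_null.
Qed.

Lemma triangle_rotate : distinguished v w (- dshift 1 u).
Proof.
move: uvw => [M [N [f [a [b [c [[ia ib ic] [e1 e2 e3]]]]]]]].
exists N, (cx_cone f), (cx_cone_in f), b, c, (dcomp (loc (cone_rot f)) (dshift 1 a)).
split; first split=> //.
  apply: diso_comp; last exact: diso_shift.
  exact: (loc_cm_qis D (cone_rot_qis f)).
split=> //.
  rewrite -dcompA e3 dcompA; congr dcomp.
  rewrite -loc_cm_comp; apply: homotopic_loc; exact: cone_rot_homotopic.
rewrite compNr -dshift_comp e1 dshift_comp dcompA -compNl; congr dcomp.
rewrite -[Defs.loc D (cone_out _)]/(loc (cx_cone_out _)) -loc_cm_comp.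
rewrite dshift_loc -sub0r -[0 - _]addrC -scaleN1r -[0](loc_cm_zero D (cx_shift 1 M) (cx_shift 1 N)).
rewrite -[RHS]addr0 -[_ + _](loc_lin D (-1) (cm_shift 1 f : Defs.hom (_ : obj (complexes L)) _)) addr0.
by congr Defs.loc; apply: chain_map_eq => x; rewrite /= kscaleN1 addr0.
Qed.

(** After a right fraction, the vanishing becomes a null-homotopy into the cone once a further
    quasi-isomorphism is composed on the source; [cone_lift] then factors the map through X. *)
Lemma triangle_exact_cov W (f : dhom D W Y) :
  dcomp v f = 0 -> exists g, f = dcomp u g.
Proof.
move: uvw => [M [N [k [a [b [c [[ia ib ic] [e1 e2 e3]]]]]]]] h.
have [V [t [t' [g [ht it ef]]]]] := right_fraction (dcomp b f).
have h0 : dcomp (loc (cx_cone_in k)) (dcomp b f) = 0.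
  by rewrite dcompA -[X in dcomp X f]e2 -dcompA h comp0r.
have h1 : loc (cm_comp (cx_cone_in k) g) = 0.
  rewrite loc_cm_comp -[dcomp _ _]dcomp_idr -it.1 dcompA.
  by rewrite -[dcomp (dcomp _ _) t']dcompA -ef h0 comp0l.
have [U [s [hs hsg]]] := loc0_killed h1.
have [j hj] := cone_lift (f := k) (k := cm_comp g s) hsg.
have [s' is'] := loc_cm_qis D hs; have [a' [ia1 ia2]] := ia.
exists (dcomp a' (dcomp (loc j) (dcomp s' t'))).
apply: (diso_monic ib).
rewrite dcompA e1 -dcompA [dcomp a (dcomp a' _)]dcompA ia2 dcomp_idl.
rewrite dcompA -[dcomp (Defs.loc D k) _]loc_cm_comp.
rewrite (homotopic_loc D (f := cm_comp k j) (g := cm_comp g s)) // loc_cm_comp ef.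
by rewrite -dcompA [dcomp (loc s) _]dcompA is'.2 dcomp_idl.
Qed.

(** The composite g k is null-homotopic only after a quasi-isomorphism t into M, so g extends over
    the cone of k t; [cone_map] identifies this cone with the cone of k in the derived category. *)
Lemma triangle_exact_contra W (f : dhom D Y W) :
  dcomp f u = 0 -> exists g, f = dcomp g v.
Proof.
move: uvw => [M [N [k [a [b [c [[ia ib ic] [e1 e2 e3]]]]]]]] h.
have [b' [ib1 ib2]] := ib; have [a' [ia1 ia2]] := ia.
have [V [s [s' [g [hs is' ef]]]]] := left_fraction (dcomp f b').
have h0 : loc (cm_comp g k) = 0.
  rewrite loc_cm_comp.
  have -> : loc g = dcomp (loc s) (dcomp f b').
    by rewrite ef dcompA is'.2 dcomp_idl.
  rewrite -[Defs.loc D k]dcomp_idr -ia2 [dcomp (Defs.loc D k) _]dcompA -e1.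
  rewrite -!dcompA [dcomp b' _]dcompA.
  by rewrite ib1 dcomp_idl [dcomp f _]dcompA h comp0l comp0r.
have [U [t [ht htg]]] := loc0_killed h0.
have [j hj] := @cone_extend _ _ _ _ _ (cm_comp k t) g htg.
have [q [iq1 iq2]] := loc_cm_qis D (cone_map_qis k ht).
exists (dcomp (dcomp s' (dcomp (loc j) q)) c).
rewrite -[RHS]dcompA e2 [RHS]dcompA; apply: (diso_epic (f := b')); first by exists b.
rewrite -[RHS]dcompA ib2 dcomp_idr ef -!dcompA; congr dcomp.
rewrite -hj loc_cm_comp; congr dcomp.
have -> : loc (cx_cone_in k) = dcomp (loc (cone_map k t)) (loc (cx_cone_in (cm_comp k t))).
  by rewrite -loc_cm_comp; congr Defs.loc; apply: chain_map_eq => x /=; rewrite cm0.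
by rewrite dcompA iq1 dcomp_idl.
Qed.
End Triangle.

End Triangles2.

(** * Thick subcategories *)

Section Thick.
Variables (K : fieldType) (L : falgType K) (D : derived (complexes L)).
Implicit Types X Y Z W T : obj (complexes L).
Implicit Types P Q : obj (complexes L) -> Prop.

Lemma thick_thick P : thick_subcategory D (thick D P).
Proof.
split.
- by move=> X hX Q [h0 _ _ _] _; apply: h0.
- move=> X; split=> h Q hQ hP; have [_ h1 _ _] := hQ; apply/h1; exact: h.
- move=> X Y Z u v w h hX hY Q hQ hP; have [_ _ h2 _] := hQ.
  by apply: h2 h _ _; [apply: hX | apply: hY].
- move=> X Y h hY Q hQ hP; have [_ _ _ h3] := hQ.
  by apply: h3 h _; apply: hY.
Qed.

Lemma thick_sub P X : P X -> thick D P X.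
Proof. by move=> h Q _; apply. Qed.

Lemma triangle_comp0' X Y Z (u : dhom D X Y) (v : dhom D Y Z) w :
  distinguished u v w -> dcomp w v = 0.
Proof. by move/triangle_rotate/triangle_comp0. Qed.

Lemma triangle_comp0'' X Y Z (u : dhom D X Y) (v : dhom D Y Z) w :
  distinguished u v w -> dcomp (dshift 1 u) w = 0.
Proof.
move/triangle_rotate/triangle_rotate/triangle_comp0.
by move/eqP; rewrite compNl oppr_eq0 => /eqP.
Qed.

Lemma triangle_exact_contra_shift X Y Z (u : dhom D X Y) (v : dhom D Y Z) w :
  distinguished u v w -> forall W (f : dhom D (shift 1 X) W), dcomp f w = 0 ->
  exists g, f = dcomp g (dshift 1 u).
Proof.
move=> h W f hf.
have [g ->] := triangle_exact_contra (triangle_rotate (triangle_rotate h)) hf.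
by exists (- g); rewrite compNr compNl.
Qed.

(** [direct_summand] asks for a complement. It is the cone of the split monomorphism [i]: id - i p
    kills [i], so it factors through the cone and gives the second inclusion [j]. *)
Lemma retract_direct_summand X Y (i : dhom D X Y) (p : dhom D Y X) :
  dcomp p i = did D X ->
  exists Z (v : dhom D Y Z) w j, [/\ distinguished i v w, dcomp v j = did D Z,
    dcomp v i = 0, dcomp p j = 0 & dcomp i p + dcomp j v = did D Y].
Proof.
move=> pi; have [Z [v [w h]]] := triangle_complete i.
have [|j hj] := triangle_exact_contra h (f := did D Y - dcomp i p).
  by rewrite compBl -dcompA pi dcomp_idl dcomp_idr subrr.
have vi := triangle_comp0 h; have wv := triangle_comp0' h.
(* S i has the left inverse S p, so (S i) w = 0 forces w = 0. *)
have w0 : w = 0.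
  have := triangle_comp0'' h; move/(congr1 (dcomp (dshift 1 p))).
  by rewrite dcompA -dshift_comp pi dshift_id dcomp_idl comp0r.
have vj : dcomp v j = did D Z.
  have [|g hg] := triangle_exact_contra (triangle_rotate h) (f := dcomp v j - did D Z).
    by rewrite compBl -dcompA -hj compBr dcompA vi comp0l dcomp_idl dcomp_idr subr0 subrr.
  by apply/eqP; rewrite -subr_eq0 hg w0 comp0r.
exists Z, v, w, j; split=> //; last by rewrite -hj addrC subrK.
have : dcomp (dcomp p j) v = 0.
  by rewrite -dcompA -hj compBr dcompA pi dcomp_idl dcomp_idr subrr.
move/(congr1 (fun f => dcomp f j)).
by rewrite -dcompA vj dcomp_idr comp0l.
Qed.

Section ThickSub.
Variables (P : obj (complexes L) -> Prop) (hP : thick_subcategory D P).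

Lemma thick_retract X Y (i : dhom D X Y) (p : dhom D Y X) :
  dcomp p i = did D X -> P Y -> P X.
Proof.
move=> pi; have [_ _ _] := hP; apply.
have [Z [v [w [j [_ e1 e2 e3 e4]]]]] := retract_direct_summand pi.
by exists Z, i, p, j, v.
Qed.

Lemma thick_iso X Y : isomorphic D X Y -> P X -> P Y.
Proof. by move=> [f [g [h1 h2]]]; apply: thick_retract h2. Qed.

Lemma thick_shift_inv X : P (shift (-1) X) <-> P X.
Proof.
have [_ h _ _] := hP; rewrite -h.
have i : isomorphic D (shift 1 (shift (-1) X)) X.
  apply: isomorphic_trans (shift_add_isomorphic D (-1) 1 X) _.
  by rewrite addNr; apply: shift_zero_isomorphic.
split; apply: thick_iso => //; exact: isomorphic_sym.
Qed.

Lemma thick_shift m X : P (shift m X) <-> P X.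
Proof.
have [_ h1 _ _] := hP.
have hn n (Y : obj (complexes L)) : P (shift n%:Z Y) <-> P Y.
  elim: n => [|n IH].
    have i := shift_zero_isomorphic D Y.
    by split; apply: thick_iso => //; apply: isomorphic_sym.
  rewrite -IH -(h1 (shift n%:Z Y)); have := shift_add_isomorphic D n%:Z 1 Y.
  rewrite -PoszD addn1 => i; split; apply: thick_iso => //.
  exact: isomorphic_sym.
case: (intP m) => [|n|n]; [exact: (hn 0%N) | exact: hn|].
rewrite -(hn n.+1).
have i : isomorphic D (shift n.+1%:Z (shift (- n.+1%:Z) X)) X.
  apply: isomorphic_trans (shift_add_isomorphic D (- n.+1%:Z) n.+1 X) _.
  by rewrite addNr; apply: shift_zero_isomorphic.
split; apply: thick_iso => //; exact: isomorphic_sym.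
Qed.

Lemma thick_third X Y Z (u : dhom D X Y) (v : dhom D Y Z) w :
  distinguished u v w -> P Y -> P Z -> P X.
Proof.
move=> /triangle_rotate h hY hZ; have [_ h1 h2 _] := hP.
by apply/h1; apply: h2 h _ _.
Qed.

Lemma thick_middle X Y Z (u : dhom D X Y) (v : dhom D Y Z) w :
  distinguished u v w -> P X -> P Z -> P Y.
Proof.
move=> /triangle_rotate h hX hZ; apply: (thick_third h) => //.
by have [_ h1 _ _] := hP; apply/h1.
Qed.

(** Induction on the number of summands: the cone of the first inclusion is a direct sum of the
    remaining ones. *)
Lemma thick_direct_sum r (Xs : 'I_r -> obj (complexes L)) X i p :
  @direct_sum _ _ D r Xs X i p -> (forall a, P (Xs a)) -> P X.
Proof.
elim: r Xs X i p => [|r IH] Xs X i p [h1 h2 h3] hX.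
  by have [h0 _ _ _] := hP; apply: h0; rewrite /zero_object -h3 big_ord0.
have [Z [v [w [j [hd e1 e2 e3 e4]]]]] := retract_direct_summand (h1 ord0).
apply: (thick_middle hd) => //.
have lift_ne (a : 'I_r) : lift ord0 a != ord0 by rewrite eq_sym neq_lift.
apply: (IH (fun a => Xs (lift ord0 a)) Z (fun a => dcomp v (i (lift ord0 a)))
  (fun a => dcomp (p (lift ord0 a)) j)) => //.
have hjv : dcomp j v = did D X - dcomp (i ord0) (p ord0) by rewrite -e4 addrC addKr.
have e (a b : 'I_r) : dcomp (dcomp (p (lift ord0 b)) j) (dcomp v (i (lift ord0 a))) =
    dcomp (p (lift ord0 b)) (i (lift ord0 a)).
  rewrite -dcompA [dcomp j _]dcompA hjv compBl dcomp_idl -dcompA.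
  by rewrite (h2 _ _ (lift_ne a)) comp0r subr0.
split.
- by move=> a; rewrite e h1.
- by move=> a b ab; rewrite e h2 // (inj_eq lift_inj).
have -> : \sum_a dcomp (dcomp v (i (lift ord0 a))) (dcomp (p (lift ord0 a)) j) =
    dcomp v (dcomp (\sum_(a < r) dcomp (i (lift ord0 a)) (p (lift ord0 a))) j).
  by rewrite comp_suml comp_sumr; apply: eq_bigr => a _; rewrite !dcompA.
move: h3; rewrite big_ord_recl => /(canRL (addKr _)) ->; rewrite addrC -hjv.
by rewrite -dcompA e1 dcomp_idr e1.
Qed.

Lemma direct_sum_thick r (Xs : 'I_r -> obj (complexes L)) X i p a :
  @direct_sum _ _ D r Xs X i p -> P X -> P (Xs a).
Proof. by move=> [h _ _]; apply: thick_retract (h a). Qed.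
End ThickSub.

(** Exactness for the shifted triangle without shifting the triangle, hence without signs: [f] is
    carried to a morphism Z -> S^(-m) W by the bijection [dshift m]. *)
Lemma shifted_exact_contra X Y Z (u : dhom D X Y) (v : dhom D Y Z) w m W
  (f : dhom D (shift m Z) W) : distinguished u v w ->
  dcomp f (dshift m v) = 0 -> exists g, f = dcomp g (dshift m w).
Proof.
move=> h hf; have e : - m + m = 0 by rewrite addNr.
have [q [iq1 iq2]] := unshift_iso D e W.
set c := Defs.loc D _ in iq1 iq2.
have [k _ kK] := dshift_bij D m Z (shift (- m) W).
pose f0 := k (dcomp q f).
have hf0 : f = dcomp c (dshift m f0) by rewrite kK dcompA iq2 dcomp_idl.
have [|g hg] := triangle_exact_contra (triangle_rotate h) (f := f0).
  apply: (bij_inj (dshift_bij D m _ _)); rewrite dshift_comp dshift0 kK.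
  by rewrite -dcompA hf comp0r.
by exists (dcomp c (dshift m g)); rewrite hf0 hg dshift_comp dcompA.
Qed.

End Thick.

(** * Simple-minded objects *)

Section Spanned.
Variable K : fieldType.
Implicit Types V W : lmodType K.

Definition spanned V n := exists b : 'I_n -> V, forall v, exists c : 'I_n -> K,
  v = \sum_i c i *: b i.

Lemma spanned_surj V W n (f : V -> W) : linear f -> (forall w, exists v, f v = w) ->
  spanned V n -> spanned W n.
Proof.
move=> lf sf [b hb]; exists (fun i => f (b i)) => w.
have [v <-] := sf w; have [c ->] := hb v; exists c.
rewrite (big_morph f (id1 := 0) (op1 := +%R)) ?(lin0 lf) //.
  by apply: eq_bigr => i _; rewrite (linZ _ _ lf).
by move=> x y; rewrite (linD _ _ lf).
Qed.

(** The kernel element x is a combination of the generators with some nonzero coefficient, so the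
    image of that generator is a combination of the other images. *)
Lemma spanned_kill V W n (f : V -> W) (x : V) : linear f ->
  (forall w, exists v, f v = w) -> x != 0 -> f x = 0 ->
  spanned V n -> exists2 k, n = k.+1 & spanned W k.
Proof.
move=> lf sf x0 fx [b hb].
have fsum m (g : 'I_m -> V) (c : 'I_m -> K) :
    f (\sum_i c i *: g i) = \sum_i c i *: f (g i).
  rewrite (big_morph f (id1 := 0) (op1 := +%R)) ?(lin0 lf) //.
    by apply: eq_bigr => i _; rewrite (linZ _ _ lf).
  by move=> ? ?; rewrite (linD _ _ lf).
have [c ex] := hb x.
have [i0 ci0] : exists i0, c i0 != 0.
  apply: contrapT => h; case/eqP: x0; rewrite ex big1 // => i _.
  have [->|ci] := eqVneq (c i) 0; first by rewrite scale0r.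
  by case: h; exists i.
case: n b hb c ex i0 ci0 => [|n] b hb c ex i0 ci0; first by case: i0 ci0.
exists n => //; exists (fun i => f (b (lift i0 i))) => w.
have [v <-] := sf w; have [d ->] := hb v.
exists (fun i => d (lift i0 i) - d i0 / c i0 * c (lift i0 i)).
move: fx; rewrite ex !fsum (bigD1_ord i0) //= (bigD1_ord i0) //= => e.
under [RHS]eq_bigr do rewrite scalerBl -scalerA.
rewrite sumrB -scaler_sumr.
move/(canRL (addKr _)): e; rewrite addr0 => ->.
rewrite scalerN scalerA opprK divfK //; exact: addrC.
Qed.

Lemma spanned_equiv V W n : lin_equiv V W -> spanned V n -> spanned W n.
Proof.
move=> [f [lf [g gf fg]]]; apply: spanned_surj lf _ => w; by exists (g w).
Qed.
End Spanned.

(** * Orthogonality and generation for simple-minded objects *)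

Section SimpleMinded.
Variables (K : fieldType) (L : falgType K) (D : derived (complexes L)).
Implicit Types Y Z W T : obj (complexes L).

Lemma shift_pred_isomorphic m W :
  isomorphic D (shift (m - 1) (shift 1 W)) (shift m W).
Proof.
have := shift_add_isomorphic D 1 (m - 1) W.
by have -> : 1 + (m - 1) = m by rewrite addrC subrK.
Qed.

Variables (r : nat) (X : 'I_r -> obj (complexes L)).
Hypothesis X_neg : forall i j n, 0 < n -> is_trivial (dhom D (shift n (X i)) (X j)).
Hypothesis X_ne : forall i j, i != j -> is_trivial (dhom D (X i) (X j)).
Hypothesis X_end : forall i (f : dhom D (X i) (X i)), exists c, f = c *: did D (X i).

(** The class of W in the overview, and below it that of Z. The shift sits on the first argument, so
    n > 0 here means Hom(X_i, S^m T) = 0 for m < 0, and n <= 0 below means m >= 0. *)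
Definition coaisle T :=
  forall i n, 0 < n -> is_trivial (dhom D (shift n (X i)) T).
Definition right_orthogonal Z :=
  forall i n, n <= 0 -> is_trivial (dhom D (shift n (X i)) Z).

(** Up to S^0 X = X, a nonzero [f] is a nonzero multiple of the identity and would force p = 0. *)
Lemma X_shift_zero i j (f : dhom D (X i) (shift 0 (X j))) Y
    (p : dhom D (shift 0 (X j)) Y) : p != 0 -> dcomp p f = 0 -> f = 0.
Proof.
move=> p0 pf; have [z [z' [z1 z2]]] := shift_zero_isomorphic D (X j).
suff : dcomp z f = 0.
  by move/(congr1 (dcomp z')); rewrite dcompA z1 dcomp_idl comp0r.
have [ij|ij] := eqVneq i j; last exact: X_ne.
subst j; have [c e] := X_end (dcomp z f).
have [c0|c0] := eqVneq c 0; first by rewrite e c0 scale0r.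
have e' : f = c *: z' by rewrite -[f]dcomp_idl -z1 -dcompA e compZr dcomp_idr.
case/eqP: p0; rewrite -[p]dcomp_idr -z1 dcompA.
suff -> : dcomp p z' = 0 by rewrite comp0l.
by move: pf; rewrite e' compZr => /eqP; rewrite scaler_eq0 (negPf c0) => /eqP.
Qed.

(** In the long exact sequence of Hom(S^n X_k, -) with n > 0, the obstruction lies in Hom(S^n X_k,
    S^(m+1) X_i). It vanishes for degree reasons unless n = 1 and m = 0; there composition with the
    nonzero [p] is injective on Hom(X_k, X_i), so the connecting map is zero. *)
Lemma coaisle_cone i m T C (p : dhom D (shift m (X i)) T) (c : dhom D T C) w :
  distinguished p c w -> m <= 0 -> p != 0 -> coaisle T -> coaisle C.
Proof.
move=> h m0 p0 hT k n n0 f; suff wf : dcomp w f = 0.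
  have [g ->] := triangle_exact_cov (triangle_rotate h) wf.
  by rewrite (hT k n n0 g) comp0r.
have := triangle_comp0'' h; move/(congr1 (fun g => dcomp g f)).
rewrite comp0l -dcompA; move: (dcomp w f) => {f h} g pg.
have [n1|n1] := boolP ((n == 1) && (m == 0)); last first.
  suff : is_trivial (dhom D (shift n (X k)) (shift 1 (shift m (X i)))) by apply.
  apply: is_trivial_equiv (lin_equiv_sym (lin_equiv_shift2 D n 1 (X k) _)) _.
  apply: is_trivial_equiv (lin_equiv_sym (lin_equiv_shift2 D _ m (X k) _)) _.
  by apply: X_neg; lia.
case/andP: n1 => /eqP n1 /eqP m1; subst n m.
have [g' _ gK] := dshift_bij D 1 (X k) (shift 0 (X i)).
rewrite -[g]gK (_ : g' g = 0) ?dshift0 //; apply: (X_shift_zero p0).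
apply: (bij_inj (dshift_bij D 1 _ _)).
by rewrite dshift_comp gK dshift0.
Qed.

(* Absorbed objects are stable under shifts, cones and retracts; for W in the
   coaisle, the identity of W then shows that W has no morphism to the right
   orthogonal. *)
Definition absorbed W := forall T, coaisle T -> forall p : dhom D W T,
  exists C (c : dhom D T C), [/\ coaisle C, dcomp c p = 0
    & forall Z, right_orthogonal Z -> forall f : dhom D T Z, exists g, f = dcomp g c].

Lemma absorbed_retract V W (i : dhom D V W) (p : dhom D W V) :
  dcomp p i = did D V -> absorbed W -> absorbed V.
Proof.
move=> pi hW T hT f; have [C [c [hC cf hc]]] := hW T hT (dcomp f p).
exists C, c; split=> //.
by rewrite -[f]dcomp_idr -pi [dcomp f _]dcompA dcompA cf comp0l.
Qed.

Lemma absorbed_iso V W : isomorphic D V W -> absorbed W -> absorbed V.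
Proof. by move=> [f [g [h _]]]; apply: absorbed_retract h. Qed.

Lemma absorbed_thick : thick_subcategory D (fun W => forall m, absorbed (shift m W)).
Proof.
split.
- move=> W hW m T hT p; exists T, (did D T); split=> //.
    have z : did D (shift m W) = 0 by rewrite -dshift_id hW dshift0.
    by rewrite dcomp_idl -[p]dcomp_idr z comp0r.
  by move=> Z _ f; exists f; rewrite dcomp_idr.
- move=> W; split=> h m.
    apply: absorbed_iso (h (m - 1)); apply: isomorphic_sym.
    exact: shift_pred_isomorphic.
  by apply: absorbed_iso (h (1 + m)); apply: shift_add_isomorphic.
- move=> U V W u v w h hU hV m T hT p.
  (* For a cone, the restriction of [p] to V is killed by some c1; then c1 p factors through the
     shift of S U, and this factor is killed in turn by c2. *)
  have [C1 [c1 [hC1 e1 f1]]] := hV m T hT (dcomp p (dshift m v)).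
  have [|q hq] := shifted_exact_contra (f := dcomp c1 p) h.
    by rewrite -dcompA.
  have [C [c [hC e2 f2]]] := absorbed_iso (shift_add_isomorphic D 1 m U) (hU (1 + m)) hC1 q.
  exists C, (dcomp c c1); split=> //.
    by rewrite -dcompA hq dcompA e2 comp0l.
  move=> Z hZ f; have [g ->] := f1 Z hZ f; have [g' ->] := f2 Z hZ g.
  by exists g'; rewrite dcompA.
- move=> V W [Z [i [p [_ [_ [pi _ _ _ _]]]]]] hW m.
  apply: (absorbed_retract (i := dshift m i) (p := dshift m p)) (hW m).
  by rewrite -dshift_comp pi dshift_id.
Qed.

(** A nonzero morphism from S^m X_i to an object of the coaisle has m <= 0. Its cone stays in the
    coaisle, and maps to the right orthogonal extend over it because they vanish on S^m X_i. *)
Lemma absorbed_X i m : absorbed (shift m (X i)).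
Proof.
move=> T hT p; have [p0|p0] := eqVneq p 0.
  exists T, (did D T); split=> //; first by rewrite p0 comp0r.
  by move=> Z _ f; exists f; rewrite dcomp_idr.
have m0 : m <= 0.
  by rewrite leNgt; apply: contra_neqN p0 => m0; apply: hT.
have [C [c [w h]]] := triangle_complete p.
exists C, c; split; [exact: coaisle_cone h _ _ _ | exact: triangle_comp0 h |].
by move=> Z hZ f; apply: (triangle_exact_contra h); apply: hZ.
Qed.

Lemma coaisle_orthogonal T Z : thick_of D X T -> coaisle T -> right_orthogonal Z ->
  is_trivial (dhom D T Z).
Proof.
move=> hT aT hZ f.
have /(_ 0) hT0 : forall m, absorbed (shift m T).
  by apply: hT absorbed_thick _ => _ [i ->] m; apply: absorbed_X.
have [C [c [_ e h]]] := absorbed_iso (isomorphic_sym (shift_zero_isomorphic D T)) hT0 aT (did D T).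
by have [g ->] := h Z hZ f; rewrite -[c]dcomp_idr e comp0r.
Qed.

Lemma thick_detect W Z : thick_of D X W ->
  (forall i n, is_trivial (dhom D (shift n (X i)) Z)) ->
  is_trivial (dhom D W Z).
Proof.
move=> hW hZ; suff /(_ 0) h : forall m, is_trivial (dhom D (shift m W) Z).
  apply: is_trivial_equiv h.
  exact: lin_equiv_iso (shift_zero_isomorphic D W) (isomorphic_refl _ _).
apply: (hW (fun W => forall m, is_trivial (dhom D (shift m W) Z))); last first.
  by move=> _ [i ->] m; apply: hZ.
split.
- move=> V hV m f; have z : did D (shift m V) = 0 by rewrite -dshift_id hV dshift0.
  by rewrite -[f]dcomp_idr z comp0r.
- move=> V; split=> h m.
    apply: is_trivial_equiv (h (m - 1)); apply: lin_equiv_iso (isomorphic_refl _ _).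
    exact: shift_pred_isomorphic.
  apply: is_trivial_equiv (h (1 + m)); apply: lin_equiv_iso (isomorphic_refl _ _).
  apply: isomorphic_sym; exact: shift_add_isomorphic.
- move=> U V V' u v w h hU hV m f.
  have [|q ->] := shifted_exact_contra (f := f) h; first exact: hV.
  suff : is_trivial (dhom D (shift m (shift 1 U)) Z) by move=> z; rewrite (z q) comp0l.
  apply: is_trivial_equiv (hU (1 + m)); apply: lin_equiv_iso (isomorphic_refl _ _).
  apply: isomorphic_sym; exact: shift_add_isomorphic.
- move=> V V' [_ [i [p [_ [_ [pi _ _ _ _]]]]]] hV m f.
  rewrite -[f]dcomp_idr -dshift_id -pi dshift_comp dcompA.
  by rewrite (hV m (dcomp f _)) comp0l.
Qed.

Variable T : 'I_r -> obj (complexes L).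
Hypothesis T_thick : forall i, thick_of D X (T i).
Hypothesis XT : forall i j n, if (i == j) && (n == 0)
  then is_line (dhom D (shift n (X j)) (T i))
  else is_trivial (dhom D (shift n (X j)) (T i)).

Lemma XT_ne i j n : ~~ ((i == j) && (n == 0)) ->
  is_trivial (dhom D (shift n (X j)) (T i)).
Proof. by have := XT i j n; case: ifP. Qed.

Lemma XT_coaisle i : coaisle (T i).
Proof. by move=> j n n0; apply: XT_ne; apply/negP=> /andP[_ /eqP n1]; rewrite n1 ltxx in n0. Qed.

(** The cone C of a nonzero u : X_j -> T_j is in the coaisle, while the vanishing of Hom(S^n X_i, Z)
    for n < 0 puts S Z in the right orthogonal. So the obstruction in Hom(C, S Z) is zero. *)
Lemma extend_to_T j Z (x : dhom D (shift 0 (X j)) Z) :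
  (forall i n, n < 0 -> is_trivial (dhom D (shift n (X i)) Z)) ->
  exists (u : dhom D (shift 0 (X j)) (T j)) (y : dhom D (T j) Z),
    u != 0 /\ x = dcomp y u.
Proof.
move=> hZ; have := XT j j 0; rewrite !eqxx /= => -[u u0 _].
exists u; have [C [v [w h]]] := triangle_complete u.
have aC : coaisle C by apply: coaisle_cone h _ u0 (@XT_coaisle j).
have [hthick0 hthick1 hthick2 _] := thick_thick D (fun Y => exists a, Y = X a).
have tC : thick_of D X C.
  apply: hthick2 h _ (@T_thick j); apply/thick_shift; first exact: thick_thick.
  by apply: thick_sub; exists j.
have [|g hg] := triangle_exact_contra_shift h (f := dshift 1 x).
- apply: (coaisle_orthogonal tC aC) => i n n0.
  apply: is_trivial_equiv (lin_equiv_sym (lin_equiv_shift2 D n 1 (X i) Z)) _.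
  by apply: hZ; lia.
have [g' _ gK] := dshift_bij D 1 (T j) Z.
exists (g' g); split=> //; apply: (bij_inj (dshift_bij D 1 _ _)).
by rewrite dshift_comp gK.
Qed.

Variable Q : obj (complexes L) -> Prop.
Hypothesis Q_thick : thick_subcategory D Q.
Hypothesis QT : forall i, Q (T i).

(** Z1 is the cone of the extension y : T_j -> Z of x. A connecting morphism lies in Hom(S^n X_i, S
    T_j), which is nonzero only for i = j and n = 1; it is then a multiple of S u, and y u = x <> 0
    makes that multiple zero. So no new morphisms from the X_i appear. *)
Lemma remove_top j Z (x : dhom D (shift 0 (X j)) Z) : x != 0 ->
  thick_of D X Z ->
  (forall i n, n < 0 -> is_trivial (dhom D (shift n (X i)) Z)) ->
  exists Z1 (v : dhom D Z Z1), [/\ thick_of D X Z1, Q Z1 -> Q Z, dcomp v x = 0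
    & forall i n (f : dhom D (shift n (X i)) Z1), exists g, dcomp v g = f].
Proof.
move=> x0 tZ hneg; have [u [y [u0 xyu]]] := extend_to_T x hneg.
have [Z1 [v [w h]]] := triangle_complete y.
exists Z1, v; split.
- have [_ _ h2 _] := thick_thick D (fun Y => exists a, Y = X a).
  exact: h2 h (@T_thick j) tZ.
- by move=> hQ; apply: (thick_middle Q_thick h) => //.
- by rewrite xyu dcompA (triangle_comp0 h) comp0l.
move=> i n f; suff wf : dcomp w f = 0.
  by have [g ->] := triangle_exact_cov (triangle_rotate h) wf; exists g.
have := triangle_comp0'' h; move/(congr1 (fun g => dcomp g f)).
rewrite comp0l -dcompA; move: (dcomp w f) => {f} g yg.
have [|n1] := boolP ((j == i) && (n - 1 == 0)); last first.
  suff : is_trivial (dhom D (shift n (X i)) (shift 1 (T j))) by apply.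
  apply: is_trivial_equiv (lin_equiv_sym (lin_equiv_shift2 D n 1 (X i) _)) _.
  exact: XT_ne.
rewrite subr_eq0 => /andP[/eqP ij /eqP n1]; subst i n.
have [g' _ gK] := dshift_bij D 1 (X j) (T j).
rewrite -[g]gK; suff -> : g' g = 0 by rewrite dshift0.
have yg' : dcomp y (g' g) = 0.
  by apply: (bij_inj (dshift_bij D 1 _ _)); rewrite dshift_comp gK dshift0.
move: (g' g) yg' => {g' gK g yg} g yg.
have [z [z' [z1 z2]]] := shift_zero_isomorphic D (X j).
apply: (diso_epic (f := z)); first by exists z'.
have := XT j j 0; rewrite !eqxx /= => -[t t0 ht].
have [c ec] := ht (dcomp g z); have [b eb] := ht u.
have b0 : b != 0 by apply: contra_neq u0 => b0; rewrite eb b0 scale0r.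
have et : t = b^-1 *: u by rewrite eb scalerA mulVf // scale1r.
rewrite comp0l ec et; have [->|c0] := eqVneq c 0; first by rewrite scale0r.
case/eqP: x0; rewrite xyu.
have : dcomp y (dcomp g z) = 0 by rewrite dcompA yg comp0l.
rewrite ec et scalerA compZr => /eqP; rewrite scaler_eq0 mulf_eq0 invr_eq0.
by rewrite (negPf c0) (negPf b0) => /eqP.
Qed.

(** Lexicographic induction: Hom(S^n X_i, Z) lives in 0 <= n < N, and d bounds its total dimension
    for n = 0. [remove_top] lowers d; once the part n = 0 is exhausted, Z is replaced by S^(-1) Z
    and N drops. For N = 0 the identity of Z vanishes. *)
Lemma generated_by_T (N d : nat) Z : thick_of D X Z ->
  (forall i n, n < 0 -> is_trivial (dhom D (shift n (X i)) Z)) ->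
  (forall i n, N%:Z <= n -> is_trivial (dhom D (shift n (X i)) Z)) ->
  (forall i n, exists k, spanned (dhom D (shift n (X i)) Z) k) ->
  (exists2 e : 'I_r -> nat, (\sum_i e i)%N = d &
    forall i, spanned (dhom D (shift 0 (X i)) Z) (e i)) -> Q Z.
Proof.
elim: N d Z => [|N IHN] d.
  move=> Z tZ hneg hpos _ _; have [hQ0 _ _ _] := Q_thick; apply: hQ0.
  apply: (thick_detect tZ) => i n; have [n0|n0] := ltP n 0; first exact: hneg.
  exact: hpos.
elim/ltn_ind: d => d IHd Z tZ hneg hpos hfin [e ed he].
have [h0|] := pselect (forall i, is_trivial (dhom D (shift 0 (X i)) Z)).
  have eq i n : lin_equiv (dhom D (shift n (X i)) (shift (-1) Z))
      (dhom D (shift (n + 1) (X i)) Z).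
    by have := lin_equiv_shift2 D n (-1) (X i) Z; rewrite opprK.
  have fin i n : exists k, spanned (dhom D (shift n (X i)) (shift (-1) Z)) k.
    have [k hk] := hfin i (n + 1); exists k.
    exact: spanned_equiv (lin_equiv_sym (eq i n)) hk.
  have [e1 he1] := choice (fun i => fin i 0).
  apply/(thick_shift_inv Q_thick); apply: (IHN (\sum_i e1 i)%N) => //; last by exists e1.
  - apply/thick_shift_inv => //; exact: thick_thick.
  - move=> i n n0; apply: is_trivial_equiv (lin_equiv_sym (eq i n)) _.
    have [n1|n1] := ltP (n + 1) 0; first exact: hneg.
    by have -> : n + 1 = 0 by lia.
  - move=> i n n0; apply: is_trivial_equiv (lin_equiv_sym (eq i n)) _.
    by apply: hpos; lia.
move/existsNP => [j /existsNP[x /eqP x0]].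
have [Z1 [v [tZ1 hQ vx sv]]] := remove_top x0 tZ hneg.
apply: hQ; have lv i n : linear (fun g : dhom D (shift n (X i)) Z => dcomp v g).
  by move=> c f g; rewrite dcomp_linr.
have triv i n : is_trivial (dhom D (shift n (X i)) Z) ->
    is_trivial (dhom D (shift n (X i)) Z1).
  by move=> h f; have [g <-] := sv i n f; rewrite (h g) comp0r.
have [k ek hk] := spanned_kill (lv j 0) (sv j 0) x0 vx (he j).
apply: (IHd (\sum_i (if i == j then k else e i))%N) => //.
- rewrite -ed (bigD1 j) //= [X in (_ < X)%N](bigD1 j) //= eqxx ek addSn ltnS.
  by rewrite leq_add2l leq_eqVlt; apply/orP; left; apply/eqP; apply: eq_bigr => i /negPf ->.
- by move=> i n n0; apply: triv; apply: hneg.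
- by move=> i n n0; apply: triv; apply: hpos.
- by move=> i n; have [l hl] := hfin i n; exists l; apply: spanned_surj (lv i n) (sv i n) hl.
- exists (fun i => if i == j then k else e i) => // i.
  have [->|_] := eqVneq i j; first exact: hk.
  exact: spanned_surj (lv i 0) (sv i 0) (he i).
Qed.
End SimpleMinded.

(** * Finite-dimensional linear algebra *)

Section Subspaces.
Variables (R : nzRingType) (V : lmodType R).
Implicit Types P Q : V -> Prop.

Definition subspace P := P 0 /\ forall a x y, P x -> P y -> P (a *: x + y).

Lemma subspaceD P x y : subspace P -> P x -> P y -> P (x + y).
Proof. by move=> [_ h] hx hy; rewrite -[x]scale1r; apply: h. Qed.
Lemma subspaceZ P a x : subspace P -> P x -> P (a *: x).
Proof. by move=> [h0 h] hx; rewrite -[_ *: _]addr0; apply: h. Qed.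
Lemma subspaceN P x : subspace P -> P x -> P (- x).
Proof. by move=> hP hx; rewrite -scaleN1r; apply: subspaceZ. Qed.
Lemma subspaceB P x y : subspace P -> P x -> P y -> P (x - y).
Proof. by move=> hP hx hy; apply: subspaceD => //; apply: subspaceN. Qed.
Lemma subspace_sum P (I : Type) (s : seq I) (F : I -> V) :
  subspace P -> (forall i, P (F i)) -> P (\sum_(i <- s) F i).
Proof.
move=> hP h; apply: big_rec => [|i x _ hx]; first by case: hP.
exact: subspaceD.
Qed.

Definition in_span n (b : 'I_n -> V) v := exists c : 'I_n -> R, v = \sum_i c i *: b i.

Lemma in_span_subspace n (b : 'I_n -> V) : subspace (in_span b).
Proof.
split; first by exists (fun=> 0); rewrite big1 // => i _; rewrite scale0r.
move=> a x y [c ->] [d ->]; exists (fun i => a * c i + d i).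
rewrite scaler_sumr -big_split; apply: eq_bigr => i _.
by rewrite scalerDl scalerA.
Qed.

Lemma in_span_gen n (b : 'I_n -> V) i : in_span b (b i).
Proof.
exists (fun j => (j == i)%:R); rewrite (bigD1 i) //= eqxx scale1r big1 ?addr0 //.
by move=> j /negPf ->; rewrite scale0r.
Qed.

Lemma in_span_lift n (b : 'I_n.+1 -> V) v :
  in_span (fun i => b (lift ord0 i)) v -> in_span b v.
Proof.
move=> [c ->]; apply: subspace_sum => [|i]; first exact: in_span_subspace.
by apply: subspaceZ; [apply: in_span_subspace | apply: in_span_gen].
Qed.

Lemma in_span_recl n (b : 'I_n.+1 -> V) v : in_span b v <->
  exists c w, in_span (fun i => b (lift ord0 i)) w /\ v = c *: b ord0 + w.
Proof.
split=> [[c ->]|[c [w [hw ->]]]].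
  exists (c ord0), (\sum_(i < n) c (lift ord0 i) *: b (lift ord0 i)).
  by rewrite big_ord_recl; split=> //; exists (fun i => c (lift ord0 i)).
have [_ h] := in_span_subspace b; apply: h; first exact: in_span_gen.
exact: in_span_lift.
Qed.

Definition dim_le P n := exists b : 'I_n -> V, forall v, P v -> in_span b v.
End Subspaces.

Section Dimension.
Variables (K : fieldType) (V : lmodType K).
Implicit Types P Q : V -> Prop.

Definition fcons n (x : V) (b : 'I_n -> V) (i : 'I_n.+1) : V :=
  if unlift ord0 i is Some j then b j else x.

Lemma fcons0 n x (b : 'I_n -> V) : fcons x b ord0 = x.
Proof. by rewrite /fcons unlift_none. Qed.
Lemma fcons_lift n x (b : 'I_n -> V) i : fcons x b (lift ord0 i) = b i.
Proof. by rewrite /fcons liftK. Qed.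

Lemma in_span_fcons n x (b : 'I_n -> V) v : in_span (fcons x b) v <->
  exists c w, in_span b w /\ v = c *: x + w.
Proof.
rewrite in_span_recl fcons0 (_ : (fun i => _) = b) //.
by apply: funext => i; rewrite fcons_lift.
Qed.

(** One step of Gaussian elimination: either no element of [P] needs the first vector, or a pivot
    [p] splits [P] into multiples of p and a part in the span of the others. *)
Lemma subspace_eliminate n (b : 'I_n.+1 -> V) P : subspace P ->
  (forall v, P v -> in_span b v) ->
  (forall v, P v -> in_span (fun i => b (lift ord0 i)) v) \/
  exists c p w, [/\ c != 0, P p, in_span (fun i => b (lift ord0 i)) w,
    p = c *: b ord0 + w &
    forall v, P v -> exists d q, [/\ P q, in_span (fun i => b (lift ord0 i)) q
      & v = d *: p + q]].
Proof.
move=> hP hb; set b' := fun i => _.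
have [h|] := pselect (forall v, P v -> in_span b' v); first by left.
move/existsNP => [p /not_implyP[Pp hp]]; right.
have [c [w [hw ep]]] := proj1 (in_span_recl b p) (hb p Pp).
have c0 : c != 0 by apply/eqP => c0; apply: hp; rewrite ep c0 scale0r add0r.
exists c, p, w; split=> // v Pv.
have [d [x [hx ev]]] := proj1 (in_span_recl b v) (hb v Pv).
exists (d / c), (v - (d / c) *: p); split; last by rewrite addrC subrK.
  by apply: subspaceB => //; apply: subspaceZ.
rewrite ev ep scalerDr scalerA divfK // opprD addrACA subrr add0r.
have sb := in_span_subspace b'; apply: subspaceB => //; exact: subspaceZ.
Qed.

Lemma dim_le_basis P n : subspace P -> dim_le P n ->
  exists b : 'I_n -> V, (forall i, P (b i)) /\ forall v, P v -> in_span b v.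
Proof.
move=> hP [b hb]; elim: n P hP b hb => [|n IH] P hP b hb.
  by exists b; split=> // -[].
have [h|[c [p [w [c0 Pp hw ep hv]]]]] := subspace_eliminate hP hb.
  have [b' [h1 h2]] := IH P hP _ h; exists (fcons 0 b'); split.
    move=> i; rewrite /fcons; case: unlift => [j|] //; by case: hP.
  move=> v Pv; apply/in_span_fcons; exists 0, v.
  by rewrite scaler0 add0r; split=> //; apply: h2.
pose b0 := fun i => b (lift ord0 i); have sb := in_span_subspace b0.
have [||b' [h1 h2]] := IH (fun v => P v /\ in_span b0 v) _ b0; last first.
- exists (fcons p b'); split.
    by move=> i; rewrite /fcons; case: unlift => [j|] //; case: (h1 j).
  move=> v Pv; have [d [q [Pq hq ->]]] := hv v Pv.
  by apply/in_span_fcons; exists d, q; split=> //; apply: h2.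
- by move=> v [].
- split; first by split; [case: hP | case: sb].
  move=> a x y [? ?] [? ?]; split; first by case: hP => _; apply.
  by case: sb => _; apply.
Qed.

Lemma dim_le_proper P Q n : subspace P -> (forall v, P v -> Q v) ->
  dim_le Q n -> (exists2 v, Q v & ~ P v) -> exists2 k, n = k.+1 & dim_le P k.
Proof.
move=> hP PQ [b hb] [v0 Qv0 nPv0].
have hb0 := hb; have {}hb v : P v -> in_span b v by move=> /PQ/hb.
have {PQ Q hb0 Qv0} v0b : in_span b v0 by apply: hb0.
elim: n P hP b hb v0 v0b nPv0 => [|n IH] P hP b hb v v0b nPv.
  by case: nPv; case: v0b => c ->; rewrite big_ord0; case: hP.
exists n => //.
have [h|[c [p [w [c0 Pp hw ep hv]]]]] := subspace_eliminate hP hb.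
  by exists (fun i => b (lift ord0 i)).
pose b0 := fun i => b (lift ord0 i); have sb := in_span_subspace b0.
have [h|h] := pselect (forall v, in_span b0 v -> P v).
  case: nPv; have [d [x [hx ->]]] := proj1 (in_span_recl b v) v0b.
  apply: subspaceD => //; last exact: h.
  have -> : b ord0 = c^-1 *: (p - w) by rewrite ep addrK scalerA mulVf // scale1r.
  do 2!apply: subspaceZ => //; apply: subspaceB => //; exact: h.
move/existsNP: h => [v1 /not_implyP[hv1 nPv1]].
have [||||k ek [b' hb']] := IH (fun v => P v /\ in_span b0 v) _ b0 _ v1.
- split; first by split; [case: hP | case: sb].
  move=> a x y [? ?] [? ?]; split; first by case: hP => _; apply.
  by case: sb => _; apply.
- by move=> ? [].
- exact: hv1.
- by case.
rewrite ek; exists (fcons p b') => u /hv[d [q [Pq hq ->]]].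
by apply/in_span_fcons; exists d, q; split=> //; apply: hb'.
Qed.

Lemma dim_le_add P Q n m : dim_le P n -> dim_le Q m ->
  dim_le (fun v => exists p q, [/\ P p, Q q & v = p + q]) (n + m).
Proof.
move=> [b hb] [b' hb'].
exists (fun i => match split i with inl j => b j | inr j => b' j end).
move=> _ [p [q [/hb[c ->] /hb'[c' ->] ->]]].
exists (fun i => match split i with inl j => c j | inr j => c' j end).
rewrite big_split_ord /=; congr (_ + _); apply: eq_bigr => i _.
  by rewrite -[lshift _ _]/(unsplit (inl i)) unsplitK.
by rewrite -[rshift _ _]/(unsplit (inr i)) unsplitK.
Qed.

End Dimension.

Lemma dim_le_inj (K : fieldType) (U V : lmodType K) (f : U -> V) P n :
  linear f -> injective f -> dim_le P n -> (forall x, P (f x)) ->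
  dim_le (fun _ : U => True) n.
Proof.
move=> lf fi hP hf.
have [||b [hb1 hb2]] := @dim_le_basis _ _ (fun y => exists x, y = f x) n.
- split; first by exists 0; rewrite (lin0 lf).
  by move=> a x y [u ->] [v ->]; exists (a *: u + v); rewrite lf.
- by have [b hb] := hP; exists b => _ [x ->]; apply: hb.
have [b' eb] := choice hb1; exists b' => x _.
have [|c ec] := hb2 (f x); first by exists x.
exists c; apply: fi; rewrite ec.
rewrite (big_morph f (id1 := 0) (op1 := +%R)) ?(lin0 lf) //.
  by apply: eq_bigr => i _; rewrite (linZ _ _ lf) eb.
by move=> u v; rewrite (linD _ _ lf).
Qed.

Lemma iter_linear (R : nzRingType) (V : lmodType R) (u : V -> V) (k : nat) :
  linear u -> linear (iter k u).
Proof. by move=> lu; elim: k => [|k IH] a x y //=; rewrite IH lu. Qed.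

(** * Fitting's lemma *)

Section Iterates.
Variables (K : fieldType) (V : lmodType K) (u : V -> V) (n : nat).
Hypotheses (lu : linear u) (hn : dim_le (fun _ : V => True) n).

(** Each strict step of the chain lowers the number of spanning vectors, so n + 1 strict steps are
    impossible. *)
Lemma chain_stable (P : nat -> V -> Prop) : (forall k, subspace (P k)) ->
  (forall k v, P k.+1 v -> P k v) -> exists k, forall v, P k v -> P k.+1 v.
Proof.
move=> hP dP; apply: contrapT => h.
have pr k : exists2 v, P k v & ~ P k.+1 v.
  apply: contrapT => h1; apply: h; exists k => v Pv.
  by apply: contrapT => nPv; apply: h1; exists v.
suff [m em _] : exists2 m, n = (m + n.+1)%N & dim_le (P n.+1) m by lia.
elim: n.+1 => [|k [m em hm]].
  by exists n; rewrite ?addn0 //; have [b hb] := hn; exists b => v _; apply: hb.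
have [m' em' hm'] := dim_le_proper (hP k.+1) (dP k) hm (pr k).
by exists m'; rewrite // em em' addSnnS.
Qed.

Lemma chain_stable_up (P : nat -> V -> Prop) : (forall k, subspace (P k)) ->
  (forall k v, P k v -> P k.+1 v) -> exists k, forall v, P k.+1 v -> P k v.
Proof.
move=> hP dP; apply: contrapT => h.
have pr k : exists2 v, P k.+1 v & ~ P k v.
  apply: contrapT => h1; apply: h; exists k => v Pv.
  by apply: contrapT => nPv; apply: h1; exists v.
have H k : (k <= n.+1)%N -> exists2 m, n = (m + k)%N & dim_le (P (n.+1 - k)%N) m.
  elim: k => [|k IH] hk.
    by exists n; rewrite ?addn0 //; have [b hb] := hn; exists b => v _; apply: hb.
  have [m em] := IH (ltnW hk); rewrite -(subnSK hk) => hm.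
  have [m' em' hm'] := dim_le_proper (hP _) (dP _) hm (pr _).
  by exists m'; rewrite // em em' addSnnS.
by have [m em _] := H n.+1 (leqnn _); lia.
Qed.

(** Stated as stabilization of the kernels and images of the powers; the decompositions are drawn
    from these two clauses where they are used. *)
Lemma fitting : exists k, (forall m x, iter m u (iter k u x) = 0 -> iter k u x = 0) /\
  forall m x, exists y, iter k u x = iter (m + k) u y.
Proof.
have [||k1 h1] := @chain_stable_up (fun k x => iter k u x = 0).
- move=> k; split; first exact: lin0 (iter_linear k lu).
  by move=> a x y hx hy; rewrite (iter_linear k lu) hx hy scaler0 addr0.
- by move=> k v /= ->; apply: lin0 lu.
have [||k2 h2] := @chain_stable (fun k x => exists y, x = iter k u y).
- move=> k; split; first by exists 0; rewrite (lin0 (iter_linear k lu)).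
  by move=> a _ _ [x ->] [y ->]; exists (a *: x + y); rewrite (iter_linear k lu).
- by move=> k v [y ->]; exists (u y); rewrite iterSr.
have k1m m x : iter (m + k1) u x = 0 -> iter k1 u x = 0.
  elim: m x => [|m IH] x //; rewrite addSn iterSr => /IH.
  by rewrite -iterSr; apply: h1.
have k2m m x : exists y, iter k2 u x = iter (m + k2) u y.
  elim: m => [|m [y ->]]; first by exists x.
  have [|z e] := h2 (iter k2 u y); first by exists y.
  by exists z; rewrite iterD e -iterD addSnnS.
(* Kernels are stable from k1 on and images from k2 on, so the sum serves both. *)
exists (k2 + k1)%N; split=> m x.
  by rewrite -iterD addnA => /k1m e; rewrite iterD e (lin0 (iter_linear k2 lu)).
have [y e] := k2m (m + k1)%N (iter k1 u x); exists y.
by rewrite iterD e -addnA [(k1 + k2)%N]addnC.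
Qed.
End Iterates.

(** * Restriction of scalars to the ground field *)

Section RestrictScalars.
Variables (K : fieldType) (L : falgType K).

(** A copy of the carrier: M already has its module structure over L^c, and the structure over K
    needs a type of its own. *)
Definition kmod (M : lmodType L^c) : Type := M.

Section Instance.
Variable M : lmodType L^c.
HB.instance Definition _ := GRing.Zmodule.on (kmod M).

Lemma kmodDr (a : K) (u v : kmod M) : kscale a (u + v : M) = kscale a (u : M) + kscale a (v : M).
Proof. exact: scalerDr. Qed.

Lemma kmodDl (v : kmod M) (a b : K) : kscale (a + b) (v : M) = kscale a (v : M) + kscale b (v : M).
Proof. by rewrite /kscale scalerDl scalerDl. Qed.

HB.instance Definition _ := GRing.Zmodule_isLmodule.Build K (kmod M)
  (@kscaleA K L M) (@kscale1 K L M) kmodDr kmodDl.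
End Instance.

Lemma kmod_linear (M N : lmodType L^c) (f : M -> N) : linear f ->
  linear (f : kmod M -> kmod N).
Proof. by move=> lf a x y; rewrite [LHS]lf. Qed.

Lemma submodule_subspace (M : lmodType L^c) (P : M -> Prop) : submodule P ->
  subspace (P : kmod M -> Prop).
Proof. by move=> [h0 h]; split=> // a x y; apply: h. Qed.

Lemma fin_dimP (M : lmodType L^c) (P : M -> Prop) :
  fin_dim P <-> exists n, dim_le (P : kmod M -> Prop) n.
Proof.
split=> [[s hs]|[n [b hb]]].
  exists (size s), (fun i => s`_i) => v /hs[c ->]; by exists c.
have e : size (map b (enum 'I_n)) = n by rewrite size_map size_enum_ord.
exists (map b (enum 'I_n)) => x /hb[c ->]; exists (fun i => c (cast_ord e i)).
rewrite (reindex (cast_ord e)) /=; last first.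
  by exists (cast_ord (esym e)) => i _; rewrite (cast_ordK, cast_ordKV).
apply: eq_bigr => i _; rewrite (nth_map (cast_ord e i)); last by rewrite size_enum_ord -[X in (_ < X)%N]e.
by rewrite (nth_ord_enum _ (cast_ord e i)).
Qed.
End RestrictScalars.

(** * Quotient modules *)

Section Quotient.
Variables (R : nzRingType) (M : lmodType R) (P : M -> Prop) (hP : subspace P).

Definition quot_class (x : M) : M -> Prop := fun y => P (y - x).
(** The proof that [P] is a subspace is an argument of the type, so that the module instances can
    depend on it. *)
Definition quotient (_ : subspace P) : Type :=
  {U : M -> Prop | exists x, U = quot_class x}.
Local Notation Q := (quotient hP).
HB.instance Definition _ := gen_eqMixin Q.
HB.instance Definition _ := gen_choiceMixin Q.

Definition qpi (x : M) : Q := exist _ (quot_class x) (ex_intro _ x erefl).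

Lemma qpi_eq x y : qpi x = qpi y <-> P (x - y).
Proof.
split=> [e|h].
  have : (sval (qpi x)) x by rewrite /= /quot_class subrr; case: hP.
  by rewrite e.
apply: eq_exist; apply: funext => z; apply: propext; split=> hz.
  by rewrite /quot_class -[z](subrK x) -addrA; apply: subspaceD.
rewrite /quot_class; have -> : z - x = (z - y) - (x - y) by rewrite opprB addrA subrK.
exact: subspaceB.
Qed.

Lemma qpi_surj (u : Q) : exists x, u = qpi x.
Proof. by case: u => U [x e]; subst U; exists x; apply: eq_exist. Qed.

Definition qrep (u : Q) : M := sval (cid (qpi_surj u)).
Lemma qrepK u : qpi (qrep u) = u.
Proof. by rewrite /qrep; case: cid. Qed.
Lemma qrep_pi x : P (qrep (qpi x) - x).
Proof. by apply/qpi_eq; rewrite qrepK. Qed.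

Definition qadd (u v : Q) := qpi (qrep u + qrep v).
Definition qopp (u : Q) := qpi (- qrep u).
Definition qscale (a : R) (u : Q) := qpi (a *: qrep u).

Lemma qaddE x y : qadd (qpi x) (qpi y) = qpi (x + y).
Proof.
apply/qpi_eq; rewrite opprD addrACA; apply: subspaceD => //; exact: qrep_pi.
Qed.
Lemma qoppE x : qopp (qpi x) = qpi (- x).
Proof. by apply/qpi_eq; rewrite -opprD; apply: subspaceN => //; apply: qrep_pi. Qed.
Lemma qscaleE a x : qscale a (qpi x) = qpi (a *: x).
Proof. by apply/qpi_eq; rewrite -scalerBr; apply: subspaceZ => //; apply: qrep_pi. Qed.

Lemma qaddA : associative qadd.
Proof.
move=> u v w; have [x ->] := qpi_surj u; have [y ->] := qpi_surj v.
by have [z ->] := qpi_surj w; rewrite !qaddE addrA.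
Qed.
Lemma qaddC : commutative qadd.
Proof.
by move=> u v; have [x ->] := qpi_surj u; have [y ->] := qpi_surj v; rewrite !qaddE addrC.
Qed.
Lemma qadd0 : left_id (qpi 0) qadd.
Proof. by move=> u; have [x ->] := qpi_surj u; rewrite qaddE add0r. Qed.
Lemma qaddN : left_inverse (qpi 0) qopp qadd.
Proof. by move=> u; have [x ->] := qpi_surj u; rewrite qoppE qaddE addNr. Qed.
HB.instance Definition _ := GRing.isZmodule.Build Q qaddA qaddC qadd0 qaddN.

Lemma qscaleA a b (u : Q) : qscale a (qscale b u) = qscale (a * b) u.
Proof. by have [x ->] := qpi_surj u; rewrite !qscaleE scalerA. Qed.
Lemma qscale1 : left_id 1 qscale.
Proof. by move=> u; have [x ->] := qpi_surj u; rewrite qscaleE scale1r. Qed.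
Lemma qscaleDr : right_distributive qscale +%R.
Proof.
move=> a u v; have [x ->] := qpi_surj u; have [y ->] := qpi_surj v.
by rewrite [qpi x + _]qaddE !qscaleE [RHS]qaddE scalerDr.
Qed.
Lemma qscaleDl (u : Q) : {morph qscale^~ u : a b / a + b}.
Proof.
by move=> a b; have [x ->] := qpi_surj u; rewrite !qscaleE [RHS]qaddE scalerDl.
Qed.
HB.instance Definition _ := GRing.Zmodule_isLmodule.Build R Q
  qscaleA qscale1 qscaleDr qscaleDl.

Lemma qpi_lin : linear (qpi : M -> Q).
Proof.
move=> a x y; apply: esym.
exact: etrans (congr1 (fun u => qadd u (qpi y)) (qscaleE a x)) (qaddE _ _).
Qed.

Lemma qpi0 x : qpi x = 0 <-> P x.
Proof. by rewrite -[0]/(qpi 0) qpi_eq subr0. Qed.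

Lemma quotient_factor (N : lmodType R) (f : M -> N) : linear f ->
  (forall x, P x -> f x = 0) ->
  exists g : Q -> N, linear g /\ forall x, g (qpi x) = f x.
Proof.
move=> lf hf; have e x : f (qrep (qpi x)) = f x.
  apply/eqP; rewrite -subr_eq0 -(linN _ lf) -(linD _ _ lf); apply/eqP/hf.
  exact: qrep_pi.
exists (fun u => f (qrep u)); split=> // a u v.
have [x ->] := qpi_surj u; have [y ->] := qpi_surj v.
by rewrite -qpi_lin !e lf.
Qed.
End Quotient.

(** * Homogeneous components *)

Section Projection.
Variables (R : nzRingType) (V : gmod R).

Lemma gr_component0 (s : seq (int * V)) n : homogeneous s ->
  \sum_(p <- s) p.2 = 0 -> \sum_(p <- s | p.1 == n) p.2 = 0.
Proof.
move=> hs s0; pose c d := \sum_(p <- s | p.1 == d) p.2.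
have hc d : gr V d (c d).
  rewrite /c big_seq_cond; elim/big_ind: _ => [|x y|p].
  - exact: gr0.
  - exact: grD.
  - by move=> /andP[ps /eqP <-]; apply: hs.
have sc : \sum_(d <- undup (map fst s)) c d = 0.
  apply: etrans s0; rewrite /c (exchange_big_dep predT) //= [LHS]big_seq [RHS]big_seq.
  apply: eq_bigr => p ps; rewrite -big_filter.
  have -> : [seq d <- undup (map fst s) | p.1 == d] = [:: p.1].
    apply: perm_small_eq => //; apply: uniq_perm => //.
      by rewrite filter_uniq // undup_uniq.
    move=> d; rewrite mem_filter mem_undup inE eq_sym.
    by apply: andb_idr => /eqP ->; apply: map_f.
  by rewrite big_seq1.
have [ns|ns] := boolP (n \in undup (map fst s)).
  exact: (gr_indep (undup_uniq _) hc sc ns).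
rewrite big_seq_cond big1 // => p /andP[ps /eqP e].
by case/negP: ns; rewrite mem_undup -e; apply: map_f.
Qed.

(** Read off from a chosen decomposition; [gprojE] shows that the choice does not matter. *)
Definition gproj (n : int) (x : V) : V :=
  \sum_(p <- sval (cid (gr_span x)) | p.1 == n) p.2.

Lemma gprojE n (s : seq (int * V)) : homogeneous s ->
  gproj n (\sum_(p <- s) p.2) = \sum_(p <- s | p.1 == n) p.2.
Proof.
rewrite /gproj; case: cid => t [ht e] hs /=.
apply/eqP; rewrite -subr_eq0; apply/eqP.
pose s' := [seq (p.1, - p.2) | p <- s].
have := @gr_component0 (t ++ s') n; rewrite !big_cat /= !big_map /=.
rewrite !sumrN; apply; last by rewrite -e subrr.
move=> p; rewrite mem_cat => /orP[/ht //|/mapP[q qs ->]] /=.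
by rewrite -scaleN1r; apply: grZ; apply: hs.
Qed.

Lemma gproj_lin n : linear (gproj n).
Proof.
move=> a x y; have [s [hs ->]] := gr_span x; have [t [ht ->]] := gr_span y.
pose s' := [seq (p.1, a *: p.2) | p <- s].
have e : a *: (\sum_(p <- s) p.2) + \sum_(p <- t) p.2 = \sum_(p <- s' ++ t) p.2.
  by rewrite big_cat big_map scaler_sumr.
have hst : homogeneous (s' ++ t).
  move=> p; rewrite mem_cat => /orP[/mapP[q qs ->]|/ht //] /=.
  by apply: grZ; apply: hs.
by rewrite e !gprojE // big_cat big_map scaler_sumr.
Qed.

Lemma gproj_gr m n x : gr V m x -> gproj n x = if m == n then x else 0.
Proof.
move=> hx; have h : homogeneous [:: (m, x)] by move=> p; rewrite inE => /eqP ->.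
by have := gprojE n h; rewrite big_seq1 /= => ->; rewrite big_cons big_nil /= addr0.
Qed.

Lemma gproj_id n x : gr V n x -> gproj n x = x.
Proof. by move=> /(gproj_gr n); rewrite eqxx. Qed.

Lemma gr_gproj n x : gr V n (gproj n x).
Proof.
rewrite /gproj; case: cid => s [hs _] /=; rewrite big_seq_cond.
elim/big_ind: _ => [|u v|p]; [exact: gr0 | exact: grD |].
by move=> /andP[ps /eqP <-]; apply: hs.
Qed.

Lemma gproj_sum x : exists D : seq int, \sum_(d <- D) gproj d x = x.
Proof.
have [s [hs e]] := gr_span x; exists (undup (map fst s)).
have e2 d : gproj d x = \sum_(p <- s | p.1 == d) p.2 by rewrite e gprojE.
apply: etrans (esym e); under eq_bigr do rewrite e2.
rewrite (exchange_big_dep predT) //= [LHS]big_seq [RHS]big_seq.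
apply: eq_bigr => p ps; rewrite -big_filter.
have -> : [seq d <- undup (map fst s) | p.1 == d] = [:: p.1].
  apply: perm_small_eq => //; apply: uniq_perm => //.
    by rewrite filter_uniq // undup_uniq.
  move=> d; rewrite mem_filter mem_undup inE eq_sym.
  by apply: andb_idr => /eqP ->; apply: map_f.
by rewrite big_seq1.
Qed.

Lemma gproj_ind (P : V -> Prop) x : subspace P -> (forall n, P (gproj n x)) -> P x.
Proof.
by move=> hP h; have [D <-] := gproj_sum x; apply: subspace_sum.
Qed.

Lemma homogeneous_ind (P : V -> Prop) : subspace P ->
  (forall n x, gr V n x -> P x) -> forall x, P x.
Proof.
move=> hP h x; have [s [hs ->]] := gr_span x; rewrite big_seq.
apply: big_rec => [|p y ps hy]; first by case: hP.
by apply: subspaceD => //; apply: (h p.1); apply: hs.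
Qed.
End Projection.

(** * Modules over a finite-dimensional algebra *)

Section Functional.
Variables (K : fieldType) (V : lmodType K) (P : V -> Prop) (s : V).
Hypotheses (hP : subspace P) (Ps : ~ P s).

(** Zorn's lemma runs over arbitrary sets A, adjoined to [P]: the union of the empty chain is empty,
    and adjoining [P] makes it admissible. *)
Let U (A : V -> Prop) x := A x \/ P x.

Lemma maximal_avoiding : exists H : V -> Prop, [/\ subspace H, ~ H s,
  forall x, P x -> H x & forall v, ~ H v -> exists h c, H h /\ s = c *: v + h].
Proof.
have [|A [[hA As] maxA]] :=
  @classical_sets.Zorn_bigcup V (fun A => subspace (U A) /\ ~ U A s).
  move=> F hF tot; split; last first.
    by case=> [[A FA As]|] //; have [_] := hF A FA; apply; left.
  split; first by right; case: hP.
  have key A x a y : F A -> U A x -> U A y ->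
      U (classical_sets.bigcup F id) (a *: x + y).
    move=> FA hx hy; have [[_ hA] _] := hF A FA.
    by case: (hA a x y hx hy) => h; [left; exists A | right].
  move=> a x y [[A FA Ax]|Px] [[B FB By]|Py].
  - have [h|h] := tot A B FA FB; first by apply: (key B) => //; left=> //; apply: h.
    by apply: (key A) => //; left=> //; apply: h.
  - by apply: (key A) => //; [left | right].
  - by apply: (key B) => //; [right | left].
  - by right; case: hP => _; apply.
exists (U A); split=> // [x Px|v Av]; first by right.
apply: contrapT => h.
pose B x := exists c h, U A h /\ x = c *: v + h.
have AB x : U A x -> B x by move=> hx; exists 0, x; rewrite scale0r add0r.
have hB : subspace B.
  split; first by apply: AB; case: hA.
  move=> a _ _ [c [x [hx ->]]] [d [y [hy ->]]].
  exists (a * c + d), (a *: x + y); split; first by case: hA => _; apply.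
  by rewrite scalerDr scalerDl scalerA addrACA.
have UB x : U B x <-> B x.
  by split=> [[//|Px]|]; [apply: AB; right | left].
apply: (maxA B); last first.
  split.
    split; first by apply/UB; case: hB.
    by move=> a x y /UB hx /UB hy; apply/UB; case: hB => _; apply.
  by move=> /UB[c [x [hx e]]]; apply: h; exists x, c.
split; first by move=> x Ax; apply: AB; left.
move=> /(_ v) BA; apply: Av; left; apply: BA.
by exists 1, 0; rewrite scale1r addr0; split=> //; case: hA.
Qed.

(** The maximal subspace H avoiding s is a hyperplane complementary to s, and f reads off the
    coefficient of s modulo H. Zorn is used because this is applied to an injective module before
    its finite dimension is known. *)
Lemma functional_exists : exists f : V -> K^o, [/\ linear f, f s = 1 &
  forall x, P x -> f x = 0].
Proof.
have [H [hH Hs PH max]] := maximal_avoiding.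
have dec v : exists c, H (v - c *: s).
  have [Hv|/max[h [c [Hh es]]]] := pselect (H v); first by exists 0; rewrite scale0r subr0.
  have c0 : c != 0 by apply/eqP => c0; apply: Hs; rewrite es c0 scale0r add0r.
  exists c^-1; rewrite es scalerDr scalerA mulVf // scale1r opprD addrA subrr add0r.
  by apply: subspaceN => //; apply: subspaceZ.
have uniq v c d : H (v - c *: s) -> H (v - d *: s) -> c = d.
  move=> h1 h2; have := subspaceB hH h2 h1.
  rewrite opprB addrC addrA subrK -scalerBl => h3.
  apply/eqP; rewrite -subr_eq0; apply: contrapT => /negP cd; apply: Hs.
  by rewrite -[s]scale1r -(mulVf cd) -scalerA; apply: subspaceZ.
have [f hf] := choice dec; exists f; split.
- move=> a x y; apply: (uniq (a *: x + y)) => //.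
  rewrite scalerDl opprD addrACA -scalerA -scalerBr.
  by case: hH => _; apply.
- by apply: (uniq s) => //; rewrite scale1r subrr; case: hH.
- move=> x /PH Hx; apply: (uniq x) => //; by rewrite scale0r subr0.
Qed.
End Functional.

(** * The dual module of the algebra *)

Section Dual.
Variables (K : fieldType) (L : falgType K).

Definition ldual : Type := 'Hom(L, K^o).
HB.instance Definition _ := GRing.Zmodule.on ldual.

Definition ldual_scale (a : L^c) (f : ldual) : ldual := (f \o amull (a : L))%VF.

Lemma ldual_scaleE a (f : ldual) x : (ldual_scale a f : 'Hom(L, K^o)) x = (f : 'Hom(L, K^o)) ((a : L) * x).
Proof. by rewrite comp_lfunE lfunE. Qed.

Lemma ldual_scaleA a b f : ldual_scale a (ldual_scale b f) = ldual_scale (a * b) f.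
Proof.
apply/lfunP => x; rewrite !ldual_scaleE; congr ((f : 'Hom(L, K^o)) _).
exact: mulrA.
Qed.
Lemma ldual_scale1 : left_id 1 ldual_scale.
Proof. by move=> f; apply/lfunP => x; rewrite ldual_scaleE mul1r. Qed.
Lemma ldual_scaleDr : right_distributive ldual_scale +%R.
Proof.
move=> a f g; apply/lfunP => x; rewrite ldual_scaleE.
by rewrite [LHS]add_lfunE [RHS]add_lfunE !ldual_scaleE.
Qed.
Lemma ldual_scaleDl f : {morph ldual_scale^~ f : a b / a + b}.
Proof.
move=> a b; apply/lfunP => x; rewrite [RHS]add_lfunE !ldual_scaleE.
rewrite -[LHS]/((f : 'Hom(L, K^o)) (((a : L) + (b : L)) * x)).
by rewrite mulrDl linearD.
Qed.
HB.instance Definition _ := GRing.Zmodule_isLmodule.Build L^c ldual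
  ldual_scaleA ldual_scale1 ldual_scaleDr ldual_scaleDl.

Lemma ldual_kscale (c : K) (f : ldual) : kscale c f = (c *: (f : 'Hom(L, K^o))).
Proof.
apply/lfunP => x; rewrite [LHS]ldual_scaleE scale_lfunE.
by rewrite mulr_algl linearZ.
Qed.

Lemma ldual_dim : exists n, dim_le (fun _ : kmod ldual => True) n.
Proof.
exists (\dim {: 'Hom(L, K^o)}), (fun i => tnth (vbasis {: 'Hom(L, K^o)}) i : kmod ldual).
move=> f _; exists (fun i => coord (vbasis {: 'Hom(L, K^o)}) i f).
rewrite {1}(coord_vbasis (memvf (f : 'Hom(L, K^o)))).
have h (I : Type) (s : seq I) (F : I -> ldual) :
    (\sum_(i <- s) (F i : 'Hom(L, K^o))) = (\sum_(i <- s) (F i : kmod ldual)).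
  by elim: s => [|i s IH]; rewrite ?big_nil ?big_cons ?IH.
rewrite h; apply: eq_bigr => i _; rewrite -(tnth_nth 0).
exact: (esym (ldual_kscale _ _)).
Qed.

Section Embed.
Variables (N : lmodType L^c) (f : kmod N -> K^o).
Hypothesis lf : linear f.

Let act (x : N) (l : L) : K^o := f ((l : L^c) *: x).

Lemma act_linear x : linear (act x).
Proof.
move=> c l l'; rewrite /act -lf; congr f.
rewrite -[LHS]/((((c *: l) + l' : L) : L^c) *: x) -[RHS]/(kscale c ((l : L^c) *: x) + (l' : L^c) *: x).
rewrite /kscale scalerA -scalerDl; congr ((_ + _ : L^c) *: x).
exact: (esym (mulr_algr c l)).
Qed.

(** The image of [f] under Hom_K(N, K) = Hom_L(N, DL). *)
Definition to_ldual (x : N) : ldual := linfun (act x).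

Lemma to_ldualE x l : (to_ldual x : 'Hom(L, K^o)) l = f ((l : L^c) *: x).
Proof.
pose A := HB.pack_for {linear L -> K^o} (act x)
  (GRing.isLinear.Build K L K^o *:%R (act x) (act_linear x)).
by rewrite /to_ldual -[act x]/(A : L -> K^o) lfunE.
Qed.

Lemma to_ldual_linear : linear to_ldual.
Proof.
move=> a x y; apply/lfunP => l; rewrite to_ldualE [RHS]add_lfunE ldual_scaleE !to_ldualE.
by rewrite scalerDr (linD _ _ lf) scalerA.
Qed.
End Embed.
End Dual.

(** * Simple submodules and injective hulls *)

Section Modules.
Variables (K : fieldType) (L : falgType K).
Implicit Types A B M N : lmodType L^c.

(** Here [p] need not be injective: f factors through A / ker p, which embeds in B. This is the form
    needed for extending along a differential. *)
Lemma injective_extend N (P : N -> Prop) A B (p : A -> B) (f : A -> N) :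
  injective_module P -> linear p -> linear f -> (forall x, P (f x)) ->
  (forall x, p x = 0 -> f x = 0) ->
  exists g : B -> N, [/\ linear g, forall y, P (g y) & forall x, g (p x) = f x].
Proof.
move=> iN lp lf Pf ker.
have hk : subspace (fun x => p x = 0).
  split; first exact: lin0 lp.
  by move=> a x y hx hy; rewrite lp hx hy scaler0 addr0.
have [p' [lp' p'E]] := quotient_factor hk lp (fun x h => h).
have [f' [lf' f'E]] := quotient_factor hk lf ker.
have ip' : injective p'.
  move=> u v; have [x ->] := qpi_surj u; have [y ->] := qpi_surj v.
  rewrite !p'E => e; apply/qpi_eq.
  by rewrite (linD _ _ lp) (linN _ lp) e subrr.
have [|g [lg Pg gE]] := iN _ _ p' f' lp' ip' lf'.
  by move=> u; have [x ->] := qpi_surj u; rewrite f'E.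
by exists g; split=> // x; rewrite -p'E gE f'E.
Qed.

Definition fin_dimensional M := exists n, dim_le (fun _ : kmod M => True) n.

Lemma kscale_act N (c : K) (l : L) (x : N) :
  (((c *: l) : L) : L^c) *: x = kscale c ((l : L^c) *: x).
Proof.
by rewrite /kscale scalerA; congr (_ *: x); apply: (esym (mulr_algr c l)).
Qed.

Lemma act_suml N (I : Type) (s : seq I) (F : I -> L) (x : N) :
  ((\sum_(i <- s) F i : L) : L^c) *: x = \sum_(i <- s) (((F i) : L^c) *: x).
Proof.
elim: s => [|i s IH]; first by rewrite !big_nil; apply: scale0r.
by rewrite !big_cons -IH; apply: scalerDl.
Qed.

Lemma kmod_sumE N (I : Type) (s : seq I) (F : I -> N) :
  \sum_(i <- s) (F i : kmod N) = \sum_(i <- s) F i.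
Proof. by elim: s => [|i s IH]; rewrite ?big_nil ?big_cons ?IH. Qed.

Lemma cyclic_dim N (x : N) :
  dim_le ((fun v => exists l : L^c, v = l *: x) : kmod N -> Prop) (\dim {: L}).
Proof.
pose b := vbasis {: L}.
exists (fun i => ((tnth b i : L^c) *: x : N)) => _ [l ->].
exists (fun i => coord b i (l : L)).
rewrite {1}(coord_vbasis (memvf (l : L))) kmod_sumE act_suml.
by apply: eq_bigr => i _; rewrite -(tnth_nth 0) kscale_act.
Qed.

Lemma fin_gen_dim N (P : N -> Prop) : fin_gen P -> fin_dim P.
Proof.
move=> [s _ hs]; apply/fin_dimP.
suff [n [b hb]] : exists n, dim_le ((fun v => exists c : 'I_(size s) -> L^c,
    v = \sum_i c i *: s`_i) : kmod N -> Prop) n.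
  by exists n, b => v /hs; apply: hb.
elim: s {hs} => [|x s [n [b hb]]].
  by exists 0%N, (fun=> 0) => _ [c ->]; exists (fun=> 0); rewrite !big_ord0.
have [b' hb'] := dim_le_add (cyclic_dim x) (ex_intro _ b hb).
exists (\dim {: L} + n)%N, b' => v [c ->]; apply: hb'.
exists (c ord0 *: x), (\sum_(i < size s) c (lift ord0 i) *: s`_i); split.
- by exists (c ord0).
- by exists (fun i => c (lift ord0 i)).
- by rewrite big_ord_recl.
Qed.

Lemma fin_dim_gen N (P : N -> Prop) : submodule P -> fin_dim P -> fin_gen P.
Proof.
move=> hP /fin_dimP[n hn].
have [b [hb1 hb2]] := dim_le_basis (submodule_subspace hP) hn.
exists (codom b) => [_ /codomP[i ->] //|x /hb2[c ex]].
have e : size (codom b) = n by rewrite size_codom card_ord.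
exists (fun i => ((c (cast_ord e i))%:A : L)).
rewrite ex kmod_sumE (reindex (cast_ord e)) /=; last first.
  by exists (cast_ord (esym e)) => i _; rewrite (cast_ordK, cast_ordKV).
apply: eq_bigr => i _; rewrite /codom /image_mem (nth_map (cast_ord e i)); last first.
  by rewrite size_enum_ord -[X in (_ < X)%N]e.
by rewrite (nth_ord_enum _ (cast_ord e i)).
Qed.

(* A submodule of xL of minimal dimension is simple. *)
Lemma simple_submodule N (x : N) : x != 0 ->
  exists (M : lmodType L^c) (f : M -> N), [/\ simple_module M, linear f, injective f
    & forall s, exists l : L^c, f s = l *: x].
Proof.
move=> x0; pose cyc (P : N -> Prop) := forall v, P v -> exists l : L^c, v = l *: x.
pose small n := `[< exists P : N -> Prop, [/\ submodule P, cyc P,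
  exists2 v, P v & v != 0 & dim_le (P : kmod N -> Prop) n] >].
have ex : exists n, small n.
  exists (\dim {: L}); apply/asboolP; exists (fun v => exists l : L^c, v = l *: x).
  split=> //; [split| |exact: cyclic_dim].
  - by exists 0; rewrite scale0r.
  - by move=> a _ _ [l ->] [l' ->]; exists (a * l + l'); rewrite scalerDl scalerA.
  - by exists x => //; exists 1; rewrite scale1r.
case: (ex_minnP ex) => n /asboolP[P [sP cP [y Py y0] dP]] min.
have minP Q : submodule Q -> (forall v, Q v -> P v) ->
    (exists2 v, Q v & v != 0) -> forall v, P v -> Q v.
  move=> sQ QP Q0; apply: contrapT => /existsNP[v /not_implyP[Pv nQv]].
  have [|k ek dk] := dim_le_proper (submodule_subspace sQ) QP dP.
    by exists v.
  suff /min : small k by rewrite ek ltnn.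
  by apply/asboolP; exists Q; split=> // u /QP/cP.
(* The minimal submodule P is only a predicate, so the simple module is built as L / ann(y) for a
   nonzero y in P; minimality gives y L = P. *)
have hk : subspace (fun l : L^c^o => (l : L^c) *: y = 0).
  split; first exact: scale0r.
  by move=> a l l' h h'; rewrite scalerDl -scalerA h h' scaler0 addr0.
have lm : linear (fun l : L^c^o => (l : L^c) *: y).
  by move=> a l l'; rewrite scalerDl -scalerA.
have [f [lf fE]] := quotient_factor hk lm (fun l h => h).
have fP u : P (f u).
  have [l ->] := qpi_surj u; rewrite fE; case: sP => h0 h.
  by rewrite -[_ *: _]addr0; apply: h.
have fi : injective f.
  move=> u v; have [l ->] := qpi_surj u; have [l' ->] := qpi_surj v.
  rewrite !fE => e; apply/qpi_eq; rewrite scalerBl -[LHS]/((l : L^c) *: y - (l' : L^c) *: y).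
  by rewrite e subrr.
exists (quotient hk : lmodType L^c), f; split=> //; last by move=> u; apply: cP.
have f1 : f (qpi hk (1 : L^c)) = y by rewrite fE scale1r.
split.
  by exists (qpi hk (1 : L^c)); apply: contra_neq y0 => e; rewrite -f1 e (lin0 lf).
move=> Q sQ; have [h|h] := pselect (zero_sub Q); [by left | right].
have /existsNP[u /not_implyP[Qu u0]] := h.
have hQ : forall v, P v -> exists2 u, Q u & v = f u.
  apply: (minP (fun v => exists2 u, Q u & v = f u)).
  - split; first by exists 0; [case: sQ | rewrite (lin0 lf)].
    move=> a _ _ [u1 h1 ->] [u2 h2 ->]; exists (a *: u1 + u2); last by rewrite lf.
    by case: sQ => _; apply.
  - by move=> _ [u1 _ ->].
  - exists (f u); first by exists u.
    by apply/eqP => e; apply: u0; apply: fi; rewrite e (lin0 lf).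
by move=> v; have [u1 Qu1 /fi ->] := hQ (f v) (fP v).
Qed.

(** A functional that is nonzero on S gives h : I -> DL, injective on S by simplicity, and
    injectivity of I gives g : DL -> I with g h = id on S. Fitting's lemma for u = h g on the
    finite-dimensional DL splits I into ker(u^k h) and im(g u^k). The second contains S, so by
    indecomposability the first is zero and I embeds in DL. *)
Lemma injective_hull_fin_dim S I : simple_module S -> injective_of_simple S I ->
  fin_dimensional I.
Proof.
move=> [[s s0] simS] [injI indI [i li ii]].
have is0 : i s <> 0 by move=> e; case/eqP: s0; apply: ii; rewrite e (lin0 li).
have [|f [lf fs _]] := @functional_exists K (kmod I) (fun x => x = 0) (i s) _ is0.
  by split=> // a x y -> ->; rewrite scaler0 addr0.
pose h := to_ldual f; have lh : linear h := to_ldual_linear lf.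
have his : h (i s) != 0.
  apply/eqP => /(congr1 (fun g : 'Hom(L, K^o) => g 1)).
  rewrite to_ldualE // scale1r fs zero_lfunE; exact/eqP/oner_neq0.
have ihi : injective (fun x => h (i x)).
  have sk : submodule (fun x => h (i x) = 0).
    split; first by rewrite (lin0 li) (lin0 lh).
    by move=> a x y hx hy; rewrite li lh hx hy scaler0 addr0.
  have [z|z] := simS _ sk; last by case/eqP: his; apply: z.
  move=> x y e; apply/eqP; rewrite -subr_eq0; apply/eqP/z.
  by rewrite (linD _ _ li) (linN _ li) (linD _ _ lh) (linN _ lh) e subrr.
have [||g [lg _ ghi]] := injI S (ldual L : lmodType L^c) (fun x => h (i x)) i _ ihi li => //.
  by move=> a x y; rewrite li lh.
pose u (e : ldual L) : ldual L := h (g e).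
have lu : linear u by move=> a x y; rewrite /u lg lh.
have lku : linear (u : kmod (ldual L) -> kmod (ldual L)) := kmod_linear lu.
have [n hn] := @ldual_dim K L.
have [k [ker img]] := fitting lku hn.
have lit m : linear (iter m u) := iter_linear m lu.
have ui m : iter m u (h (i s)) = h (i s).
  by elim: m => [|m IH] //; rewrite iterS IH /u ghi.
have [_ indec] := indI.
have [||||P0|Q0] := indec (fun x => iter k u (h x) = 0)
  (fun x => exists e, x = g (iter k u e)).
- split; first by rewrite (lin0 lh) (lin0 (lit k)).
  by move=> a x y hx hy; rewrite lh (lit k) hx hy scaler0 addr0.
- split; first by exists 0; rewrite (lin0 (lit k)) (lin0 lg).
  by move=> a _ _ [x ->] [y ->]; exists (a *: x + y); rewrite (lit k) lg.
- move=> x hx [e ex]; rewrite ex in hx *.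
  have : iter k.+1 u (iter k u e) = 0 by rewrite iterSr.
  by move/(ker k.+1 e) => ->; rewrite (lin0 lg).
- move=> x; have [e ee] := img k.+1 (h x).
  exists (x - g (iter k u e)), (g (iter k u e)); split; last by rewrite subrK.
    rewrite (linD _ _ lh) (linN _ lh) (linD _ _ (lit k)) (linN _ (lit k)).
    by rewrite -[h (g _)]/(u _) -iterSr -iterD ee subrr.
  by exists e.
- exists n; apply: (dim_le_inj (f := (fun x => iter k u (h x)) : kmod I -> kmod (ldual L))) hn _ => //.
    by apply: (kmod_linear (f := fun x => iter k u (h x))) => a x y; rewrite lh (lit k).
  move=> x y e; apply/eqP; rewrite -subr_eq0; apply/eqP/P0.
  by rewrite (linD _ _ lh) (linN _ lh) (linD _ _ (lit k)) (linN _ (lit k)) e subrr.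
- by case: is0; apply: Q0; exists (h (i s)); rewrite ui ghi.
Qed.

End Modules.

(** * Bounded complexes of injectives *)

Section GradedMaps.
Variables (R : nzRingType) (V W : gmod R) (f : V -> W) (m : int).
Hypotheses (lf : linear f) (df : forall n x, gr V n x -> gr W (n + m) (f x)).

Lemma gproj_morph n x : gproj (n + m) (f x) = f (gproj n x).
Proof.
apply: (homogeneous_ind (P := fun x => gproj (n + m) (f x) = f (gproj n x))).
  split; first by rewrite (lin0 lf) !(lin0 (gproj_lin _)) (lin0 lf).
  by move=> a u v hu hv; rewrite lf !gproj_lin lf hu hv.
move=> d v hv; rewrite (gproj_gr _ hv) (gproj_gr _ (df hv)).
by rewrite (inj_eq (addIr m)); case: eqP => // _; rewrite (lin0 lf).
Qed.
End GradedMaps.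

(** * K-injective complexes *)

Section KInjective.
Variables (K : fieldType) (L : falgType K).
Implicit Types A C J M N : complex L.

Lemma gproj_d M n x : gproj (n + 1) (cx_d M x) = cx_d M (gproj n x).
Proof. by apply: gproj_morph; [apply: cx_d_lin | apply: cx_d_deg]. Qed.

Lemma gproj_cm M N (f : chain_map M N) n x : gproj n (f x) = f (gproj n x).
Proof.
rewrite -[n in LHS]addr0; apply: gproj_morph; first exact: cm_lin.
by move=> k y hy; rewrite addr0; apply: cm_deg.
Qed.

Lemma acyclic_gr M n x : acyclic M -> gr M n x -> cx_d M x = 0 ->
  exists2 y, gr M (n - 1) y & x = cx_d M y.
Proof.
move=> aM hx /aM[y e]; exists (gproj (n - 1) y); first exact: gr_gproj.
by rewrite -gproj_d subrK -e gproj_id.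
Qed.

Definition k_injective J := forall A, acyclic A ->
  forall f : chain_map A J, null_homotopic f.

Definition bounded M := exists N : int, forall n x, N < `|n| -> gr M n x -> x = 0.

(** The homotopy is built upwards in the degree. If it is correct below degree k, the error f' kills
    boundaries coming from degree k - 1, hence all cycles in degree k, since A is acyclic;
    injectivity of J_k then extends f' along the differential to degree k + 1. *)
Lemma bounded_k_injective J : bounded J -> (forall n, injective_module (gr J n)) ->
  k_injective J.
Proof.
move=> [N hN] injJ A aA f.
pose good k (h : A -> J) := [/\ linear h, forall n x, gr A n x -> gr J (n - 1) (h x)
  & forall m x, m < k -> gr A m x -> f x = cx_d J (h x) + h (cx_d A x)].
have step k h : good k h -> exists h', good (k + 1) h'.
  move=> [lh dh eh]; pose f' x := f x - cx_d J (h x) - h (cx_d A x).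
  have lf' : linear f'.
    exact: (linear_addf (linear_addf (cm_lin f) (linear_oppf (linear_compf (@cx_d_lin _ _ J) lh)))
      (linear_oppf (linear_compf lh (@cx_d_lin _ _ A)))).
  have df' n x : gr A n x -> gr J n (f' x).
    move=> hx; apply: grB; first apply: grB.
    - exact: (cm_deg f).
    - by have := cx_d_deg (dh _ _ hx); rewrite subrK.
    - by have := dh _ _ (cx_d_deg hx); rewrite addrK.
  have cf' x : f' (cx_d A x) = cx_d J (f' x).
    by rewrite /f' !cx_dB !cx_dd cm_comm (lin0 lh) !subr0.
  have f'0 m x : m < k -> gr A m x -> f' x = 0.
    by move=> mk hx; rewrite /f' (eh m) // -addrA -opprD subrr.
  have [|||g [lg Pg gE]] := @injective_extend _ _ J (gr J k) A A (cx_d A)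
      (fun x => f' (gproj k x)) (injJ k) (@cx_d_lin _ _ A).
  - exact: (linear_compf lf' (gproj_lin k)).
  - by move=> x; apply: df'; apply: gr_gproj.
  - move=> x dx; have [||y hy ->] := @acyclic_gr A k (gproj k x) aA.
    + exact: gr_gproj.
    + by rewrite -gproj_d dx (lin0 (gproj_lin _)).
    + by rewrite cf' (f'0 (k - 1) y) ?cx_d0 //; lia.
  exists (fun x => h x + g (gproj (k + 1) x)); split.
  - exact: (linear_addf lh (linear_compf lg (gproj_lin _))).
  - move=> n x hx; apply: grD; first exact: dh.
    rewrite (gproj_gr _ hx); case: eqP => [->|_]; first by rewrite addrK.
    by rewrite (lin0 lg); apply: gr0.
  move=> m x mk hx.
  have e0 : gproj (k + 1) x = 0.
    by rewrite (gproj_gr _ hx); case: eqP => // e; lia.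
  rewrite e0 (lin0 lg) addr0 addrA.
  have [mk'|mk'] := ltP m k.
    rewrite gproj_d (gproj_gr _ hx) ifF; last by apply/eqP; lia.
    by rewrite cx_d0 (lin0 lg) addr0; apply: eh mk' hx.
  have em : m = k by lia.
  subst m; rewrite gproj_d gE (gproj_id hx) [gproj k x]gproj_id // /f'.
  by rewrite -[f x - _ - _]addrA -opprD [RHS]addrC subrK.
(* J is zero in degrees below -N, where the construction starts, and in all degrees from -N + 2|N| +
   1 on; the absolute value allows for a negative N. *)
have [h hh] : exists h, good (- N + (`|N|%N + `|N|%N).+1%:Z) h.
  elim: (`|N|%N + `|N|%N).+1 => [|k [h hh]]; last first.
    by have [h' hh'] := step _ _ hh; exists h'; rewrite -addn1 PoszD addrA.
  exists (fun=> 0); split; first exact: zero_linear.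
    by move=> n x _; apply: gr0.
  move=> m x hm hx; rewrite cx_d0 addr0; apply: (hN m); first lia.
  exact: (cm_deg f).
case: hh => lh dh eh; exists h; split=> // x.
apply: (homogeneous_ind (P := fun x => f x = cx_d J (h x) + h (cx_d A x))).
  split; first by rewrite cm0 (lin0 lh) !cx_d0 (lin0 lh) addr0.
  move=> a u v hu hv; rewrite (cm_lin f) hu hv lh !(@cx_d_lin _ _ _) lh.
  by rewrite scalerDr addrACA.
move=> n y hy; have [hn|hn] := ltP n (- N + (`|N|%N + `|N|%N).+1%:Z).
  exact: eh hn hy.
have zero z : gr J n z -> z = 0 by apply: hN; lia.
rewrite (zero (f y)) 1?(zero (_ + _)) //; last exact: (cm_deg f).
apply: grD; first by have := cx_d_deg (dh _ _ hy); rewrite subrK.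
by have := dh _ _ (cx_d_deg hy); rewrite addrK.
Qed.

Variable D : derived (complexes L).
Local Notation loc f := (@loc K (complexes L) D _ _ f).

(** The homotopy fibre E of [s] is acyclic, so E -> J is null-homotopic. The component of the
    homotopy on W is the retraction [r]; the one on J is, up to sign, a homotopy from r s to the
    identity. *)
Lemma k_injective_retract J W (s : chain_map J W) : k_injective J -> cm_qis s ->
  exists r : chain_map W J, homotopic (fun x => r (s x)) id.
Proof.
move=> kJ hs; pose E := pullback s (cm_zero (zero_complex L) W).
have aE : acyclic E.
  apply/acyclic_qis0; apply: qis_homotopic (pb_snd_qis _ hs).
  by apply: homotopic_eq => x; rewrite [LHS]zero_complexE [RHS]zero_complexE.
have [H [lH dH eH]] := kJ E aE (pb_fst _ _).
pose r (q : W) : J := H ((0, 0), q).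
have lr : linear r.
  move=> a x y; rewrite /r -lH; congr H; congr (_, _, _) => /=;
    by rewrite scaler0 addr0.
have dr n q : gr W n q -> gr J n (r q).
  move=> hq; have := dH (n + 1) ((0, 0), q); rewrite addrK; apply.
  by split; [split; apply: gr0 | rewrite /= addrK].
have cr q : r (cx_d W q) = cx_d J (r q).
  have := eH ((0, 0), q) => /= /esym/eqP; rewrite addr_eq0 => /eqP ->.
  rewrite -(linN _ lH); congr H; congr (_, _, _) => /=.
  - by rewrite ?cx_d0 oppr0.
  - by rewrite ?cx_d0 oppr0.
  - by rewrite cm0 subr0 sub0r opprK.
exists (ChainMap lr dr cr); exists (fun n : J => - H ((n, 0), 0)); split.
- move=> a x y; rewrite scalerN -opprD -lH; congr (- H _); congr (_, _, _) => /=.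
    by rewrite scaler0 addr0.
  by rewrite scaler0 addr0.
- by move=> n x hx; apply: grN; apply: dH; split; [split=> //; apply: gr0 | apply: gr0].
- move=> x; have e := eH ((x, 0), 0).
  have eb : H (cx_d E ((x, 0), 0)) = H ((cx_d J x, 0), 0) + r (s x).
    rewrite -(linD _ _ lH); congr H; congr (_, _, _);
      by rewrite /= ?cx_d0 ?subr0 ?addr0 ?add0r ?cm0 ?subr0.
  rewrite -[X in _ - X = _]/(pb_fst s (cm_zero (zero_complex L) W) ((x, 0), 0)).
  by rewrite e eb cx_dN [X in _ - (X + _)]/= addrA opprD addrCA subrr addr0 opprD.
Qed.

(** In a left fraction s^-1 g the denominator s starts at J, so a retraction of s replaces its
    inverse. *)
Lemma k_injective_realize J X (phi : dhom D X J) : k_injective J ->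
  exists f : chain_map X J, phi = loc f.
Proof.
move=> kJ; have [W [s [s' [g [hs is' ->]]]]] := left_fraction phi.
have [r hr] := k_injective_retract kJ hs.
have e : dcomp (loc r) (loc s) = did D J.
  rewrite -loc_cm_comp -(loc_id D (J : obj (complexes L))).
  exact: (@homotopic_loc _ _ D _ _ (cm_comp r s) (cm_id J) hr).
exists (cm_comp r g); rewrite loc_cm_comp; congr dcomp.
by rewrite -[s']dcomp_idl -e -dcompA is'.2 dcomp_idr.
Qed.

Lemma k_injective_faithful J X (f : chain_map X J) : k_injective J ->
  loc f = 0 -> null_homotopic f.
Proof.
move=> kJ /loc0_killed[V [a [ha hfa]]].
have [k hk] := @cone_extend _ _ _ _ _ a f hfa.
have := kJ _ (qis_acyclic_cone ha) k.
rewrite -hk => h.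
exact: null_homotopic_comp (cm_id J) (cx_cone_in a) h.
Qed.

Lemma zero_object_acyclic M : zero_object D M -> acyclic M.
Proof.
move=> z; have [|V [a [[ai as_] [h [lh dh eh]]]]] := @loc0_killed _ _ D M M (cm_id M).
  by rewrite (loc_id D (M : obj (complexes L))).
move=> x /as_[v [y [ev ->]]]; exists (h v + y).
by rewrite cx_dD; congr (_ + _); have /= := eh v; rewrite ev (lin0 lh) addr0.
Qed.

Lemma acyclic_cone_qis M N (f : chain_map M N) : acyclic (cx_cone f) -> cm_qis f.
Proof.
move=> aC; split.
  move=> x dx [y e]; have [|[n m] [/= e1 e2]] := aC (- y, x).
    by congr pair => /=; rewrite ?cx_dN ?e ?addNr ?dx ?oppr0.
  by exists (- m); rewrite cx_dN e2.
move=> y dy; have [|[n m] [/= e1 e2]] := aC (y, 0).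
  by congr pair => /=; rewrite ?dy ?cm0 ?addr0 ?cx_d0 ?oppr0.
exists m, n; split; last by rewrite e1 addrC.
by apply/eqP; rewrite -oppr_eq0 -e2.
Qed.

(** In the derived category the maps into and out of the cone vanish, hence so does the identity of
    the cone, which is therefore acyclic. *)
Lemma diso_qis M N (f : chain_map M N) : diso (loc f) -> cm_qis f.
Proof.
move=> i; apply: acyclic_cone_qis; apply: zero_object_acyclic.
have h := cone_distinguished D f.
have v0 : loc (cx_cone_in f) = 0.
  by apply: (diso_epic i); rewrite comp0l; apply: triangle_comp0 h.
have w0 : loc (cx_cone_out f) = 0.
  by apply: (diso_monic (diso_shift 1 i)); rewrite comp0r; apply: (triangle_comp0'' h).
have [|g] := triangle_exact_cov (triangle_rotate h) (f := did D (cx_cone f : obj (complexes L))).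
  by rewrite w0 comp0l.
by rewrite v0 comp0l.
Qed.

Lemma bijective_qis M N (f : chain_map M N) : bijective f -> cm_qis f.
Proof.
move=> [g gf fg]; have fi := can_inj gf; split.
  move=> x _ [y e]; exists (g y); apply: fi; by rewrite e cm_comm fg.
move=> y dy; exists (g y), 0; rewrite fg cx_d0 addr0; split=> //.
by apply: fi; rewrite cm_comm fg dy cm0.
Qed.

Section ConeMaps.
Variables (M N N' : complex L) (f : chain_map M N).

Section Left.
Variables (b : chain_map N N').
Let e (z : cx_cone f) : cx_cone (cm_comp b f) := (b z.1, z.2).

Lemma cone_post_lin : linear e.
Proof. by move=> c [y x] [y' x']; congr pair; rewrite /= (cm_lin b). Qed.
Lemma cone_post_deg n z : gr (cx_cone f) n z -> gr (cx_cone (cm_comp b f)) n (e z).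
Proof. by move=> [h1 h2]; split=> //; apply: (cm_deg b). Qed.
Lemma cone_post_comm z : e (cx_d (cx_cone f) z) = cx_d (cx_cone (cm_comp b f)) (e z).
Proof. by congr pair; rewrite /= cmD cm_comm. Qed.
Definition cone_post : chain_map (cx_cone f) (cx_cone (cm_comp b f)) :=
  ChainMap cone_post_lin cone_post_deg cone_post_comm.

Lemma cone_post_qis : cm_qis b -> cm_qis cone_post.
Proof.
move=> [bi bs]; split.
  move=> [y x] [/= e1 /eqP]; rewrite oppr_eq0 => /eqP e2 [[y' x'] [/= e3 e4]].
  have [||y1 ey1] := bi (y + f (- x')).
  - by rewrite cx_dD -cm_comm cx_dN -e4.
  - by exists y'; rewrite cmD e3 cmN cmN addrK.
  exists (y1, x'); congr pair => //=.
  by rewrite -ey1 cmN subrK.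
move=> [y x] [/= e1 /eqP]; rewrite oppr_eq0 => /eqP e2.
have [||]// := bi (f x).
- by rewrite -cm_comm e2 cm0.
- by exists (- y); rewrite cx_dN; apply/eqP; rewrite -addr_eq0 addrC e1.
move=> n en; have [|y1 [z [ey1 ez]]] := bs (y + b n).
  by rewrite cx_dD -cm_comm -en.
exists (y1 - n, x), (z, 0); split; congr pair => /=.
- by rewrite cx_dB ey1 sub0r -en addNr.
- by rewrite e2 oppr0.
- by rewrite cmB !cm0 addr0 addrAC -ez addrK.
- by rewrite cx_d0 oppr0 addr0.
Qed.
End Left.

Section Homotopic.
Variables (f' : chain_map M N) (h : M -> N).
Hypotheses (lh : linear h) (dh : forall n x, gr M n x -> gr N (n - 1) (h x)).
Hypothesis eh : forall x, f x - f' x = cx_d N (h x) + h (cx_d M x).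
Let e (z : cx_cone f) : cx_cone f' := (z.1 + h z.2, z.2).

Lemma cone_homotopy_lin : linear e.
Proof. by move=> c [y x] [y' x']; congr pair; rewrite /= lh scalerDr addrACA. Qed.
Lemma cone_homotopy_deg n z : gr (cx_cone f) n z -> gr (cx_cone f') n (e z).
Proof.
by move=> [h1 h2]; split=> //; apply: grD => //; have := dh h2; rewrite addrK.
Qed.
Lemma cone_homotopy_comm z : e (cx_d (cx_cone f) z) = cx_d (cx_cone f') (e z).
Proof.
congr pair; rewrite /= cx_dD (linN _ lh) -!addrA; congr (_ + _).
by apply/eqP; rewrite subr_eq -addrA [_ + h _]addrC addrA -subr_eq eh addrC.
Qed.
Definition cone_homotopy : chain_map (cx_cone f) (cx_cone f') :=
  ChainMap cone_homotopy_lin cone_homotopy_deg cone_homotopy_comm.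
Lemma cone_homotopy_qis : cm_qis cone_homotopy.
Proof.
apply: bijective_qis; exists (fun z => (z.1 - h z.2, z.2)) => -[y x];
  by congr pair; rewrite /= ?addrK ?subrK.
Qed.
End Homotopic.
End ConeMaps.

(** With K-injective targets the square is realized by chain maps commuting up to homotopy. The
    comparison of cones is composed of three quasi-isomorphisms: one for b, one for the homotopy,
    one for a. *)
Lemma cone_isomorphic M N (f : chain_map M N) M' N' (f' : chain_map M' N') :
  k_injective M' -> k_injective N' ->
  forall (a : dhom D M M') (b : dhom D N N'), diso a -> diso b ->
  dcomp b (loc f) = dcomp (loc f') a ->
  isomorphic D (cx_cone f : obj (complexes L)) (cx_cone f').
Proof.
move=> kM kN a b ia ib.
have [a0 ea] := k_injective_realize a kM; have [b0 eb] := k_injective_realize b kN.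
subst a b; move=> e.
have [|h [lh dh eh]] := @k_injective_faithful _ _ (cm_lincomb (-1) (cm_comp f' a0) (cm_comp b0 f)) kN.
  rewrite (loc_lin D (-1) (_ : Defs.hom (_ : obj (complexes L)) _)).
  by rewrite -/(loc _) -/(loc _) !loc_cm_comp e scaleN1r addNr.
have eh' x : cm_comp b0 f x - cm_comp f' a0 x = cx_d N' (h x) + h (cx_d M x).
  by rewrite -eh /= kscaleN1 addrC.
exists (loc (cm_comp (cone_map f' a0) (cm_comp (cone_homotopy lh dh eh') (cone_post f b0)))).
apply: loc_cm_qis; apply: qis_comp; first exact: cone_map_qis (diso_qis ia).
by apply: qis_comp; [apply: cone_homotopy_qis | apply: cone_post_qis (diso_qis ib)].
Qed.
End KInjective.

(** * Splitting off the image of an endomorphism *)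

Section ImageComplex.
Variables (K : fieldType) (L : falgType K) (J : complex L) (v : chain_map J J).

Lemma cm_ker_subspace : subspace (fun x => v x = 0).
Proof.
split; first exact: cm0.
by move=> a x y hx hy; rewrite (cm_lin v) hx hy scaler0 addr0.
Qed.
Local Notation Q := (quotient cm_ker_subspace).
Local Notation pi := (qpi cm_ker_subspace).

Definition im_gr (n : int) (z : Q) := exists2 x, gr J n x & z = pi x.

Lemma im_gr0 d : im_gr d 0.
Proof. by exists 0; [apply: gr0 | rewrite (lin0 (qpi_lin _))]. Qed.
Lemma im_gr_lin d a x y : im_gr d x -> im_gr d y -> im_gr d (a *: x + y).
Proof.
move=> [u hu ->] [w hw ->]; exists (a *: u + w); first exact: gr_lin.
by rewrite (qpi_lin cm_ker_subspace).
Qed.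
Lemma im_gr_span (z : Q) : exists s : seq (int * Q),
  (forall p, p \in s -> im_gr p.1 p.2) /\ z = \sum_(p <- s) p.2.
Proof.
have [x ->] := qpi_surj z; have [s [hs ->]] := gr_span x.
exists [seq (p.1, pi p.2) | p <- s]; split.
  by move=> p /mapP[q qs ->]; exists q.2 => //; apply: hs.
rewrite big_map (big_morph pi (id1 := 0) (op1 := +%R)) //.
by move=> a b; rewrite (linD _ _ (qpi_lin _)).
Qed.
Lemma im_gr_indep (s : seq int) (c : int -> Q) : uniq s ->
  (forall d, im_gr d (c d)) -> \sum_(d <- s) c d = 0 ->
  forall d, d \in s -> c d = 0.
Proof.
move=> us hc hs d ds.
have /choice[x hx] : forall d, exists x, gr J d x /\ c d = pi x.
  by move=> e; have [x ? ?] := hc e; exists x.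
rewrite (hx d).2; apply/qpi0.
apply: (gr_indep (c := fun d => v (x d)) us _ _ ds).
  by move=> e; apply: (cm_deg v); case: (hx e).
have e : pi (\sum_(d <- s) x d) = 0.
  rewrite -hs (big_morph pi (id1 := 0) (op1 := +%R)).
  - by apply: eq_bigr => e _; case: (hx e).
  - by move=> a b; rewrite (linD _ _ (qpi_lin _)).
  - exact: lin0 (qpi_lin _).
move/qpi0: e; rewrite (big_morph v (id1 := 0) (op1 := +%R)) //.
  by move=> a b; rewrite cmD.
exact: cm0.
Qed.
Definition im_gmod : gmod L^c :=
  @GMod L^c (Q : lmodType L^c) im_gr im_gr0 im_gr_lin im_gr_span im_gr_indep.

Lemma im_d_exists : exists g : Q -> Q, linear g /\ forall x, g (pi x) = pi (cx_d J x).
Proof.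
apply: quotient_factor.
  by move=> a x y; rewrite (@cx_d_lin _ _ J) (qpi_lin cm_ker_subspace).
by move=> x hx; apply/qpi0; rewrite cm_comm hx cx_d0.
Qed.
Definition im_d := sval (cid im_d_exists).
Lemma im_d_lin : linear im_d. Proof. by rewrite /im_d; case: cid => ? []. Qed.
Lemma im_dE x : im_d (pi x) = pi (cx_d J x).
Proof. by rewrite /im_d; case: cid => ? []. Qed.
Lemma im_d_deg n (z : im_gmod) : gr im_gmod n z -> gr im_gmod (n + 1) (im_d z).
Proof. by move=> [x hx ->]; exists (cx_d J x); [apply: cx_d_deg | rewrite im_dE]. Qed.
Lemma im_dd z : im_d (im_d z) = 0.
Proof. by have [x ->] := qpi_surj z; rewrite !im_dE cx_dd (lin0 (qpi_lin _)). Qed.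
(** The image of [v], presented as J / ker v because a submodule given by a predicate is not a
    module type; the inclusion into J is induced by v. *)
Definition im_complex : complex L :=
  @Complex _ _ im_gmod im_d im_d_lin im_d_deg im_dd.

Lemma im_proj_deg n x : gr J n x -> gr im_complex n (pi x).
Proof. by exists x. Qed.
Lemma im_proj_comm x : pi (cx_d J x) = cx_d im_complex (pi x).
Proof. by rewrite /= im_dE. Qed.
Definition im_proj : chain_map J im_complex :=
  @ChainMap _ _ J im_complex pi (@qpi_lin _ _ _ cm_ker_subspace) im_proj_deg im_proj_comm.

Lemma im_incl_exists : exists g : Q -> J, linear g /\ forall x, g (pi x) = v x.
Proof. by apply: quotient_factor; [apply: cm_lin |]. Qed.
Definition im_incl_fun : im_complex -> J := sval (cid im_incl_exists).
Lemma im_incl_lin : linear im_incl_fun.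
Proof. by rewrite /im_incl_fun; case: cid => ? []. Qed.
Lemma im_inclE x : im_incl_fun (pi x) = v x.
Proof. by rewrite /im_incl_fun; case: cid => ? []. Qed.
Lemma im_incl_deg n z : gr im_complex n z -> gr J n (im_incl_fun z).
Proof. by move=> [x hx ->]; rewrite im_inclE; apply: (cm_deg v). Qed.
Lemma im_incl_comm z : im_incl_fun (cx_d im_complex z) = cx_d J (im_incl_fun z).
Proof. by have [x ->] := qpi_surj z; rewrite /= im_dE !im_inclE cm_comm. Qed.
Definition im_incl : chain_map im_complex J :=
  ChainMap im_incl_lin im_incl_deg im_incl_comm.

Lemma im_incl_proj : cm_comp im_incl im_proj = v.
Proof. by apply: chain_map_eq => x; apply: im_inclE. Qed.

Hypothesis v_ker : forall x, v (v x) = 0 -> v x = 0.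
Hypothesis v_im : forall x, exists y, v x = v (v y).

(** The composite is the map induced by [v] on J / ker v: [v_ker] makes it injective and [v_im]
    surjective. *)
Lemma im_proj_incl_bij : bijective (cm_comp im_proj im_incl).
Proof.
have e x : cm_comp im_proj im_incl (pi x) = pi (v x) by rewrite /= im_inclE.
have [x' hx'] := choice (fun x => v_im x).
exists (fun z => pi (x' (qrep z))) => z; last first.
  by rewrite e -[RHS]qrepK; apply/qpi_eq; rewrite cmB -hx' subrr.
have [x ->] := qpi_surj z; rewrite e; set w := qrep _.
have /qpi_eq : pi w = pi (v x) by rewrite qrepK.
rewrite cmB => /eqP; rewrite subr_eq0 => /eqP h.
apply/qpi_eq; rewrite cmB; apply/eqP; rewrite subr_eq0; apply/eqP.
apply/eqP; rewrite -subr_eq0 -cmB; apply/eqP; apply: v_ker.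
by rewrite cmB cmB -hx' h subrr.
Qed.

Lemma im_bounded_injective : bounded_injective_complex J ->
  bounded_injective_complex im_complex.
Proof.
move=> [[N hN] fg inj]; split.
- exists N => n _ hn [x hx ->]; rewrite (hN n x) //; exact: lin0 (qpi_lin _).
- move=> n; have [s hs1 hs2] := fg n; exists (map pi s).
    by move=> _ /mapP[x xs ->]; exists x => //; apply: hs1.
  move=> _ [x hx ->]; have [c ->] := hs2 x hx.
  have e : size (map pi s) = size s by rewrite size_map.
  exists (fun i => c (cast_ord e i)); rewrite (reindex (cast_ord e)) /=; last first.
    by exists (cast_ord (esym e)) => i _; rewrite (cast_ordK, cast_ordKV).
  rewrite (big_morph pi (id1 := 0) (op1 := +%R)).
  + apply: eq_bigr => i _; rewrite (nth_map 0); last by case: i => i /= hi; rewrite -e.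
    by rewrite (linZ _ _ (qpi_lin _)).
  + by move=> a b; rewrite (linD _ _ (qpi_lin _)).
  + exact: lin0 (qpi_lin _).
move=> n A B p f lp ip lf hf.
have [||G [lG dG eG]] := inj n A B p (fun x => im_incl (f x)) lp ip.
- exact: linear_compf im_incl_lin lf.
- by move=> x; apply: im_incl_deg.
have [q qK Kq] := im_proj_incl_bij.
have lq : linear q.
  move=> a x y; apply: (can_inj qK); rewrite Kq (cm_lin (cm_comp im_proj im_incl)).
  by rewrite !Kq.
exists (fun y => q (im_proj (G y))); split.
- exact: (linear_compf lq (linear_compf (cm_lin im_proj) lG)).
(* The inverse [q] preserves degrees: the component of degree n of a preimage has the same image. *)
- move=> y; have hG := dG y; set z := q _.
  have [x ex] := qpi_surj z; exists (gproj n x); first exact: gr_gproj.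
  apply: (can_inj qK); rewrite /z Kq /= im_inclE; apply/qpi_eq.
  have : cm_comp im_proj im_incl z = im_proj (G y) by rewrite /z Kq.
  rewrite ex /= im_inclE => /esym/qpi_eq h.
  by rewrite -[G y](gproj_id hG) -gproj_cm -(linN _ (gproj_lin n)) -(linD _ _ (gproj_lin n)) -gproj_cm h (lin0 (gproj_lin n)).
- by move=> x; rewrite eG; apply: qK.
Qed.
End ImageComplex.

(** * The thick subcategory of bounded injective complexes *)

Section BoundedInjective.
Variables (K : fieldType) (L : falgType K) (D : derived (complexes L)).
Implicit Types X Y Z W : obj (complexes L).
Local Notation loc f := (@loc K (complexes L) D _ _ f).

Lemma binj_k_injective (J : complex L) : bounded_injective_complex J -> k_injective J.
Proof. by move=> [h1 _ h2]; apply: bounded_k_injective. Qed.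

Lemma bounded_fin_dim (J : complex L) : bounded J ->
  (forall n, fin_dim (gr J n)) -> fin_dimensional (J : lmodType L^c).
Proof.
move=> [N hN] fd.
have sum (s : seq int) : exists n, dim_le ((fun x : J => exists c : int -> J,
    (forall d, gr J d (c d)) /\ x = \sum_(d <- s) c d) : kmod J -> Prop) n.
  elim: s => [|d s [n [b hb]]].
    by exists 0%N, (fun=> 0) => _ [c [_ ->]]; exists (fun=> 0); rewrite big_nil big_ord0.
  have /fin_dimP[m hm] := fd d; exists (m + n)%N.
  have [b' hb'] := dim_le_add hm (ex_intro _ b hb); exists b' => x [c [hc ->]].
  apply: hb'; exists (c d), (\sum_(e <- s) c e); split=> //.
    by exists c.
  by rewrite big_cons.
pose s := [seq k%:Z - `|N|%N%:Z | k <- iota 0 (`|N|%N + `|N|%N).+1].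
have us : uniq s by rewrite map_inj_uniq ?iota_uniq // => i j /addIr[].
have [n [b hb]] := sum s; exists n, b => x _; apply: hb.
apply: (homogeneous_ind (P := fun x : J => exists c : int -> J,
    (forall d, gr J d (c d)) /\ x = \sum_(d <- s) c d)).
  split; first by exists (fun=> 0); split=> [d|]; [apply: gr0 | rewrite big1].
  move=> a _ _ [c [hc ->]] [d [hd ->]]; exists (fun k => a *: c k + d k); split.
    by move=> k; apply: gr_lin.
  by rewrite scaler_sumr -big_split.
move=> d y hy; have [ds|ds] := boolP (d \in s).
  exists (fun k => if k == d then y else 0); split.
    by move=> k; case: eqP => [->|_] //; apply: gr0.
  rewrite (bigD1_seq d) //= eqxx big1 ?addr0 // => k /negPf ->; by [].
exists (fun=> 0); split=> [k|]; first exact: gr0.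
rewrite big1 //; apply: (hN d) => //; rewrite ltNge; apply: contra ds => hd.
apply/mapP; exists (absz (d + `|N|%N%:Z)); last by lia.
by rewrite mem_iota; lia.
Qed.

Lemma binj_fin_dim (J : complex L) : bounded_injective_complex J ->
  fin_dimensional (J : lmodType L^c).
Proof.
move=> [h1 h2 _]; apply: bounded_fin_dim => // n; exact: fin_gen_dim.
Qed.

Definition binj Z := exists C, bounded_injective_complex C /\ isomorphic D Z C.

Lemma binj_Db Z : binj Z -> Db D Z.
Proof.
move=> [C [[h1 h2 _] h3]]; exists C; split=> // n; exact: fin_gen_dim.
Qed.

Lemma binj_iso X Y : isomorphic D X Y -> binj X -> binj Y.
Proof.
move=> i [C [hC h]]; exists C; split=> //.
exact: isomorphic_trans (isomorphic_sym i) h.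
Qed.

Lemma binj_shift m (C : complex L) : bounded_injective_complex C ->
  bounded_injective_complex (cx_shift m C).
Proof.
move=> [[N hN] h2 h3]; split=> [|n|n]; [|exact: h2|exact: h3].
exists (N + `|m|) => n x hn; apply: hN; lia.
Qed.

Lemma binj_cone (C C' : complex L) (f : chain_map C C') :
  bounded_injective_complex C -> bounded_injective_complex C' ->
  bounded_injective_complex (cx_cone f).
Proof.
move=> [[N hN] g1 i1] [[N' hN'] g2 i2]; split.
- exists (`|N| + `|N'| + 1) => n [y x] hn [/= hy hx].
  have n1 : N' < `|n| by move: hn; clear; lia.
  have n2 : N < `|n + 1| by move: hn; clear; lia.
  by congr pair; [apply: (hN' n) | apply: (hN (n + 1))].
- move=> n; apply: fin_dim_gen.
    by split; [apply: (gr0 (cx_cone f)) | move=> a x y; apply: (gr_lin (g := cx_cone f))].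
  apply/fin_dimP.
  have /fin_dimP[m [b hb]] := fin_gen_dim (g2 n).
  have /fin_dimP[m' [b' hb']] := fin_gen_dim (g1 (n + 1)).
  have d1 : dim_le ((fun z : cx_cone f => gr C' n z.1 /\ z.2 = 0) : kmod (cx_cone f) -> Prop) m.
    exists (fun i => (b i, 0)) => -[y x] [/= hy hx]; have [c ec] := hb y hy; exists c.
    rewrite [x]hx [y]ec.
    by rewrite kmod_sumE pair_sum /=; congr pair; rewrite big1 // => i _; rewrite scaler0.
  have d2 : dim_le ((fun z : cx_cone f => z.1 = 0 /\ gr C (n + 1) z.2) : kmod (cx_cone f) -> Prop) m'.
    exists (fun i => (0, b' i)) => -[y x] [/= hy hx]; have [c ec] := hb' x hx; exists c.
    rewrite [y]hy [x]ec.
    by rewrite kmod_sumE pair_sum /=; congr pair; rewrite big1 // => i _; rewrite scaler0.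
  exists (m + m')%N; have [b0 hb0] := dim_le_add d1 d2; exists b0 => -[y x] [hy hx].
  apply: hb0; exists (y, 0), (0, x); split=> //.
  by congr pair; rewrite /= ?addr0 ?add0r.
- move=> n A B p k lp ip lk hk.
  have [||g1' [lg1 dg1 eg1]] := i2 n A B p (fun x => (k x).1) lp ip.
  + by move=> a x y; rewrite lk.
  + by move=> x; case: (hk x).
  have [||g2' [lg2 dg2 eg2]] := i1 (n + 1) A B p (fun x => (k x).2) lp ip.
  + by move=> a x y; rewrite lk.
  + by move=> x; case: (hk x).
  exists (fun y => (g1' y, g2' y)); split.
  + exact: (pair_linear lg1 lg2).
  + by move=> y; split; [apply: dg1 | apply: dg2].
  + by move=> x; rewrite eg1 eg2; case: (k x).
Qed.

Lemma binj_zero : bounded_injective_complex (zero_complex L).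
Proof.
split.
- by exists 0 => n x _ _; apply: zero_complexE.
- move=> n; exists [::] => [x|x _]; first by rewrite in_nil.
  by exists (fun=> 0); rewrite big_ord0; apply: zero_complexE.
- move=> n A B p f _ _ _ _; exists (fun=> 0); split.
  + exact: zero_linear.
  + by move=> y; apply: (gr0 (zero_complex L)).
  + by move=> x; rewrite [RHS]zero_complexE.
Qed.

(** The idempotent i p is realized by a chain map u that is idempotent only up to homotopy. A
    suitable power v of u still represents it, and by Fitting's lemma satisfies the conditions for
    its image to be a summand of J. *)
Lemma binj_retract Z (J : complex L) (i : dhom D Z J) (p : dhom D J Z) :
  bounded_injective_complex J -> dcomp p i = did D Z -> binj Z.
Proof.
move=> hJ pi; pose E := dcomp i p.
have EE : dcomp E E = E by rewrite /E dcompA -[dcomp (dcomp i p) i]dcompA pi dcomp_idr.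
have [u eu] := k_injective_realize E (binj_k_injective hJ).
have [n hn] := binj_fin_dim hJ.
have [k [ker img]] := fitting (kmod_linear (cm_lin u)) hn.
pose fix pw m : chain_map J J := if m is m'.+1 then cm_comp u (pw m') else cm_id J.
have pwE m x : pw m x = iter m u x by elim: m => [|m IH] //=; rewrite IH.
(* The exponent is k + 1 because for k = 0 the power u^0 = id would not represent [E]. *)
pose v := pw k.+1.
have lv : loc v = E.
  rewrite /v; elim: k {ker img v} => [|k IH]; first by rewrite /= cm_idr.
  by rewrite [pw k.+2]/(cm_comp u (pw k.+1)) loc_cm_comp IH -eu.
have vker x : v (v x) = 0 -> v x = 0.
  rewrite /v !pwE [iter k.+1 u x]iterS -iterSr => /(ker k.+2 x).
  by move=> ->; apply: cm0.
have vim x : exists y, v x = v (v y).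
  have [y e] := img k.+1 x; exists y.
  by rewrite /v !pwE iterS e -iterS -iterD -addnS.
pose J1 := im_complex v.
have hJ1 := im_bounded_injective vker vim hJ.
exists J1; split=> //.
pose q := loc (im_proj v); pose j := loc (im_incl v).
have jq : dcomp j q = E by rewrite -loc_cm_comp im_incl_proj.
have iA : diso (dcomp q j).
  rewrite -loc_cm_comp; apply: loc_cm_qis; apply: bijective_qis.
  exact: im_proj_incl_bij.
have A1 : dcomp q j = did D (J1 : obj (complexes L)).
  (* As j q = E is idempotent, a = q j satisfies a^3 = a^2, and a is invertible, so a = id. *)
  have e3 : dcomp (dcomp q j) (dcomp (dcomp q j) (dcomp q j)) =
      dcomp (dcomp q j) (dcomp q j).
    by rewrite -!dcompA ![dcomp j (dcomp q _)]dcompA jq [dcomp E (dcomp E _)]dcompA EE.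
  apply: (diso_monic iA); rewrite dcomp_idr; exact: (diso_monic iA).
exists (dcomp q i), (dcomp p j); split.
  rewrite -dcompA [dcomp j _]dcompA jq /E dcompA [dcomp p _]dcompA pi dcomp_idl.
  by rewrite pi.
rewrite -dcompA [dcomp i _]dcompA -/E -jq dcompA [dcomp q _]dcompA A1 dcomp_idl.
exact: A1.
Qed.

Lemma binj_thick : thick_subcategory D binj.
Proof.
split.
- move=> X zX; exists (zero_complex L); split; first exact: binj_zero.
  exists 0; exists 0; split; rewrite comp0l; first by rewrite zX.
  apply: esym; apply: acyclic_zero_object => x _.
  by exists 0; rewrite cx_d0 [x]zero_complexE.
- move=> X; split=> [[C [hC h]]|[C [hC h]]].
    apply: (@binj_iso (shift (-1) (shift 1 X))).
      apply: isomorphic_trans (shift_add_isomorphic D 1 (-1) X) _.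
      by rewrite subrr; apply: shift_zero_isomorphic.
    exists (cx_shift (-1) C); split; first exact: binj_shift.
    exact: (isomorphic_shift (-1) h).
  exists (cx_shift 1 C); split; first exact: binj_shift.
  exact: (isomorphic_shift 1 h).
- move=> X Y Z u v w [M [N [f [a [b [c [[ia ib ic] _]]]]]]] [C [hC iC]] [C' [hC' iC']].
  have [a1 ia1] : isomorphic D M C.
    by apply: isomorphic_trans iC; apply: isomorphic_sym; exists a.
  have [b1 ib1] : isomorphic D N C'.
    by apply: isomorphic_trans iC'; apply: isomorphic_sym; exists b.
  have [a1' [ha1 ha2]] := ia1.
  have kC := binj_k_injective hC; have kC' := binj_k_injective hC'.
  (* Transported to the injective models C and C', the morphism f is represented by a chain map g,
     whose cone is again a bounded complex of injectives. *)
  have [g eg] := k_injective_realize (dcomp (dcomp b1 (loc f)) a1') kC'.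
  exists (cx_cone g); split; first exact: binj_cone.
  apply: (@isomorphic_trans _ _ _ _ (cone f)); first by exists c.
  apply: (cone_isomorphic kC kC' ia1 ib1).
  by rewrite -eg -dcompA ha1 dcomp_idr.
- move=> X Y [_ [i [p [_ [_ [pi _ _ _ _]]]]]] [C [hC [f [g [gf fg]]]]].
  apply: (binj_retract (i := dcomp f i) (p := dcomp p g) hC).
  by rewrite -dcompA [dcomp g _]dcompA gf dcomp_idl.
Qed.
End BoundedInjective.

(* A linear relation with total converse and trivial kernel embeds W in a
   quotient of a subspace of V. *)
Lemma spanned_relation (K : fieldType) (V W : lmodType K) (R : V -> W -> Prop) n :
  dim_le (fun _ : V => True) n ->
  (forall a v v' w w', R v w -> R v' w' -> R (a *: v + v') (a *: w + w')) ->
  R 0 0 -> (forall w, R 0 w -> w = 0) -> (forall w, exists v, R v w) -> spanned W n.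
Proof.
move=> [b0 hb0] Rlin R0 Rker Rtot.
have [||b [hb1 hb2]] := @dim_le_basis _ V (fun v => exists w, R v w) n.
- split; first by exists 0.
  by move=> a x y [u hu] [w hw]; exists (a *: u + w); apply: Rlin.
- by exists b0 => v _; apply: hb0.
have [w hw] := choice hb1; exists w => x.
have [v hv] := Rtot x; have [|c ec] := hb2 v; first by exists x.
exists c; apply/eqP; rewrite -subr_eq0; apply/eqP; apply: Rker.
have hsum : R v (\sum_i c i *: w i).
  rewrite ec; elim/big_rec2: _ => [|i y z _ h]; first exact: R0.
  exact: Rlin.
by have := Rlin (-1) _ _ _ _ hsum hv; rewrite !scaleN1r addNr addrC.
Qed.

Lemma vect_dim (K : fieldType) (V : vectType K) :
  dim_le (fun _ : V => True) (\dim {: V}).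
Proof.
exists (fun i => tnth (vbasis {: V}) i) => v _.
exists (fun i => coord (vbasis {: V}) i v).
rewrite {1}(coord_vbasis (memvf v)).
by apply: eq_bigr => i _; rewrite -(tnth_nth 0).
Qed.

(** * Finiteness and boundedness of Hom spaces *)

Section HomFinite.
Variables (K : fieldType) (L : falgType K) (D : derived (complexes L)).
Implicit Types C J : complex L.
Local Notation loc f := (@loc K (complexes L) D _ _ f).

(** A chain map is determined by its values on K-linear generators, recorded in a matrix. Not every
    matrix arises, and a map may have several, hence a relation between matrices and morphisms
    instead of a map. *)
Lemma hom_spanned C J : fin_dimensional (C : lmodType L^c) ->
  fin_dimensional (J : lmodType L^c) -> k_injective J ->
  exists k, spanned (dhom D C J) k.
Proof.
move=> [p [b hb]] [q [b' hb']] kJ.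
pose Rf (M : 'M[K]_(p, q)) (f : chain_map C J) := forall i,
  (f (b i) : kmod J) = \sum_j M i j *: (b' j : kmod J).
exists (\dim {: 'M[K]_(p, q)}).
apply: (spanned_relation (R := fun M w => exists f, Rf M f /\ w = loc f)) (vect_dim _) _ _ _ _.
- move=> a M M' _ _ [f [hf ->]] [f' [hf' ->]]; exists (cm_lincomb a f f'); split.
    move=> i; rewrite /= -[kscale a (f (b i))]/(a *: (f (b i) : kmod J)).
    rewrite hf hf' scaler_sumr; apply: etrans (esym (big_split _ _ _ _ _)) _.
    by apply: eq_bigr => j _; rewrite !mxE scalerDl scalerA.
  by rewrite (loc_lin D a (f : Defs.hom (_ : obj (complexes L)) _)).
- exists (cm_zero C J); split; last by rewrite loc_cm_zero.
  by move=> i; rewrite /= big1 // => j _; rewrite mxE scale0r.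
- move=> _ [f [hf ->]]; rewrite -(loc_cm_zero D C J); congr Defs.loc.
  apply: chain_map_eq => x /=; have [//|c ->] := hb x.
  rewrite kmod_sumE (big_morph f (id1 := 0) (op1 := +%R)).
  + rewrite big1 // => i _; rewrite -[c i *: b i]/(kscale (c i) (b i : C)).
    rewrite (linZ _ _ (cm_lin f)) hf big1 ?scaler0 // => j _.
    by rewrite mxE scale0r.
  + exact: cmD.
  + exact: cm0.
- move=> w; have [f ->] := k_injective_realize w kJ.
  have /choice[M hM] : forall i, exists c : 'I_q -> K, (f (b i) : kmod J) = \sum_j c j *: (b' j : kmod J).
    by move=> i; have [//|c ec] := hb' (f (b i)); exists c.
  exists (\matrix_(i, j) M i j), f; split=> // i; rewrite hM.
  by apply: eq_bigr => j _; rewrite mxE.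
Qed.

(** For |n| > |N| + |M| the complexes S^n C and J have no common nonzero degree, so every chain map
    is zero. *)
Lemma hom_bounded C J : bounded C -> bounded J -> k_injective J ->
  exists B : nat, forall n, B%:Z < `|n| ->
    is_trivial (dhom D (shift n (C : obj (complexes L))) J).
Proof.
move=> [N hN] [M hM] kJ; exists (`|N| + `|M|)%N => n hn w.
have [f ->] := k_injective_realize w kJ.
rewrite -(loc_cm_zero D (cx_shift n C) J); congr Defs.loc; apply: chain_map_eq.
apply: (homogeneous_ind (P := fun x => f x = cm_zero (cx_shift n C) J x)) => /=.
  split; first exact: cm0.
  by move=> a x y hx hy; rewrite (cm_lin f) hx hy scaler0 addr0.
move=> m x hx; have [h|h] := ltP N `|m + n|; first by rewrite (hN _ _ h hx) cm0.
by apply: (hM m); [lia | apply: (cm_deg f hx)].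
Qed.
End HomFinite.

(** * Detecting cohomology by injective modules *)

Section Stalks.
Variables (K : fieldType) (L : falgType K) (D : derived (complexes L)).
Variables (r : nat) (S I : 'I_r -> lmodType L^c).
Hypotheses (S_spec : simple_representatives S)
  (I_spec : forall j, injective_of_simple (S j) (I j)).
Local Notation loc f := (@loc K (complexes L) D _ _ f).

Lemma stalk_binj j : bounded_injective_complex (stalk (I j)).
Proof.
have [sS _ _] := S_spec; have fd := injective_hull_fin_dim (sS j) (I_spec j).
have [inj _ _] := I_spec j.
have sub n : submodule (gr (stalk (I j)) n).
  by split; [apply: gr0 | move=> a x y; apply: gr_lin].
split.
- exists 0 => n x n0 [e|//]; by rewrite e in n0.
- move=> n; apply: fin_dim_gen; first exact: sub.
  apply/fin_dimP; have [k [b hb]] := fd; by exists k, b => x _; apply: hb.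
move=> n A B p f lp ip lf hf; have [n0|n0] := eqVneq n 0.
  have [//|g [lg _ eg]] := inj A B p f lp ip lf.
  by exists g; split=> // y; left.
exists (fun=> 0); split; [exact: zero_linear | by move=> y; right |].
by move=> x; case: (hf x) => // e; rewrite e eqxx in n0.
Qed.

Lemma thick_I_binj Z : thick_of D (fun j => stalk (I j)) Z -> binj D Z.
Proof.
move=> h; apply: h (binj_thick D) _ => _ [j ->]; exists (stalk (I j)).
by split; [apply: stalk_binj | apply: isomorphic_refl].
Qed.

(** If a cycle x is no boundary, the submodule generated by its class in C / im d contains a copy of
    some simple module S_k. The embedding of S_k in I_k extends to C / im d, which gives a chain map
    to the stalk I_k in degree n that is nonzero on a cycle l x. *)
Lemma detect_acyclic (C : complex L) :
  (forall m k, is_trivial (dhom D C (shift m (stalk (I k))))) -> acyclic C.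
Proof.
move=> hC.
have sB : subspace (fun y => exists z, y = cx_d C z).
  split; first by exists 0; rewrite cx_d0.
  by move=> a _ _ [u ->] [v ->]; exists (a *: u + v); rewrite (@cx_d_lin _ _ C).
suff hom n x : gr C n x -> cx_d C x = 0 -> exists z, x = cx_d C z.
  move=> x dx; apply: (gproj_ind sB) => n; apply: (hom n); first exact: gr_gproj.
  by rewrite -gproj_d dx (lin0 (gproj_lin _)).
move=> hx dx; apply: contrapT => nx.
have x0 : qpi sB x != 0 by apply/eqP => /qpi0.
have [M [f [sM lf fi hf]]] := simple_submodule x0.
have [_ _ hS] := S_spec; have [k [g lg bg]] := hS M sM.
have [inj _ [i li ii]] := I_spec k.
have lig : linear (fun s => i (g s)) := linear_compf li lg.
have [//|G [lG _ eG]] := inj M _ f (fun s => i (g s)) lf fi lig.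
have [[s s0] _] := sM; have [l el] := hf s.
pose chi (y : C) : shift (- n) (stalk (I k)) := G (qpi sB (gproj n y)).
have chi_lin : linear chi.
  exact: (linear_compf lG (linear_compf (qpi_lin sB) (gproj_lin n))).
have chi_deg m y : gr C m y -> gr (cx_shift (- n) (stalk (I k))) m (chi y).
  move=> hy; rewrite /chi (gproj_gr _ hy); case: eqP => [->|_].
    by left; rewrite subrr.
  by right; rewrite (lin0 (qpi_lin sB)) (lin0 lG).
have chid y : chi (cx_d C y) = 0.
  rewrite /chi -[n](subrK 1) gproj_d (_ : qpi sB _ = 0) ?(lin0 lG) //.
  by apply/qpi0; exists (gproj (n - 1) y).
have chi_comm y : chi (cx_d C y) = cx_d (cx_shift (- n) (stalk (I k))) (chi y).
  by rewrite chid /= /kscale scaler0.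
pose chim := @ChainMap _ _ C (cx_shift (- n) (stalk (I k))) chi chi_lin chi_deg chi_comm.
(* If [chim] vanishes in D, it is null-homotopic after a quasi-isomorphism a. Lifting the cycle l x
   through a, up to a boundary, gives chi (l x) = 0, since the differential of the target is
   zero. *)
have [V [a [[_ as_] [h [lh _ eh]]]]] := loc0_killed (hC (- n) k (loc chim)).
have [|w [z [ew ez]]] := as_ (l *: x); first by rewrite (linZ _ _ (@cx_d_lin _ _ C)) dx scaler0.
have ne : i (g s) <> 0.
  move=> e; case/eqP: s0; apply: (bij_inj bg); apply: ii.
  by rewrite e (lin0 lg) (lin0 li).
apply: ne; rewrite -eG el -(linZ _ _ (qpi_lin sB)) -[l *: x](gproj_id (n := n)); last exact: grZ.
rewrite -[LHS]/(chi (l *: x)) ez (linD _ _ chi_lin) chid addr0.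
by have /= := eh w; rewrite ew (lin0 lh) addr0 /kscale scaler0.
Qed.
End Stalks.

(** * Morphisms out of projective A_oo-modules *)

Section StasheffHead.
Variables (K : fieldType) (A M N : gmod K).
Variables (mA : A -> seq A -> A) (mM : M -> seq A -> M) (g : M -> seq A -> N).

(** Sorts the terms by what happens to x: m_1(x), an operation on x and b together, or none on x.
    The last terms form a Stasheff sum over A with x as a parameter, which links structure equations
    of M to maps out of the free module. *)
Lemma stasheff_sum_cons d x e b (a : seq (int * A)) :
  stasheff_sum mA mM g d x ((e, b) :: a) =
  (-1) ^+ (size a).+1 *: g (mM x [::]) (b :: [seq p.2 | p <- a]) +
  sum_split (fun v w => (-1) ^+ size w *:
     g (mM x (b :: [seq p.2 | p <- v])) [seq p.2 | p <- w]) a +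
  (-1) ^ ((size a).+1%:Z * (1 + d)) *: stasheff_sum mA mA
     (fun c s => (-1) ^ ((1 + d) * (size s)%:Z) *: g x (c :: s)) e b a.
Proof.
have n1 : (-1 : K) != 0 by rewrite oppr_eq0 oner_eq0.
rewrite {1}/stasheff_sum !sum_split_cons -!addrA; congr (_ + (_ + _)).
rewrite /stasheff_sum scalerDr !scaler_sum_split; congr (_ + _).
  apply: eq_sum_split => v w ea; rewrite !scalerA size_map exprnP -!expfzDr //.
  congr (_ *: _); apply: (@sgn_eq _ (- (size w)%:Z * (1 + d))).
  by rewrite ea size_cat /total_degree big_nil /=; nia.
apply: eq_sum_split => u [|c t] ea; first by rewrite scaler0.
rewrite scaler_sum_split; apply: eq_sum_split => v w et /=.
rewrite !scalerA -!expfzDr //; congr (_ *: _).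
rewrite ea et /total_degree big_cons !size_cat /= !size_cat !size_map.
apply: (@sgn_eq _ (- ((size u).+1 + size w)%N%:Z * (1 + d))).
by rewrite -/(total_degree u) /=; nia.
Qed.
End StasheffHead.

(** * A_oo-null-homotopies *)

Section NullHomotopy.
Variables (K : fieldType) (A : ainf_alg K) (M N : ainf_mod A).
Variables (p : ainf_hom M N) (H : M -> seq A -> N).
Hypotheses (H_lin : multilinear H) (H_deg : has_degree (fun n => - n%:Z) H)
  (H_one : forall x s, aa_one A \in s -> H x s = 0).
Hypothesis H_eq : forall d x a, gr M d x -> homogeneous a ->
  p x [seq q.2 | q <- a] = stasheff_sum (aa_m A) (am_m M) H d x a +
    sum_split (fun v w => (-1) ^+ size w *:
      am_m N (H x [seq q.2 | q <- v]) [seq q.2 | q <- w]) a.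

Let C := am_cone (ah_id M).
Let Psi (z : C) (s : seq A) : N := p z.1 s + (-1) ^ (1 * (0 + (size s)%:Z)) *: H z.2 s.

Lemma cone_psi_lin : multilinear Psi.
Proof.
have [[p1 p2] [h1 h2]] := (ah_multilin p, H_lin).
split=> [s|z u v] c y t; rewrite /Psi /=.
  by rewrite p1 h1 !scalerDr !scalerA [c * _]mulrC addrACA.
by rewrite p2 h2 !size_cat !scalerDr !scalerA [c * _]mulrC addrACA.
Qed.

Lemma cone_psi_deg : has_degree (fun n => 1 - n%:Z) Psi.
Proof.
move=> d z a [h1 h2] ha; apply: grD; first exact: ah_deg.
by apply: grZ; have := H_deg h2 ha; congr (gr N _ _); lia.
Qed.

Lemma cone_psi_eq d z a : gr C d z -> homogeneous a ->
  stasheff_sum (aa_m A) (am_m C) Psi d z a = op_comp (am_m N) Psi z [seq q.2 | q <- a].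
Proof.
move=> [h1 h2] ha; have [[m1 _] _ _] := am_axiom N.
have [p1 _] := ah_multilin p; have [hH1 _] := H_lin.
have n1 : (-1 : K) != 0 by rewrite oppr_eq0 oner_eq0.
rewrite stasheff_sumD.
have -> : stasheff_sum (aa_m A) (am_m C)
     (fun z s => (-1) ^ (1 * (0 + (size s)%:Z)) *: H z.2 s) d z a =
     (-1) ^ (1 * (0 + (size a).+1%:Z)) *:
       stasheff_sum (aa_m A) (am_m M) H (d + 1) z.2 a.
  apply: (etrans (@stasheff_sum_strict K A C (am_shift 1 M) N (am_m C)
     (am_m (am_shift 1 M)) snd (fun y s => (-1) ^ (1 * (0 + (size s)%:Z)) *: H y s)
     d z a (fun _ _ => erefl))).
  exact: (@shift_stasheff_sum K A 1 M N H 0 d z.2 a hH1).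
have -> : stasheff_sum (aa_m A) (am_m C) (fun z s => p z.1 s) d z a =
    op_comp (am_m N) p z.1 [seq q.2 | q <- a] + (-1) ^+ size a *: p z.2 [seq q.2 | q <- a].
  rewrite -(ah_eq p h1 ha) /stasheff_sum addrAC; congr (_ + _).
  transitivity (sum_split (fun v w => (-1) ^+ size w *:
      p (am_m M z.1 [seq q.2 | q <- v]) [seq q.2 | q <- w]) a +
     sum_split (fun v w => (-1) ^+ size w *: p ((-1) ^+ size (map (fun q : int * A => q.2) v) *:
       (ah_id M) z.2 [seq q.2 | q <- v]) [seq q.2 | q <- w]) a).
    rewrite -sum_splitD; apply: eq_sum_split => v w _.
    by rewrite -scalerDr -(linD _ _ (p1 _)).
  congr (_ + _); rewrite sum_split_first /= ?scale1r // => q u v.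
  by rewrite scaler0 (lin0 (p1 _)) scaler0.
rewrite (H_eq h2 ha) mul1r add0r scalerDr !addrA -exprnP -[RHS]addr0.
rewrite exprS mulN1r scaleNr; set S := _ *: stasheff_sum _ _ _ _ _ _.
rewrite [X in X - S]addrAC addrK /op_comp scaler_sum_split addr0.
rewrite !sum_split_map -sum_splitD; apply: eq_sum_split => v w ea.
rewrite (linD _ _ (m1 _)) (linZ _ _ (m1 _)) scalerA; congr (_ + _ *: _).
rewrite mul1r add0r size_map -exprnP -exprD ea size_cat -addnA exprD addnn -mul2n exprM sqrrN expr1n.
by rewrite expr1n mulr1.
Qed.

Lemma cone_psi_one z s : aa_one A \in s -> Psi z s = 0.
Proof. by move=> h; rewrite /Psi H_one // ah_one_vanish // scaler0 addr0. Qed.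

(** [H_eq] says that H is a homotopy from p to 0; the pair is a morphism on the cone of the
    identity, with a sign at H coming from the shift of M. *)
Definition cone_psi : ainf_hom C N := AinfHom cone_psi_lin cone_psi_deg cone_psi_eq cone_psi_one.

Lemma cone_psi_in : ah_comp cone_psi (am_cone_in (ah_id M)) = p.
Proof.
apply: ainf_hom_eq => x s; have [h1 _] := H_lin; have [p1 _] := ah_multilin p.
rewrite /= /op_comp sum_split_first => [|y u v].
  by rewrite /= /Psi /= (lin0 (h1 _)) scaler0 addr0.
by rewrite /= /Psi /= (lin0 (h1 _)) (lin0 (p1 _)) scaler0 addr0.
Qed.

Lemma cone_id_acyclic (z : C) : am_m C z [::] = 0 -> exists t, z = am_m C t [::].
Proof.
have [[m1 _] _ _] := am_axiom M.
case: z => y x /= [e1 e2]; exists (0, y).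
have ex : x = - am_m M y [::].
  by apply/eqP; rewrite -addr_eq0 addrC; move: e1; rewrite expr0 scale1r => ->.
congr pair; rewrite /= ?(lin0 (m1 _)) ?add0r ?expr0 ?scale1r //.
by rewrite /shift_op ex mul1r expr1z scaleN1r.
Qed.

Variable D : derived (ainf_modules A).

(** As for complexes, [p] factors through the cone of the identity. Its zero endomorphism [zz] is a
    quasi-isomorphism, so the cone is a zero object. *)
Lemma null_homotopic_ainf : loc D (p : Defs.hom (M : obj (ainf_modules A)) N) = 0.
Proof.
pose zz : Defs.hom (C : obj (ainf_modules A)) C := lincomb (-1) (idm (C : obj (ainf_modules A))) (idm _).
have z0 x s : (zz : ainf_hom C C) x s = 0 by rewrite /= scaleN1r addNr.
have hz : qis zz.
  split=> [x hx _|y /cone_id_acyclic[x ->]].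
    exact: cone_id_acyclic.
  exists 0, x; have [[m1 _] _ _] := am_axiom C.
  by rewrite z0 add0r; split=> //; apply: (lin0 (m1 _)).
have [k [e _]] := loc_qis D hz.
have d0 : did D (C : obj (ainf_modules A)) = 0 by rewrite -e loc_zero comp0r.
rewrite -cone_psi_in (loc_comp D (cone_psi : Defs.hom (C : obj (ainf_modules A)) N)).
by rewrite -[loc D (am_cone_in _)]dcomp_idl d0 comp0l comp0r.
Qed.
End NullHomotopy.

(** * H^0 as a functor on the derived category *)

Section Cohomology.
Variables (K : fieldType) (A : ainf_alg K).
Implicit Types M N : ainf_mod A.

Lemma am_d_lin M : linear (fun x : M => am_m M x [::]).
Proof. by have [[m1 _] _ _] := am_axiom M; apply: m1. Qed.

Arguments am_d_lin : clear implicits.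

Lemma homogeneous_nil : homogeneous ([::] : seq (int * A)). Proof. by []. Qed.

Lemma am_d_deg M n (x : M) : gr M n x -> gr M (n + 1) (am_m M x [::]).
Proof.
move=> hx; have [_ md _] := am_axiom M.
by have := md _ _ _ hx homogeneous_nil; rewrite /total_degree big_nil addr0.
Qed.

Lemma ah_fun_lin M N (g : ainf_hom M N) : linear (fun x : M => g x [::]).
Proof. by have [h _] := ah_multilin g; apply: h. Qed.

Arguments ah_fun_lin {M N} g.

Lemma ah_fun_deg M N (g : ainf_hom M N) n (x : M) : gr M n x -> gr N n (g x [::]).
Proof.
move=> hx; have := ah_deg g hx homogeneous_nil.
by rewrite /total_degree big_nil /= subrr !addr0.
Qed.

Lemma ah_fun_d M N (g : ainf_hom M N) (x : M) :
  g (am_m M x [::]) [::] = am_m N (g x [::]) [::].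
Proof.
apply: (homogeneous_ind (P := fun x => g (am_m M x [::]) [::] = am_m N (g x [::]) [::])).
  split; first by rewrite !(lin0 (am_d_lin _), lin0 (ah_fun_lin g)).
  by move=> a u v hu hv; rewrite am_d_lin !ah_fun_lin am_d_lin hu hv.
move=> n {}x hx; have := ah_eq g hx homogeneous_nil.
by rewrite /stasheff_sum /op_comp !sum_split_nil addr0 expr0 scale1r.
Qed.

Lemma am_gproj_d M n (x : M) : gproj (n + 1) (am_m M x [::]) = am_m M (gproj n x) [::].
Proof. exact: (gproj_morph (f := fun x => am_m M x [::]) (am_d_lin M) (@am_d_deg M)). Qed.

Lemma am_gproj_f M N (g : ainf_hom M N) n (x : M) :
  gproj n (g x [::]) = g (gproj n x) [::].
Proof.
rewrite -[n in LHS]addr0.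
apply: (gproj_morph (f := fun x => g x [::]) (ah_fun_lin g)) => k y hy.
by rewrite addr0; apply: ah_fun_deg.
Qed.

Definition cocycle0 M (x : M) := gr M 0 x /\ am_m M x [::] = 0.
Definition class0 M (x : M) : M -> Prop :=
  fun y => exists2 z, gr M (-1) z & y - x = am_m M z [::].
(** H^0 as a bare set of cosets: [loc_univ] accepts any target category, and only equality of
    classes is used. *)
Definition coh0 M : Type := {U : M -> Prop | exists2 x, cocycle0 x & U = class0 x}.

Lemma class0_eq M (x y : M) : class0 x = class0 y <->
  exists2 z, gr M (-1) z & y - x = am_m M z [::].
Proof.
split=> [e|[z hz e]].
  have : class0 y y by exists 0; [apply: gr0 | rewrite subrr (lin0 (am_d_lin M))].
  by rewrite -e.
apply: funext => u; apply: propext; split=> -[w hw ew].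
  exists (w - z); first exact: grB.
  rewrite (linD _ _ (am_d_lin M)) (linN _ (am_d_lin M)) -ew -e.
  by rewrite opprB addrA subrK.
exists (w + z); first exact: grD.
by rewrite (linD _ _ (am_d_lin M)) -ew -e addrA subrK.
Qed.

Definition coh_pi M (x : M) (hx : cocycle0 x) : coh0 M :=
  exist _ (class0 x) (ex_intro2 _ _ x hx erefl).

Lemma coh_surj M (U : coh0 M) : exists x (hx : cocycle0 x), U = coh_pi hx.
Proof. by case: U => U [x hx e]; subst U; exists x, hx; apply: eq_exist. Qed.

Lemma cocycle0_map M N (g : ainf_hom M N) (x : M) : cocycle0 x -> cocycle0 (g x [::]).
Proof.
move=> [h1 h2]; split; first exact: ah_fun_deg.
by rewrite -ah_fun_d h2 (lin0 (ah_fun_lin g)).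
Qed.

Lemma coh_rep_ex M (U : coh0 M) : exists x, cocycle0 x /\ sval U = class0 x.
Proof. by case: U => U [x hx e]; exists x. Qed.

Definition coh_map M N (g : ainf_hom M N) (U : coh0 M) : coh0 N :=
  let c := cid (coh_rep_ex U) in coh_pi (cocycle0_map g (proj1 (svalP c))).

Lemma coh_mapE M N (g : ainf_hom M N) (x : M) (hx : cocycle0 x) :
  coh_map g (coh_pi hx) = coh_pi (cocycle0_map g hx).
Proof.
apply: eq_exist; case: cid => y [/= hy /class0_eq [z hz e]].
apply/class0_eq; exists (g (- z) [::]).
  by apply: ah_fun_deg; have := grB (gr0 M (-1)) hz; rewrite [0 - z]sub0r.
rewrite -ah_fun_d (linN _ (am_d_lin M)) -e opprB.
by rewrite (linD _ _ (ah_fun_lin g)) (linN _ (ah_fun_lin g)).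
Qed.

Lemma coh_map_id M : coh_map (ah_id M) = id.
Proof.
apply: funext => U; have [x [hx ->]] := coh_surj U; rewrite coh_mapE.
exact: eq_exist.
Qed.

Lemma coh_map_comp M N P (g : ainf_hom N P) (f : ainf_hom M N) :
  coh_map (ah_comp g f) = fun U => coh_map g (coh_map f U).
Proof.
apply: funext => U; have [x [hx ->]] := coh_surj U; rewrite !coh_mapE.
by apply: eq_exist; rewrite /= /op_comp sum_split_nil.
Qed.

Definition set_category : category :=
  @Category Type (fun A B => A -> B) (fun A x => x)
    (fun A B E (g : B -> E) (f : A -> B) x => g (f x))
    (fun _ _ _ => erefl) (fun _ _ _ => erefl) (fun _ _ _ _ _ _ _ => erefl).

Definition coh_functor : functor (ainf_modules A) set_category :=
  @Functor (ainf_modules A) set_category coh0 coh_map coh_map_id coh_map_comp.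

(** Quasi-isomorphisms are tested on total cohomology; [gproj] commutes with the differentials and
    with g_1, and so cuts out degree 0. *)
Lemma coh_map_bij M N (g : ainf_hom M N) :
  iso_on_cohomology (fun x => am_m M x [::]) (fun x => am_m N x [::])
    (fun x => g x [::]) ->
  exists h : coh0 N -> coh0 M, (fun U => h (coh_map g U)) = id /\
    (fun U => coh_map g (h U)) = id.
Proof.
move=> [gi gs].
have inj : injective (coh_map g).
  move=> U V; have [x [hx ->]] := coh_surj U; have [y [hy ->]] := coh_surj V.
  rewrite !coh_mapE => /(congr1 sval) /= /class0_eq[z hz e]; apply: eq_exist => /=.
  apply/class0_eq; have [||w ew] := gi (y - x).
  - by rewrite (linD _ _ (am_d_lin M)) (linN _ (am_d_lin M)) hx.2 hy.2 subrr.
  - by exists z; rewrite -e (linD _ _ (ah_fun_lin g)) (linN _ (ah_fun_lin g)).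
  exists (gproj (-1) w); first exact: gr_gproj.
  rewrite -am_gproj_d -ew addNr gproj_id //; apply: grB; [exact: hy.1 | exact: hx.1].
have surj V : exists U, coh_map g U = V.
  have [y [hy ->]] := coh_surj V; have [x [z [ex ey]]] := gs y hy.2.
  have hx : cocycle0 (gproj 0 x).
    split; first exact: gr_gproj.
    by rewrite -am_gproj_d ex (lin0 (gproj_lin _)).
  exists (coh_pi hx); rewrite coh_mapE; apply: eq_exist => /=.
  apply/class0_eq; exists (gproj (-1) z); first exact: gr_gproj.
  rewrite -am_gproj_d addNr -am_gproj_f -{1}(gproj_id hy.1) {1}ey.
  by rewrite (linD _ _ (gproj_lin 0)) addrC addKr.
have [h hK] := choice surj; exists h; split; apply: funext => U //.
by apply: inj; rewrite hK.
Qed.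
End Cohomology.
Arguments am_d_lin {K A} M.
Arguments ah_fun_lin {K A M N} g.

Lemma signK (K : fieldType) (V : lmodType K) n (v : V) :
  (-1) ^+ n *: ((-1) ^+ n *: v) = v.
Proof. by rewrite scalerA -exprD addnn -mul2n exprM sqrrN !expr1n scale1r. Qed.

(** * Morphisms out of the free module *)

Section FreeModule.
Variables (K : fieldType) (A : ainf_alg K).
Implicit Types M N : ainf_mod A.
Local Notation F := (free_module A).

Section FromFree.
Variables (M : ainf_mod A) (x : M) (hx : cocycle0 x).

Definition free_fun (b : F) (s : seq A) : M := (-1) ^+ size s *: am_m M x (b :: s).

Lemma homogeneous_cons e (b : A) a : gr A e b -> homogeneous a -> homogeneous ((e, b) :: a).
Proof. by move=> hb ha q; rewrite inE => /orP[/eqP ->|/ha]. Qed.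

Lemma free_fun_lin : multilinear free_fun.
Proof.
have [[m1 m2] _ _] := am_axiom M.
split=> [s|b u v] c y z; rewrite /free_fun.
  by rewrite (m2 x [::] s) scalerDr !scalerA mulrC.
by rewrite !size_cat /= (m2 x (b :: u) v) scalerDr !scalerA mulrC.
Qed.

Lemma free_fun_deg : has_degree (fun n => 1 - n%:Z) free_fun.
Proof.
move=> e b a hb ha; have [_ md _] := am_axiom M; apply: grZ.
have := md _ _ _ hx.1 (homogeneous_cons hb ha); congr (gr M _ _).
by rewrite /total_degree big_cons /=; lia.
Qed.

Lemma sign_split (a v w : seq (int * A)) : a = v ++ w ->
  (-1) ^+ size v = (-1) ^+ size a * (-1) ^+ size w :> K.
Proof.
by move=> ->; rewrite size_cat exprD -mulrA -exprD addnn -mul2n exprM sqrrN !expr1n mulr1.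
Qed.

Lemma stasheff_head N (g : M -> seq A -> N) (d : int) e (b : A) (a : seq (int * A)) :
  d = 0 -> stasheff_sum (aa_m A) (aa_m A)
     (fun c s => (-1) ^ ((1 + d) * (size s)%:Z) *: g x (c :: s)) e b a =
  stasheff_sum (aa_m A) (aa_m A) (fun c s => (-1) ^+ size s *: g x (c :: s)) e b a.
Proof.
move=> ->; congr (stasheff_sum _ _ _ _ _ _); apply: funext => c; apply: funext => s.
by rewrite addr0 mul1r -exprnP.
Qed.

(** The Stasheff equation of M at (x, b, a) with m_1(x) = 0: the terms without an operation on x
    give the left-hand side, the others the right-hand side. *)
Lemma free_fun_eq e (b : F) a : gr F e b -> homogeneous a ->
  stasheff_sum (aa_m A) (am_m F) free_fun e b a =
  op_comp (am_m M) free_fun b [seq p.2 | p <- a].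
Proof.
move=> hb ha; have [[m1 _] _ mS] := am_axiom M.
have := mS _ _ _ hx.1 (homogeneous_cons hb ha).
rewrite stasheff_sum_cons (stasheff_head (am_m M)) // hx.2 (lin0 (m1 _)) scaler0 add0r.
rewrite addr0 mulr1 -exprnP exprS mulN1r scaleNr => /eqP; rewrite subr_eq0 => /eqP h.
rewrite -[LHS](signK (size a)) -h scaler_sum_split /op_comp sum_split_map.
apply: eq_sum_split => v w ea.
by rewrite /free_fun (linZ _ _ (m1 _)) size_map (sign_split ea) scalerA.
Qed.

Lemma free_fun_one b s : aa_one A \in s -> free_fun b s = 0.
Proof.
move=> h; rewrite /free_fun am_one_vanish ?scaler0 //; last by rewrite inE h orbT.
by case: s h.
Qed.

Definition from_free : ainf_hom F M :=
  AinfHom free_fun_lin free_fun_deg free_fun_eq free_fun_one.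
End FromFree.

Variable D : derived (ainf_modules A).
Local Notation loc f := (@loc K (ainf_modules A) D _ _ f).

Lemma loc_ainf_comp M N P (g : ainf_hom N P) (f : ainf_hom M N) :
  loc (ah_comp g f) = dcomp (loc g) (loc f).
Proof. exact: (loc_comp D (g : Defs.hom (N : obj (ainf_modules A)) P)). Qed.

Lemma loc_ainf_zero M N (f : ainf_hom M N) : (forall x s, f x s = 0) -> loc f = 0.
Proof.
move=> h; rewrite -(loc_zero D (f : Defs.hom (M : obj (ainf_modules A)) N)).
congr Defs.loc; apply: ainf_hom_eq => x s; rewrite h /= h.
by rewrite scaler0 addr0.
Qed.

Section Naturality.
Variables (M N : ainf_mod A) (g : ainf_hom M N) (x : M) (hx : cocycle0 x).
Variables (y z : N) (hy : cocycle0 y) (hz : gr N (-1) z).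
Hypothesis ey : y = g x [::] + am_m N z [::].

(** The homotopy between [from_free hy] and g after [from_free hx]: the term in g absorbs its higher
    components, the term in z the coboundary. *)
Let H (b : F) (s : seq A) : N := (-1) ^+ size s *: g x (b :: s) - am_m N z (b :: s).

Lemma nat_lin : multilinear H.
Proof.
have [g1 g2] := ah_multilin g; have [[m1 m2] _ _] := am_axiom N.
split=> [s|b u v] c p q; rewrite /H.
  rewrite (g2 x [::] s) (m2 z [::] s) scalerDr scalerBr !scalerA mulrC.
  by rewrite opprD addrACA.
rewrite !size_cat /= (g2 x (b :: u) v) (m2 z (b :: u) v) scalerDr scalerBr !scalerA mulrC.
by rewrite opprD addrACA.
Qed.

Lemma nat_deg : has_degree (fun n => - n%:Z) H.
Proof.
move=> e b a hb ha; have [_ md _] := am_axiom N.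
have hc := homogeneous_cons hb ha; apply: grB.
  apply: grZ; have := ah_deg g hx.1 hc; congr (gr N _ _).
  by rewrite /total_degree big_cons /=; lia.
have := md _ _ _ hz hc; congr (gr N _ _).
by rewrite /total_degree big_cons /=; lia.
Qed.

Lemma nat_one b s : aa_one A \in s -> H b s = 0.
Proof.
move=> h; rewrite /H ah_one_vanish ?inE ?h ?orbT // am_one_vanish ?inE ?h ?orbT //.
  by rewrite scaler0 subr0.
by case: s h.
Qed.

Let p : ainf_hom F N :=
  ah_lincomb (-1) (from_free hy) (ah_comp g (from_free hx)).

(** Combines the morphism equation of g at (x, b, a) with the Stasheff equation of N at (z, b, a),
    both sorted by [stasheff_sum_cons]. *)
Lemma nat_eq e (b : F) a : gr F e b -> homogeneous a ->
  p b [seq q.2 | q <- a] = stasheff_sum (aa_m A) (am_m F) H e b a +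
    sum_split (fun v w => (-1) ^+ size w *:
      am_m N (H b [seq q.2 | q <- v]) [seq q.2 | q <- w]) a.
Proof.
move=> hb ha; have [g1 g2] := ah_multilin g; have [[m1 m2] _ mS] := am_axiom N.
have hc := homogeneous_cons hb ha.
pose G := stasheff_sum (aa_m A) (aa_m A) (fun c s => (-1) ^+ size s *: g x (c :: s)) e b a.
pose Z := stasheff_sum (aa_m A) (aa_m A) (fun c s => am_m N z (c :: s)) e b a.
have -> : stasheff_sum (aa_m A) (am_m F) H e b a = G - Z.
  rewrite -scaleN1r addrC /Z linear_stasheff_sum -?stasheff_sumD; last first.
    by move=> k u v; rewrite scalerDr !scalerA mulrC.
  by congr (stasheff_sum _ _ _ _ _ _); apply: funext => c; apply: funext => s;
    rewrite scaleN1r addrC.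
have eG := ah_eq g hx.1 hc.
rewrite stasheff_sum_cons (stasheff_head x g) // -/G hx.2 (lin0 (g1 _)) scaler0 add0r in eG.
rewrite addr0 mulr1 -exprnP /op_comp /= sum_split_cons sum_split_map in eG.
have eZ := mS _ _ _ hz hc.
rewrite stasheff_sum_cons subrr mulr0 expr0z scale1r in eZ.
have eZ' : stasheff_sum (aa_m A) (aa_m A) (fun c s => (-1) ^ (0 * (size s)%:Z) *: am_m N z (c :: s)) e b a = Z.
  congr (stasheff_sum _ _ _ _ _ _); apply: funext => c; apply: funext => s.
  by rewrite mul0r expr0z scale1r.
rewrite eZ' in eZ.
set n := size a in eG eZ *.
rewrite /= /free_fun /op_comp sum_split_map size_map -/n ey.
rewrite (linD _ _ (m1 _)).
set u := am_m N (g x [::]) _ in eG *; set w := am_m N (am_m N z [::]) _ in eZ *.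
set T1 := sum_split _ a in eG; set T2 := sum_split _ a in eG; set T3 := sum_split _ a in eZ.
have -> : sum_split (fun v w => g ((-1) ^+ size [seq q.2 | q <- v] *:
    am_m M x (b :: [seq q.2 | q <- v])) [seq q.2 | q <- w]) a = (-1) ^+ n *: T1.
  rewrite /T1 scaler_sum_split; apply: eq_sum_split => v w' ea.
  by rewrite (linZ _ _ (g1 _)) size_map scalerA (sign_split ea).
have -> : sum_split (fun v w => (-1) ^+ size w *:
      am_m N (H b [seq q.2 | q <- v]) [seq q.2 | q <- w]) a = (-1) ^+ n *: T2 - T3.
  rewrite /T2 /T3 scaler_sum_split -scaleN1r scaler_sum_split -sum_splitD.
  apply: eq_sum_split => v w' ea.
  rewrite /H (linD _ _ (m1 _)) (linN _ (m1 _)) (linZ _ _ (m1 _)) scalerDr scalerN scaleN1r.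
  congr (_ - _); rewrite scalerA size_map (sign_split ea) mulrCA -exprD addnn -mul2n exprM.
  by rewrite sqrrN !expr1n mulr1.
have {}eG : (-1) ^+ n *: T1 = G + (-1) ^+ n *: (u + T2).
  by rewrite -eG exprS mulN1r scaleNr scalerBr signK addrC subrK.
have {}eZ : (-1) ^+ n *: w = T3 + Z.
  move: eZ; rewrite exprS mulN1r scaleNr => /eqP; rewrite -addrA addrC subr_eq0.
  by move/eqP.
have sum6 (V : zmodType) (c t1 t2 t3 t4 : V) :
    - (c + (t1 + t2)) + (t3 + (c + t4)) = t3 - t2 + (t4 - t1).
  rewrite addrCA -[RHS]addrA; congr (_ + _).
  by rewrite opprD addrACA addNr add0r opprD [LHS]addrC [RHS]addrCA [- t1 - _]addrC.
by rewrite eG scaleN1r !scalerDr eZ sum6.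
Qed.

Lemma from_free_natural : dcomp (loc g) (loc (from_free hx)) = loc (from_free hy).
Proof.
have := null_homotopic_ainf nat_lin nat_deg nat_one nat_eq D.
rewrite (loc_lin D (-1) (_ : Defs.hom (F : obj (ainf_modules A)) N)) scaleN1r.
by move/eqP; rewrite addrC subr_eq0 -loc_ainf_comp => /eqP.
Qed.
End Naturality.
End FreeModule.

(** * The projectives eA and the simple modules *)

Section Yoneda.
Variables (K : fieldType) (A : ainf_alg K) (r : nat) (e : 'I_r -> A).
Hypotheses (A_min : minimal A) (A_pos : positive e).
Variable D : derived (ainf_modules A).
Local Notation loc f := (@loc K (ainf_modules A) D _ _ f).
Local Notation F := (free_module A).

Lemma idem_deg j : gr A 0 (e j).
Proof. by have [_ _ [h _ _ _] _] := A_pos; case: (h j). Qed.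

Lemma idem_neq0 j : e j != 0.
Proof. by have [_ _ [h _ _ _] _] := A_pos; case: (h j). Qed.

Lemma idem_mul i j : aa_m A (e i) [:: e j] = if i == j then e i else 0.
Proof. by have [_ _ [_ h _ _] _] := A_pos; apply: h. Qed.

Lemma idem_vanish j s : size s != 1 -> aa_m A (e j) s = 0.
Proof.
move=> hs; have [_ _ _ h] := A_pos; apply: h hs _; exists (e j).
  exact: mem_head.
exact: idem_deg.
Qed.

Lemma aa_lin1 s : linear (fun x : A => aa_m A x s).
Proof. by have [[m1 _] _ _] := aa_axiom A; apply: m1. Qed.

Lemma aa_lin2 x u v : linear (fun y : A => aa_m A x (u ++ y :: v)).
Proof. by have [[_ m2] _ _] := aa_axiom A; apply: m2. Qed.

Lemma aa_lin11 x : linear (fun y : A => aa_m A x [:: y]).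
Proof. exact: (aa_lin2 x [::] [::]). Qed.

(** With m_1 = 0 the Stasheff equation in three arguments is associativity of m_2. *)
Lemma idem_assoc i j b : aa_m A (e i) [:: aa_m A (e j) [:: b]] =
  aa_m A (aa_m A (e i) [:: e j]) [:: b].
Proof.
apply: (homogeneous_ind (P := fun b => aa_m A (e i) [:: aa_m A (e j) [:: b]] =
  aa_m A (aa_m A (e i) [:: e j]) [:: b])).
  split; first by rewrite !(lin0 (aa_lin11 _)).
  by move=> a x y hx hy; rewrite !aa_lin11 hx hy.
move=> n {}b hb; have [_ _ mS] := aa_axiom A.
have hc : homogeneous [:: (0, e j); (n, b)].
  by apply: homogeneous_cons (idem_deg j) _; apply: homogeneous_cons hb _.
have := mS _ _ _ (idem_deg i) hc.
rewrite /stasheff_sum !sum_split_cons !sum_split_nil /= !A_min.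
rewrite (lin0 (aa_lin1 _)) !scaler0 !add0r !addr0.
rewrite /total_degree !big_nil.
have -> : aa_m A (e i) [:: 0; b] = 0 by exact: lin0 (aa_lin2 (e i) [::] [:: b]).
have -> : aa_m A (e i) [:: e j; 0] = 0 by exact: lin0 (aa_lin2 (e i) [:: e j] [::]).
rewrite !scaler0 !add0r addr0 => /eqP.
rewrite expr1 scaleN1r addrC -exprnP expr2 mulN1r opprK scale1r subr_eq0.
by move/eqP.
Qed.

Section Projective.
Variables (j : 'I_r) (P : ainf_mod A) (i : P -> A).
Hypothesis P_spec : idempotent_submodule (e j) i.

Lemma proj_lin : linear i. Proof. by have [[h _] _ _ _] := P_spec. Qed.
Lemma proj_inj : injective i. Proof. by have [[_ h] _ _ _] := P_spec. Qed.
Lemma proj_deg d x : gr P d x -> gr F d (i x).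
Proof. by have [_ h _ _] := P_spec; move/h. Qed.
Lemma proj_m x s : i (am_m P x s) = am_m F (i x) s.
Proof. by have [_ _ h _] := P_spec; apply: h. Qed.

Definition proj_incl : ainf_hom P F :=
  @ah_strict K A P F i proj_lin proj_deg proj_m.

Lemma proj_gen_exists : exists x, i x = e j.
Proof.
have [_ _ _ h] := P_spec; apply/h; exists (e j).
by rewrite idem_mul eqxx.
Qed.

Lemma proj_image x : aa_m A (e j) [:: i x] = i x.
Proof.
have [_ _ _ h] := P_spec; have [b ->] : exists b, i x = aa_m A (e j) [:: b].
  by apply/h; exists x.
by rewrite idem_assoc idem_mul eqxx.
Qed.

Definition proj_gen : P := sval (cid proj_gen_exists).
Lemma proj_genE : i proj_gen = e j.
Proof. by rewrite /proj_gen; case: cid. Qed.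

Lemma proj_gen_cocycle : cocycle0 proj_gen.
Proof.
split; first by have [_ h _ _] := P_spec; apply/h; rewrite proj_genE; apply: idem_deg.
by apply: proj_inj; rewrite proj_m /= A_min (lin0 proj_lin).
Qed.

Section Element.
Variables (M : ainf_mod A) (x : M) (hx : cocycle0 x).

Definition from_proj : dhom D P M := dcomp (loc (from_free hx)) (loc proj_incl).

Lemma from_projE b s : ah_comp (from_free hx) proj_incl b s =
  (-1) ^+ size s *: am_m M x (i b :: s).
Proof.
rewrite /= /op_comp sum_split_first // => y u v; rewrite /free_fun /=.
have [[_ m2] _ _] := am_axiom M.
by rewrite (lin0 (m2 x [::] v)) scaler0.
Qed.
End Element.

(** The first component is b |-> e_j b = b on e_j A; the higher ones are operations m_n, n >= 3,
    with the argument e_j of degree 0, and vanish by positivity. *)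
Lemma from_proj_gen : from_proj proj_gen_cocycle = did D P.
Proof.
rewrite /from_proj -loc_ainf_comp -(loc_id D (P : obj (ainf_modules A))).
congr Defs.loc; apply: ainf_hom_eq => b s; rewrite from_projE.
apply: proj_inj; rewrite (linZ _ _ proj_lin) proj_m proj_genE.
case: s => [|y s]; first by rewrite expr0 scale1r /= proj_image.
by rewrite [am_m F _ _]idem_vanish // scaler0 /= (lin0 proj_lin).
Qed.

Section Extension.
Variable G : forall X Y : ainf_mod A, dhom D X Y -> coh0 X -> coh0 Y.
Hypotheses (G_id : forall X : ainf_mod A, G (did D X) = id)
  (G_comp : forall (X Y Z : ainf_mod A) (g : dhom D Y Z) (f : dhom D X Y),
     G (dcomp g f) = fun U => G g (G f U))
  (G_loc : forall (X Y : ainf_mod A) (f : ainf_hom X Y), G (loc f) = coh_map f).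

(** By [derived_ind]. As the claim concerns classes, any representative may be taken at the middle
    of a composite; the inverse of a quasi-isomorphism reduces to the quasi-isomorphism itself. *)
Lemma from_proj_natural (M N : ainf_mod A) (f : dhom D M N)
    x (hx : cocycle0 (x : M)) y (hy : cocycle0 (y : N)) :
  G f (coh_pi hx) = coh_pi hy -> from_proj hy = dcomp f (from_proj hx).
Proof.
move: M N f x hx y hy.
pose R (M N : obj (ainf_modules A)) (f : dhom D M N) :=
  forall (x : (M : ainf_mod A)) (hx : cocycle0 x) (y : (N : ainf_mod A)) (hy : cocycle0 y),
  @G M N f (coh_pi hx) = coh_pi hy -> from_proj hy = dcomp f (from_proj hx).
suff : forall M N f, @R M N f by [].
apply: derived_ind => [M N f|M N Q g f hg hf|M N f g hf [gf fg]] x hx y hy.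
- rewrite [@G _ _ _](G_loc f) coh_mapE => /(congr1 sval) /= /class0_eq[z hz ez].
  rewrite /from_proj dcompA; congr dcomp; apply: esym.
  apply: (@from_free_natural K A D M N f x hx y z hy hz).
  by rewrite -ez addrC subrK.
- rewrite (G_comp g f); have [u [hu eu]] := coh_surj (G f (coh_pi hx)).
  rewrite eu => /hg -> ; rewrite -dcompA; congr dcomp; exact: hf.
- move=> h; have : G (Defs.loc D f) (coh_pi hy) = coh_pi hx.
    by rewrite -h -[LHS]/((fun U => G (Defs.loc D f) (G g U)) (coh_pi hx)) -G_comp fg G_id.
  rewrite [@G _ _ _](G_loc f) coh_mapE => /(congr1 sval) /= /class0_eq[z hz ez].
  have -> : from_proj hx = dcomp (Defs.loc D f) (from_proj hy).
    rewrite /from_proj dcompA; congr dcomp; apply: esym.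
    apply: (@from_free_natural K A D M N f y hy x z hx hz).
    by rewrite -ez addrC subrK.
  by rewrite dcompA gf dcomp_idl.
Qed.
End Extension.

Lemma coh_extension : exists G : forall X Y : ainf_mod A, dhom D X Y -> coh0 X -> coh0 Y,
  [/\ forall X : ainf_mod A, G X X (did D X) = id,
   forall (X Y Z : ainf_mod A) (g : dhom D Y Z) (f : dhom D X Y),
     G X Z (dcomp g f) = fun U => G Y Z g (G X Y f U)
   & forall (X Y : ainf_mod A) (f : ainf_hom X Y), G X Y (loc f) = coh_map f].
Proof.
have [|G [hG _]] := @loc_univ _ _ D set_category (coh_functor A); last by exists G.
move=> X Y f hf; have [h [h1 h2]] := coh_map_bij hf.
by exists h.
Qed.

(** Yoneda: the generator corresponds to the identity of P, so naturality recovers f from its value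
    on the class of the generator. *)
Lemma from_proj_surj (M : ainf_mod A) (f : dhom D P M) :
  exists (x : M) (hx : cocycle0 x), f = from_proj hx.
Proof.
have [G [G1 G2 G3]] := coh_extension.
have [x [hx ex]] := coh_surj (G P M f (coh_pi proj_gen_cocycle)).
exists x, hx; rewrite (from_proj_natural G1 G2 G3 ex) from_proj_gen.
by rewrite dcomp_idr.
Qed.

(** On H^0 the morphism sends the class of the generator to that of x e_j, and a zero morphism sends
    it to 0. *)
Lemma from_proj_eq0 (M : ainf_mod A) (x : M) (hx : cocycle0 x) : from_proj hx = 0 ->
  exists z, am_m M x [:: e j] = am_m M z [::].
Proof.
have [G [G1 G2 G3]] := coh_extension => h.
have := G3 _ _ (ah_comp (from_free hx) proj_incl).
rewrite loc_ainf_comp -[dcomp _ _]/(from_proj hx) h.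
pose zf : ainf_hom P M := ah_lincomb (-1) (ah_comp (from_free hx) proj_incl) (ah_comp (from_free hx) proj_incl).
have zf0 b s : zf b s = 0 by rewrite /= scaleN1r addNr.
rewrite -(loc_ainf_zero D zf0) G3 => /(congr1 (fun f => f (coh_pi proj_gen_cocycle))).
rewrite !coh_mapE => /(congr1 sval) h2.
have /class0_eq[z hz] : class0 (zf (proj_gen) [::]) =
  class0 (ah_comp (from_free hx) proj_incl proj_gen [::]) := h2.
by rewrite zf0 subr0 from_projE expr0 scale1r proj_genE => ez; exists z.
Qed.
End Projective.

Section Simple.
Variables (k : 'I_r) (Y : ainf_mod A).
Hypothesis Y_spec : simple_ainf_module (e k) Y.

Lemma positive_degree_gproj (b : A) : positive_degree b -> gproj 0 b = 0.
Proof.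
move=> [s [hs ps ->]]; rewrite gprojE // big_seq_cond big1 // => p /andP[/ps h /eqP e0].
by rewrite e0 ltxx in h.
Qed.

Lemma degree_split (b : A) : exists c b', [/\ gr A 0 c, positive_degree b' & b = c + b'].
Proof.
have [s [hs ->]] := gr_span b; have [_ neg _ _] := A_pos.
exists (\sum_(p <- s | p.1 == 0) p.2), (\sum_(p <- s | 0 < p.1) p.2); split.
- rewrite big_seq_cond; elim/big_ind: _ => [|x y|p]; [exact: gr0 | exact: grD |].
  by move=> /andP[ps /eqP <-]; apply: hs.
- exists [seq p <- s | 0 < p.1]; split; last by rewrite big_filter.
    by move=> p; rewrite mem_filter => /andP[_ /hs].
  by move=> p; rewrite mem_filter => /andP[].
rewrite [LHS](bigID (fun p => p.1 == 0)) /=; congr (_ + _).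
rewrite big_mkcond [RHS]big_mkcond [LHS]big_seq [RHS]big_seq.
apply: eq_bigr => p ps; have [p0|p0|//] := ltgtP p.1 0.
  by rewrite (neg _ _ p0 (hs p ps)).
by [].

Qed.

Lemma idem_gproj n b : gproj n (aa_m A (e k) [:: b]) = aa_m A (e k) [:: gproj n b].
Proof.
rewrite -[n in LHS]addr0.
apply: (gproj_morph (f := fun b => aa_m A (e k) [:: b])); first exact: aa_lin11.
move=> m x hx; have [_ md _] := aa_axiom A.
have hc : homogeneous [:: (m, x)] by apply: homogeneous_cons hx _.
have := md _ _ _ (idem_deg k) hc; congr (gr A _ _).
by rewrite /total_degree big_cons big_nil /= subrr !addr0 add0r.
Qed.

Lemma simple_generator : exists y : Y, [/\ y != 0 /\ gr Y 0 y,
  forall z, exists c, z = c *: y,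
  forall s, size s != 1 -> am_m Y y s = 0,
  forall l b, l != k -> am_m Y y [:: aa_m A (e l) [:: b]] = 0
  & am_m Y y [:: e k] = y].
Proof.
have [P [i [q [Pi [lq sq] dq mq kq]]]] := Y_spec.
have li := proj_lin Pi; have ii := proj_inj Pi; have mi := proj_m Pi.
pose p0 := proj_gen Pi; have ip0 : i p0 = e k := proj_genE Pi.
exists (q p0); split.
- split; last by apply: dq; case: (proj_gen_cocycle Pi).
  apply/eqP => /kq[b hb]; rewrite ip0 => eb; case/eqP: (idem_neq0 k).
  rewrite -(gproj_id (idem_deg k)) eb idem_gproj positive_degree_gproj //.
  exact: lin0 (aa_lin11 _).
- move=> z; have [x <-] := sq z; have [b' [b [hb' hb eb]]] := degree_split (i x).
  have [_ _ [_ _ _ h] _] := A_pos; have [c ec] := h _ hb'.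
  exists (c k); apply/eqP; rewrite -subr_eq0 -(linZ _ _ lq) -(linN _ lq) -(linD _ _ lq).
  apply/eqP/kq; exists b => //.
  rewrite (linD _ _ li) (linN _ li) (linZ _ _ li) ip0 -(proj_image Pi) eb.
  rewrite (linD _ _ (aa_lin11 _)) ec.
  rewrite (big_morph (fun y : A => aa_m A (e k) [:: y]) (id1 := 0) (op1 := +%R)).
  + rewrite (bigD1 k) //= (linZ _ _ (aa_lin11 _)) idem_mul eqxx big1.
      by rewrite addr0 addrAC subrr add0r.
    by move=> l lk; rewrite (linZ _ _ (aa_lin11 _)) idem_mul eq_sym (negPf lk) scaler0.
  + by move=> u v; rewrite (linD _ _ (aa_lin11 _)).
  + exact: lin0 (aa_lin11 _).
- move=> s hs; rewrite -mq (_ : am_m P p0 s = 0) ?(lin0 lq) //.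
  by apply: ii; rewrite mi ip0 (lin0 li); apply: idem_vanish.
- move=> l b lk; rewrite -mq (_ : am_m P p0 _ = 0) ?(lin0 lq) //.
  apply: ii; rewrite mi ip0 (lin0 li) -[LHS]/(aa_m A (e k) [:: aa_m A (e l) [:: b]]).
  by rewrite idem_assoc idem_mul eq_sym (negPf lk) (lin0 (aa_lin1 _)).
- rewrite -mq; congr q; apply: ii; rewrite mi ip0.
  by rewrite -[LHS]/(aa_m A (e k) [:: e k]) idem_mul eqxx.
Qed.

Lemma simple_Dfd : Dfd (Y : obj (ainf_modules A)).
Proof.
have [y [_ span _ _ _]] := simple_generator; exists [:: y] => x _.
have [c ->] := span x; exists (fun=> c), 0.
have [[m1 _] _ _] := am_axiom Y.
by rewrite (lin0 (m1 _)) addr0 big_ord1.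
Qed.

(** Each morphism comes from a degree-zero cocycle of S^m Y, and Y is spanned by some y of degree 0.
    The degree excludes m <> 0, and y e_j = 0 excludes k <> j. Otherwise y e_k = y is no coboundary,
    the differential of Y being zero, so y gives a nonzero morphism. *)
Lemma simple_hom j (P : ainf_mod A) (i : P -> A) m :
  idempotent_submodule (e j) i ->
  if (k == j) && (m == 0) then is_line (dhom D P (am_shift m Y))
  else is_trivial (dhom D P (am_shift m Y)).
Proof.
move=> Pi; have [y [[y0 dy] span van ann act]] := simple_generator.
have [[m1 _] _ _] := am_axiom Y.
have n1 : (-1 : K) != 0 by rewrite oppr_eq0 oner_eq0.
have image b : exists b', i b = aa_m A (e j) [:: b'].
  by exists (i b); rewrite proj_image.
have zero (x : am_shift m Y) (hx : cocycle0 x) :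
    (forall b s, am_m Y x (i b :: s) = 0) -> from_proj Pi hx = 0.
  move=> h; rewrite /from_proj -loc_ainf_comp; apply: loc_ainf_zero => b s.
  by rewrite from_projE /= /shift_op h !scaler0.
have [|kjm] := boolP ((k == j) && (m == 0)); last first.
  move=> f; have [x [hx ->]] := from_proj_surj Pi f; apply: zero => b s.
  have [c ec] := span x; move: kjm; rewrite negb_and => /orP[kj|m0].
    rewrite ec (linZ _ _ (m1 _)); case: s => [|a s].
      by have [b' ->] := image b; rewrite ann ?scaler0 // eq_sym.
    by rewrite van // scaler0.
  suff -> : (x : Y) = 0 by rewrite (lin0 (m1 _)).
  have hxm : gr Y m x by have := hx.1; rewrite /= add0r.
  have hx0 : gr Y 0 x by rewrite ec; apply: grZ.
  by rewrite -(gproj_id hxm) (gproj_gr _ hx0) eq_sym (negPf m0).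
case/andP => /eqP kj /eqP m0; subst j m.
have hy : cocycle0 (y : am_shift 0 Y).
  by split; rewrite /= ?addr0 // /shift_op van ?scaler0.
exists (from_proj Pi hy).
  apply/eqP => /from_proj_eq0[z]; rewrite /= /shift_op act.
  have [c ->] := span z; rewrite (linZ _ _ (m1 _)) van // !scaler0 => /eqP.
  rewrite scaler_eq0 (negPf y0) orbF expfz_eq0 (negPf n1) andbF.
  by [].
move=> f; have [x [hx ->]] := from_proj_surj Pi f; have [c ec] := span x.
exists c; rewrite /from_proj -!loc_ainf_comp.
pose cy := ah_comp (from_free hy) (proj_incl Pi).
(* [lincomb] always adds a second morphism, so c times [cy] is written as c cy + 0, with 0 realized
   by [z0]. *)
pose z0 : ainf_hom P (am_shift 0 Y) := ah_lincomb (-1) cy cy.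
have z00 : loc z0 = 0 by apply: loc_ainf_zero => b s; rewrite /= scaleN1r addNr.
rewrite -[RHS]addr0 -[in RHS]z00.
rewrite -[RHS](loc_lin D c (cy : Defs.hom (P : obj (ainf_modules A)) _)).
congr Defs.loc; apply: ainf_hom_eq => b s.
rewrite -[RHS]/(c *: cy b s + (-1 *: cy b s + cy b s)) scaleN1r addNr addr0.
rewrite !from_projE /= /shift_op ec (linZ _ _ (m1 _)) !scalerA.
by congr (_ *: _); rewrite mulrC -!mulrA [c * _]mulrC.
Qed.
End Simple.
End Yoneda.

(** * The theorem *)

Section FunctorShift.
Variables (K : fieldType) (C C' : dg_model K) (D : derived C) (D' : derived C').
Variables (P : obj C -> Prop) (P' : obj C' -> Prop) (F : prefunctor D D').

Lemma equivalence_hom X Y : linear_functor P P' F -> equivalence P P' F ->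
  P X -> P Y -> lin_equiv (dhom D X Y) (dhom D' (F X) (F Y)).
Proof.
move=> [_ _ _ lF] [bF _] hX hY; exists (fun f => phom F f); split; last exact: bF.
by move=> a f g; apply: lF.
Qed.

Lemma functor_isomorphic X Y : linear_functor P P' F -> P X -> P Y ->
  isomorphic D X Y -> isomorphic D' (F X) (F Y).
Proof.
move=> [_ h1 h2 _] hX hY [f [g [gf fg]]]; exists (phom F f), (phom F g).
by split; rewrite -h2 // ?gf ?fg h1.
Qed.

Hypotheses (add : forall m n X, isomorphic D (shift n (shift m X)) (shift (m + n) X))
  (zero : forall X, isomorphic D (shift 0 X) X)
  (add' : forall m n X, isomorphic D' (shift n (shift m X)) (shift (m + n) X))
  (zero' : forall X, isomorphic D' (shift 0 X) X)
  (P_shift : forall m X, P X -> P (shift m X)).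

(** A triangle functor comes with an isomorphism for S only. Iteration treats m >= 0; for m < 0 the
    result for -m is applied to S^m X and shifted back. *)
Lemma functor_shift m X : triangle_functor P P' F -> P X ->
  isomorphic D' (F (shift m X)) (shift m (F X)).
Proof.
move=> [lF [eta [heta _ _]]].
have hn n (Z : obj C) : P Z -> isomorphic D' (F (shift n%:Z Z)) (shift n%:Z (F Z)).
  move=> hZ; elim: n => [|n IH].
    apply: isomorphic_trans (isomorphic_sym (zero' _)).
    by apply: (functor_isomorphic lF) => //; apply: P_shift.
  have e : n.+1%:Z = n%:Z + 1 by lia.
  apply: (@isomorphic_trans _ _ _ _ (F (shift 1 (shift n%:Z Z)))).
    apply: (functor_isomorphic lF); do ?exact: P_shift.
      by apply: P_shift; apply: P_shift.
    by rewrite e; apply: isomorphic_sym.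
  apply: (@isomorphic_trans _ _ _ _ (shift 1 (F (shift n%:Z Z)))).
    by exists (eta (shift n%:Z Z)); apply: heta; apply: P_shift.
  apply: (isomorphic_trans (isomorphic_shift 1 IH)).
  by rewrite e; apply: add'.
move=> hX; case: (intP m) => [|n|n]; [exact: (hn 0%N) | exact: hn |].
set W := shift _ X; have hW : P W by apply: P_shift.
have i1 : isomorphic D' (F X) (shift n.+1%:Z (F W)).
  apply: isomorphic_trans (hn n.+1 W hW); apply: (functor_isomorphic lF) => //.
    exact: P_shift.
  apply: isomorphic_sym; apply: (isomorphic_trans (add _ _ _)).
  by rewrite addNr.
apply: isomorphic_sym; apply: (isomorphic_trans (isomorphic_shift _ i1)).
by apply: (isomorphic_trans (add' _ _ _)); rewrite subrr.
Qed.
End FunctorShift.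

Section AinfShifts.
Variables (K : fieldType) (A : ainf_alg K) (D : derived (ainf_modules A)).

Lemma same_differential_qis (M N : ainf_mod A) (f : ainf_hom M N) (g : N -> M) :
  (forall x, f (g x) [::] = x) -> injective (fun x => f x [::]) ->
  qis (f : Defs.hom (M : obj (ainf_modules A)) N).
Proof.
move=> fg fi; split=> [x hx [y ey]|y hy].
  by exists (g y); apply: fi; rewrite ah_fun_d fg.
exists (g y), 0; rewrite fg (lin0 (am_d_lin N)) addr0; split=> //.
by apply: fi; rewrite ah_fun_d fg hy (lin0 (ah_fun_lin f)).
Qed.

Lemma ainf_shift_add m n (X : obj (ainf_modules A)) :
  isomorphic D (shift n (shift m X)) (shift (m + n) X).
Proof.
exists (loc D (shift_add m n X)); apply: loc_qis_iso.
exact: (@same_differential_qis _ _ (am_shift_add X m n) id).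
Qed.

Lemma ainf_shift_zero (X : obj (ainf_modules A)) : isomorphic D (shift 0 X) X.
Proof.
apply: isomorphic_sym; exists (loc D (shift_zero X)); apply: loc_qis_iso.
exact: (@same_differential_qis _ _ (am_shift_zero X) id).
Qed.
End AinfShifts.

Section Orthogonal.
Variables (K : fieldType) (L : falgType K) (D : derived (complexes L)).
Implicit Types X Y Z W : obj (complexes L).

Lemma lin_equiv_shift0 m X Z :
  lin_equiv (dhom D X (shift m Z)) (dhom D (shift (- m) X) Z).
Proof.
have := lin_equiv_shift2 D 0 m X Z; rewrite sub0r; apply: lin_equiv_trans.
apply: lin_equiv_iso (isomorphic_refl _ _).
exact: isomorphic_sym (shift_zero_isomorphic D X).
Qed.

Lemma orthogonal_thick W :
  thick_subcategory D (fun Z => forall m, is_trivial (dhom D (shift m W) Z)).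
Proof.
split.
- by move=> Z hZ m f; rewrite -[f]dcomp_idl hZ comp0l.
- move=> Z; split=> h m.
    apply: is_trivial_equiv (h (m + 1)).
    by have := lin_equiv_shift2 D (m + 1) 1 W Z; rewrite addrK.
  exact: is_trivial_equiv (lin_equiv_sym (lin_equiv_shift2 D m 1 W Z)) (h (m - 1)).
- move=> X Y Z u v w h hX hY m f.
  have [|g ->] := triangle_exact_cov (triangle_rotate h) (f := f).
    suff : is_trivial (dhom D (shift m W) (shift 1 X)) by apply.
    exact: is_trivial_equiv (lin_equiv_sym (lin_equiv_shift2 D m 1 W X)) (hX (m - 1)).
  by rewrite (hY m g) comp0r.
- move=> X Y [_ [i [p [_ [_ [pi _ _ _ _]]]]]] hY m f.
  by rewrite -[f]dcomp_idl -pi -dcompA (hY m (dcomp i f)) comp0r.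
Qed.

(** The identity is a multiple of the given generator of the line, and a nonzero one, since
    otherwise the generator would vanish. *)
Lemma line_scalar X : is_line (dhom D X X) -> forall f, exists c, f = c *: did D X.
Proof.
move=> [v v0 hv] f; have [c ec] := hv (did D X); have [d ->] := hv f.
have c0 : c != 0.
  by apply: contra_neq v0 => c0; rewrite -[v]dcomp_idr ec c0 scale0r comp0r.
by exists (d / c); rewrite ec scalerA divfK.
Qed.
End Orthogonal.

Theorem lemma4p9
  (K : closedFieldType) (L : falgType K) (L_basic : basic L)
  (D : derived (complexes L))
  (* r is the rank of the Grothendieck group of mod L *)
  (K0 : zmodType) (cl : fd_module L -> K0) (K0_spec : grothendieck_group cl)
  (r : nat) (K0_rank : free_rank K0 r)
  (* simple modules, and the corresponding indecomposable injectives *)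
  (S I : 'I_r -> lmodType L^c)
  (S_spec : simple_representatives S)
  (I_spec : forall j, injective_of_simple (S j) (I j))
  (X : 'I_r -> obj (complexes L)) (X_spec : simple_minded D X)
  (* the A_oo-algebra of the simples, and Phi : D^b(mod L) -> per *)
  (SS : obj (complexes L))
  (iS : forall a, dhom D (stalk (S a)) SS) (pS : forall a, dhom D SS (stalk (S a)))
  (SS_spec : direct_sum iS pS)
  (AS : ainf_alg K) (thetaS : forall m : int, dhom D SS (shift m SS) -> AS)
  (AS_spec : positive_end_algebra iS pS thetaS)
  (DS : derived (ainf_modules AS))
  (Phi : prefunctor D DS)
  (Phi_equiv : triangle_equivalence (Db D) (per DS) Phi)
  (Phi_S : forall j, isomorphic_to_idempotent_module DS
     (idempotent_of iS pS thetaS j) (Phi (stalk (S j))))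
  (Phi_restr : triangle_equivalence (thick_of D (fun j => stalk (I j))) (@Dfd K AS) Phi)
  (* the A_oo-algebra of X_1, ..., X_r, and Psi *)
  (XX : obj (complexes L))
  (iX : forall a, dhom D (X a) XX) (pX : forall a, dhom D XX (X a))
  (XX_spec : direct_sum iX pX)
  (AX : ainf_alg K) (thetaX : forall m : int, dhom D XX (shift m XX) -> AX)
  (AX_spec : positive_end_algebra iX pX thetaX)
  (DX : derived (ainf_modules AX))
  (Psi : prefunctor DS DX)
  (Psi_equiv : triangle_equivalence (fun=> True) (fun=> True) Psi)
  (Psi_per : triangle_equivalence (per DS) (per DX) Psi)
  (Psi_Dfd : triangle_equivalence (@Dfd K AS) (@Dfd K AX) Psi)
  (PsiPhi_X : forall i, isomorphic_to_idempotent_module DX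
     (idempotent_of iX pX thetaX i) (Psi (Phi (X i))))
  (* the simple modules over AX, and their images T_i *)
  (Y : 'I_r -> obj (ainf_modules AX))
  (Y_spec : forall i, simple_ainf_module (idempotent_of iX pX thetaX i) (Y i))
  (G : prefunctor DX D)
  (G_spec : quasi_inverse (thick_of D (fun j => stalk (I j))) (@Dfd K AX)
     (prefunctor_comp Psi Phi) G)
  (T : obj (complexes L))
  (iT : forall i, dhom D (G (Y i)) T) (pT : forall i, dhom D T (G (Y i)))
  (T_spec : direct_sum iT pT) :
  [/\ forall Z, thick D (fun Z' => Z' = T) Z <-> thick_of D (fun j => stalk (I j)) Z,
      forall i j (m : int), if (i == j) && (m == 0)
        then is_line (dhom D (X j) (shift m (G (Y i))))
        else is_trivial (dhom D (X j) (shift m (G (Y i)))),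
      exists C, bounded_injective_complex C /\ isomorphic D T C,
      forall C, Dminus D C ->
        (forall m : int, is_trivial (dhom D C (shift m T))) -> zero_object D C
    & forall m : int, 0 < m -> is_trivial (dhom D T (shift m T))].

Proof.
have [X_Db X_neg X_hom Db_thick] := X_spec.
set thickI := thick_of D (fun j => stalk (I j)) in Phi_restr G_spec *.
have tI : thick_subcategory D thickI := thick_thick D _.
have tX : thick_subcategory D (thick_of D X) := thick_thick D _.
have I_Db Z : thickI Z -> Db D Z.
  by move=> h; apply: binj_Db; apply: (thick_I_binj S_spec I_spec h).
have Db_shift m Z : Db D Z -> Db D (shift m Z).
  by move=> /Db_thick h; apply/Db_thick; apply/(thick_shift tX).
have [_ AX_min AX_pos] := AX_spec.
have Y_Dfd i : @Dfd K AX (Y i) by apply: (simple_Dfd AX_min AX_pos (Y_spec i)).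
have [[G_thick _ _ _] _ [eta [eta_iso _]]] := G_spec.
pose T_ i := G (Y i).
have T_I i : thickI (T_ i) by apply: G_thick.
have FT i : isomorphic DX (Psi (Phi (T_ i))) (Y i).
  by exists (eta (Y i)); apply: eta_iso.
(* Psi Phi carries X_j to P_j and T_i to Y_i, so [simple_hom] can be transported back. Phi is fully
   faithful on D^b, which contains T_i by [I_Db]. *)
have bb i j (m : int) : if (i == j) && (m == 0)
    then is_line (dhom D (X j) (shift m (T_ i)))
    else is_trivial (dhom D (X j) (shift m (T_ i))).
  have [P [p [hP iP]]] := PsiPhi_X j.
  have e : lin_equiv (dhom DX P (am_shift m (Y i))) (dhom D (X j) (shift m (T_ i))).
    have [tPhi ePhi] := Phi_equiv; have [tPsi ePsi] := Psi_equiv.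
    have [lPhi _] := tPhi; have [lPsi _] := tPsi.
    have dT := I_Db _ (T_I i); have dS := Db_shift m _ dT.
    apply: lin_equiv_sym.
    apply: (lin_equiv_trans (equivalence_hom lPhi ePhi (X_Db j) dS)).
    apply: (lin_equiv_trans (@equivalence_hom _ _ _ _ _ _ _ _ (Phi (X j)) (Phi (shift m (T_ i))) lPsi ePsi Logic.I Logic.I)).
    apply: lin_equiv_iso iP _.
    apply: (@isomorphic_trans _ _ _ _ (Psi (shift m (Phi (T_ i))))).
      apply: (functor_isomorphic lPsi) => //.
      exact: (functor_shift (shift_add_isomorphic D) (shift_zero_isomorphic D)
        (ainf_shift_add DS) (ainf_shift_zero DS) Db_shift m tPhi dT).
    apply: isomorphic_trans (isomorphic_shift m (FT i)).
    exact: (@functor_shift _ _ _ DS DX (fun=> True) (fun=> True) Psi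
      (@ainf_shift_add _ _ DS) (@ainf_shift_zero _ _ DS) (@ainf_shift_add _ _ DX)
      (@ainf_shift_zero _ _ DX) (fun _ _ h => h) m (Phi (T_ i)) tPsi Logic.I).
  have := simple_hom AX_min AX_pos DX (Y_spec i) m hP.
  by case: ifP => _ h; [apply: is_line_equiv e h | apply: is_trivial_equiv e h].
have Xneg i j n : 0 < n -> is_trivial (dhom D (shift n (X i)) (X j)).
  move=> n0; have h := lin_equiv_shift0 D (- n) (X i) (X j); rewrite opprK in h.
  by apply: is_trivial_equiv h _; apply: X_neg; lia.
have Xne i j : i != j -> is_trivial (dhom D (X i) (X j)).
  by move=> /negPf ij; have := X_hom i j; rewrite ij.
have Xend i (f : dhom D (X i) (X i)) : exists c, f = c *: did D (X i).
  by apply: line_scalar; have := X_hom i i; rewrite eqxx.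
have XT i j n : if (i == j) && (n == 0)
    then is_line (dhom D (shift n (X j)) (T_ i))
    else is_trivial (dhom D (shift n (X j)) (T_ i)).
  have := bb i j (- n); rewrite oppr_eq0.
  have h := lin_equiv_shift0 D (- n) (X j) (T_ i); rewrite opprK in h.
  by case: ifP => _; [apply: is_line_equiv | apply: is_trivial_equiv].
have T_X i : thick_of D X (T_ i) by apply/Db_thick; apply: I_Db.
have TI : thickI T by apply: (thick_direct_sum tI T_spec).
have XT0 j n : n != 0 -> is_trivial (dhom D (shift n (X j)) T).
  move=> n0 f; have [_ _ eT] := T_spec; rewrite -[f]dcomp_idl -eT comp_suml.
  rewrite big1 // => i _; rewrite -dcompA.
  have := XT i j n; rewrite (negPf n0) andbF => /(_ (dcomp (pT i) f)) ->.
  exact: comp0r.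
have aa Z : thick D (fun Z' => Z' = T) Z <-> thickI Z.
  split=> [h|hZ]; first by apply: h tI _ => _ ->.
  set Q := thick D _; have tQ : thick_subcategory D Q := thick_thick D _.
  have QT i : Q (T_ i).
    by apply: (direct_sum_thick tQ i T_spec); apply: thick_sub.
  (* Replacing Z by a bounded injective complex, and each X_i by a bounded complex of
     finite-dimensional modules, makes every Hom(S^n X_i, Z) finite-dimensional, and zero for large
     |n|. *)
  have [J [hJ iJ]] := thick_I_binj S_spec I_spec hZ.
  have kJ := binj_k_injective hJ; have fJ := binj_fin_dim hJ.
  have [bJ _ _] := hJ.
  have eJ i n (C : complex L) : isomorphic D (X i) C ->
      lin_equiv (dhom D (cx_shift n C) J) (dhom D (shift n (X i)) Z).
    move=> h; apply: lin_equiv_iso (isomorphic_sym iJ).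
    exact: isomorphic_shift (isomorphic_sym h).
  have /choice[b hb] i : exists B : nat, forall n, B%:Z < `|n| ->
      is_trivial (dhom D (shift n (X i)) Z).
    have [C [bC _ iC]] := X_Db i; have [B hB] := hom_bounded D bC bJ kJ.
    by exists B => n hn; apply: is_trivial_equiv (eJ i n C iC) (hB n hn).
  pose B := (\sum_i b i)%N.
  have hB i n : B%:Z < `|n| -> is_trivial (dhom D (shift n (X i)) Z).
    move=> hn; apply: hb; apply: le_lt_trans hn.
    by rewrite lez_nat /B (bigD1 i) //= leq_addr.
  have fin i n : exists k, spanned (dhom D (shift n (X i)) Z) k.
    have [C [bC fC iC]] := X_Db i.
    have fC' : fin_dimensional (cx_shift n C : lmodType L^c) := bounded_fin_dim bC fC.
    have [k hk] := hom_spanned D fC' fJ kJ.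
    by exists k; apply: spanned_equiv (eJ i n C iC) hk.
  have sh i n : lin_equiv (dhom D (shift (n - B%:Z) (X i)) Z)
      (dhom D (shift n (X i)) (shift B%:Z Z)).
    exact: lin_equiv_sym (lin_equiv_shift2 D n B%:Z (X i) Z).
  have fin' i n : exists k, spanned (dhom D (shift n (X i)) (shift B%:Z Z)) k.
    by have [k hk] := fin i (n - B%:Z); exists k; apply: spanned_equiv hk.
  (* Hom(S^n X_i, S^B Z) = Hom(S^(n-B) X_i, Z) vanishes unless 0 <= n <= 2B; this is the range of
     [generated_by_T] with N = 2B + 1. *)
  apply/(thick_shift tQ B%:Z).
  have [e he] := choice (fun i => fin' i 0).
  apply: (generated_by_T Xneg Xne Xend T_X XT tQ QT (N := (B + B).+1)
    (d := (\sum_i e i)%N)) => //.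
  - by apply/(thick_shift tX); apply/Db_thick; apply: I_Db.
  - by move=> i n n0; apply: is_trivial_equiv (sh i n) _; apply: hB; lia.
  - by move=> i n n0; apply: is_trivial_equiv (sh i n) _; apply: hB; lia.
  - by exists e.
split=> //.
- exact: (thick_I_binj S_spec I_spec TI).
- move=> C _ hC; apply: acyclic_zero_object; apply: (detect_acyclic (D := D) S_spec I_spec).
  have hT m : is_trivial (dhom D (shift m C) T).
    have h := lin_equiv_shift0 D (- m) C T; rewrite opprK in h.
    exact: is_trivial_equiv h (hC (- m)).
  move=> m k; apply: is_trivial_equiv (lin_equiv_sym (lin_equiv_shift0 D m C _)) _.
  (* The objects Z with Hom(S^n C, Z) = 0 for all n form a thick subcategory; it contains T, hence
     by a) every I_k. *)
  have : thick D (fun Z' => Z' = T) (stalk (I k)) by apply/aa; apply: thick_sub; exists k.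
  by move=> h; apply: (h _ (orthogonal_thick D C)) => _ -> n; apply: hT.
(* T is in the coaisle by b), and S^m T is in the right orthogonal: Hom(S^n X_j, S^m T) =
   Hom(S^(n-m) X_j, T) with n - m < 0 when n <= 0 < m. *)
- move=> m m0; apply: (coaisle_orthogonal Xneg Xne Xend).
  + by apply/Db_thick; apply: I_Db.
  + by move=> j n n0; apply: XT0; lia.
  + move=> j n n0; apply: is_trivial_equiv (lin_equiv_sym (lin_equiv_shift2 D n m (X j) T)) _.
    by apply: XT0; lia.
Qed.
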